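(* Let $N$ be the marked Hawkes process described in the context, and assume $\|F\|_{L^1}<1$ and $\int_0^\infty tF(t)\,dt<\infty$. Fix $A\in\boldsymbol{\mathcal X}$ and put $\nu(v)=v\,m\,\mathbb{Q}(A)\,(\|R\|_{L^1}+1)$ for $v\ge 0$. Then the family of processes $\{(T^{-1}N(Tv,A))_{T\ge 0},\ v\ge 0\}$ converges to the function $\nu$ point-wise in $L^2(\mathbb{P})$ as $T\to\infty$; that is, for each $v\ge 0$, $$T^{-1}N(Tv,A)-\nu(v)\longrightarrow 0\quad\text{in } L^2(\mathbb{P})\text{ as }T\to\infty .$$
   Context: Setting. $(\Omega,\mathcal F,\mathbb P)$ is a probability space and $(\mathcal X,\boldsymbol{\mathcal X})$ is a Borel space; $\partial$ is a point external to $\mathcal X$. A marked point process with mark space $\mathcal X$ is a sequence $N=((T_n,X_n))_{n\ge1}$ of random elements, where $T_n$ takes values in $(0,\infty]$, $X_n$ takes values in $\mathcal X\cup\{\partial\}$, $T_n\le T_{n+1}$, with $T_n<T_{n+1}$ if $T_n<\infty$, and $X_n=\partial$ iff $T_n=\infty$. It is identified with the integer-valued random measure $N(dt,dx)=\sum_{n\ge1}\delta_{(T_n,X_n)}(dt,dx)\mathbf 1_{\{T_n<\infty\}}$ on $\mathbb R_+\times\mathcal X$. $N$ is a marked Hawkes process: with respect to the natural filtration of $N$, the compensator of the random measure $N$ is $\kappa(t,dx)\,dt$, where $$\kappa(t,A)=\Big(m+\int_{(0,t)\times\mathcal X}f(t-s,x)\,N(ds,dx)\Big)\mathbb Q(A),\qquad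 t\ge0,\ A\in\boldsymbol{\mathcal X}.$$ Here $\mathbb Q$ is a probability measure on $(\mathcal X,\boldsymbol{\mathcal X})$, $m\ge0$ is a constant, and $f:\mathbb R_+\times\mathcal X\to\mathbb R_+$ is non-negative, bounded and measurable with $\int_{\mathcal X}\|f(\cdot,x)\|_{L^1}^2\,\mathbb Q(dx)<\infty$, where $L^1=L^1(\mathbb R_+)$. Notation. $N(t,A)=N((0,t],A)=\sum_{n\ge1}\mathbf 1_{\{T_n\le t\}}\mathbf 1_{\{X_n\in A\}}$. $F(t)=\int_{\mathcal X}f(t,x)\,\mathbb Q(dx)$ for $t\ge0$. Convolution is $g\ast h(t)=\int_0^t g(t-s)h(s)\,ds$. $R=-r$, where $r$ is the unique solution (resolvent of $-F$) of $r(t)=F\ast r(t)-F(t)$, $t\ge0$; equivalently $R=F+F\ast R$ and $R=\sum_{n\ge1}F_n$ with $F_1=F$, $F_{n+1}=F_n\ast F$. Convention: $0/0=0$. *)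

(* Defs.v *)
From HB Require Import structures.
From mathcomp Require Import all_boot all_order all_algebra.
From mathcomp Require Import all_classical all_reals all_analysis.
From mathcomp Require Import measurable_realfun.

Set Implicit Arguments.
Unset Strict Implicit.
Unset Printing Implicit Defensive.

Import Order.TTheory GRing.Theory Num.Theory.
Import numFieldNormedType.Exports.

Local Open Scope classical_set_scope.
Local Open Scope ring_scope.

(* [E] is isomorphic, as a measurable space, to a Borel subset of the line. *)
Definition borel_space (R : realType) (d : measure_display)
    (E : measurableType d) : Prop :=
  exists phi : E -> R,
    [/\ injective phi,
        measurable_fun [set: E] phi &
        forall A : set E, measurable A -> measurable (phi @` A)].

Section marked_point_process.
Context (R : realType) (dO dE : measure_display).
Context (Omega : measurableType dO) (E : measurableType dE).

(* The point [None : option E] is the external point of the mark space, so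
   that the measurable subsets of [option E] are those whose trace on [E] is
   measurable. Indices start at [0] instead of [1]. *)
Record marked_point_process (T : nat -> Omega -> \bar R)
    (X : nat -> Omega -> option E) : Prop := MarkedPointProcess {
  mpp_measurable_time : forall n, measurable_fun [set: Omega] (T n) ;
  mpp_measurable_mark : forall n (B : set (option E)),
    measurable (Some @^-1` B) -> measurable (X n @^-1` B) ;
  mpp_time_gt0 : forall n w, (0 < T n w)%E ;
  mpp_time_le : forall n w, (T n w <= T n.+1 w)%E ;
  mpp_time_lt : forall n w, (T n w < +oo)%E -> (T n w < T n.+1 w)%E ;
  mpp_mark_external : forall n w, X n w = None <-> T n w = +oo%E }.

Definition mpp_atom (t : \bar R) (x : option E) :
    {measure set (R * E)%type -> \bar R} :=
  match t, x with
  | s%:E, Some y => \d_(s, y)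
  | _, _ => mzero
  end.

Definition mpp_measure (T : nat -> Omega -> \bar R)
    (X : nat -> Omega -> option E) (w : Omega) :
    {measure set (R * E)%type -> \bar R} :=
  mseries (fun n => mpp_atom (T n w) (X n w)) 0.

Definition mpp_count (N : Omega -> {measure set (R * E)%type -> \bar R})
    (t : R) (A : set E) (w : Omega) : \bar R :=
  N w (`]0, t]%classic `*` A).

Definition natural_filtration
    (N : Omega -> {measure set (R * E)%type -> \bar R}) (t : R) :
    set (set Omega) :=
  <<s [set C | exists s (A : set E) (B : set (\bar R)),
         [/\ 0 <= s <= t, measurable A, measurable B &
             C = mpp_count N s A @^-1` B]] >>.

(* Generators of the predictable sigma-algebra on [Omega * `[0, +oo[]. *)
Definition predictable_rectangles (F : R -> set (set Omega)) :
    set (set (Omega * R)%type) :=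
  [set C | exists2 B, F 0 B & C = B `*` [set 0]] `|`
  [set C | exists s t B, [/\ 0 <= s, s <= t, F s B &
             C = B `*` `]s, t]%classic]].

Definition predictable_process (F : R -> set (set Omega))
    (Y : Omega * R -> \bar R) : Prop :=
  @measurable_fun _ _ (g_sigma_algebraType (predictable_rectangles F)) (\bar R)
    ([set: Omega] `*` `[0, +oo[%classic) Y.

(* Measurability for the product of the predictable sigma-algebra and the
   sigma-algebra of the mark space. *)
Definition predictable_field (F : R -> set (set Omega))
    (W : (Omega * R) * E -> \bar R) : Prop :=
  @measurable_fun _ _
    (g_sigma_algebraType (predictable_rectangles F) * E)%type (\bar R)
    (([set: Omega] `*` `[0, +oo[%classic) `*` [set: E]) W.

(* [nu] is the compensator (dual predictable projection) of the random measure
   [mu] on [`[0, +oo[ * E]: [nu] is predictable, i.e. integrates nonnegative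
   predictable fields to predictable processes, and the integrals of such
   fields with respect to [mu] and [nu] have the same expectation. *)
Record compensator (P : probability Omega R) (F : R -> set (set Omega))
    (mu nu : Omega -> {measure set (R * E)%type -> \bar R}) : Prop :=
  Compensator {
  compensator_predictable : forall W : (Omega * R) * E -> \bar R,
    predictable_field F W -> (forall z, 0 <= W z)%E ->
    predictable_process F (fun z =>
      \int[nu z.1]_(y in `[0%R, z.2]%classic `*` [set: E])
         W ((z.1, y.1), y.2))%E ;
  compensator_dual : forall W : (Omega * R) * E -> \bar R,
    predictable_field F W -> (forall z, 0 <= W z)%E ->
    (\int[P]_w \int[mu w]_(y in `[0%R, +oo[%classic `*` [set: E])
        W ((w, y.1), y.2) =
     \int[P]_w \int[nu w]_(y in `[0%R, +oo[%classic `*` [set: E])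
        W ((w, y.1), y.2))%E }.

Definition hawkes_kernel (Q : probability E R) (m : R) (f : R -> E -> R)
    (N : Omega -> {measure set (R * E)%type -> \bar R})
    (w : Omega) (t : R) (A : set E) : \bar R :=
  ((m%:E + \int[N w]_(y in `]0%R, t[%classic `*` [set: E])
             (f (t - y.1)%R y.2)%:E) * Q A)%E.

Definition marked_hawkes_process (P : probability Omega R)
    (Q : probability E R) (m : R) (f : R -> E -> R)
    (T : nat -> Omega -> \bar R) (X : nat -> Omega -> option E) : Prop :=
  marked_point_process T X /\
  let N := mpp_measure T X in
  exists2 nu : Omega -> {measure set (R * E)%type -> \bar R},
    compensator P (natural_filtration N) N nu &
    forall w (B : set (R * E)%type), measurable B ->
      (nu w B = \int[lebesgue_measure]_(t in `[0%R, +oo[%classic)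
                  hawkes_kernel Q m f N w t (xsection B t))%E.

End marked_point_process.

Section half_line.
Context (R : realType).

Definition L1norm (g : R -> R) : \bar R :=
  (\int[lebesgue_measure]_(t in `[0%R, +oo[%classic) `|(g t)%:E|)%E.

Definition convolution (g h : R -> R) (t : R) : R :=
  \int[lebesgue_measure]_(s in `[0, t]%classic) (g (t - s) * h s).

Definition locally_integrable_half_line (g : R -> R) : Prop :=
  forall t, 0 <= t ->
    lebesgue_measure.-integrable `[0, t]%classic (EFin \o g).

(* Uniqueness of the resolvent is in the class of locally integrable
   functions. *)
Definition resolvent_opp (F r : R -> R) : Prop :=
  locally_integrable_half_line r /\
  forall t, 0 <= t -> r t = convolution F r t - F t.

End half_line.

Definition hawkes_fertility (R : realType) (d : measure_display)
    (E : measurableType d) (Q : probability E R) (f : R -> E -> R) : Prop :=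
  [/\ @measurable_fun _ _ (R * E)%type R (`[0, +oo[%classic `*` [set: E])
        (fun y => f y.1 y.2),
      (forall t x, 0 <= t -> 0 <= f t x),
      (exists M, forall t x, 0 <= t -> f t x <= M) &
      (\int[Q]_x (L1norm (fun t => f t x)) ^+ 2 < +oo)%E].

Definition mean_fertility (R : realType) (d : measure_display)
    (E : measurableType d) (Q : probability E R) (f : R -> E -> R) (t : R) : R :=
  \int[Q]_x f t x.

(* Main.v *)
Require Import Defs.
From mathcomp Require Import all_boot all_order all_algebra.
From mathcomp Require Import all_classical all_reals all_analysis.
From mathcomp Require Import measurable_realfun.
From mathcomp Require Import ring lra.
Import Order.TTheory GRing.Theory Num.Theory.
Import numFieldNormedType.Exports.
Local Open Scope classical_set_scope.
Local Open Scope ring_scope.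
Set Implicit Arguments.
Unset Strict Implicit.
Unset Printing Implicit Defensive.

(* Put [psi v = 1 + int_0^v R], which satisfies [psi = 1 + F * psi], and fix [t].
   For [H (s, x) = 1_A x + Q A * int_s^t f (u - s, x) psi (t - u) du], the renewal
   equation gives, path by path,
     [int H dN - int H dnu = N(t, A) - m Q(A) int_0^t psi (t - u) du].
   The first moment of [N] up to [t] is at most [m t / (1 - q)] with
   [q = ||F||_1 < 1], and [int H^2 dQ] is bounded since [f] has a square
   integrable [L^1] norm, so the isometry for compensated integrals bounds the
   variance of [N(t, A)] by a constant times [t]. As [psi] increases to
   [1 + ||R||_1], the centering of [N(T v, A)] divided by [T] tends to
   [v m Q(A) (1 + ||R||_1)]. The isometry rests on the duality
   between [N] and [nu] alone, which requires predictable integrands. *)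

(** * Integrals of nonnegative functions *)

Section analysis_complements.
Context {R : realType}.
Local Open Scope ereal_scope.
Local Notation leb := (@lebesgue_measure R).

(** The integrand [H] is the mean size of a family. In the branching picture a point born at [u] has
    a family of mean size [psi (t - u)] by time [t], itself included, so [H (s, x)] is the mean
    number of points with mark in [A] that a point at [s] with mark [x] accounts for up to [t].
    Compensating this function, and not the bare count, absorbs the dependence of the intensity on
    the past and leaves a deterministic centering. The first obstacle is finiteness. Neither moments
    of [N] nor non-explosion are assumed, while the contraction by [q] and the expansion of the
    square both end with a subtraction. Both are carried out with the process stopped at [T n],
    where at most [n.+1] points are left, with bounds free of [n]. For the same reason identities
    are written as sums wherever a term may be infinite. The second obstacle is predictability for a
    filtration generated by counts alone: the event [u <= T n] and the integral over the past of [u]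
    have to be rebuilt from countably many counts at rational times before [u]. *)

Lemma ge0_integral_shift (a : R) (g : R -> \bar R) :
  measurable_fun [set: R] g -> (forall x, 0 <= g x) ->
  \int[leb]_u g (u - a)%R = \int[leb]_u g u.
Proof.
move=> mg g0.
pose phi : measurableTypeR R -> measurableTypeR R := fun u => (u - a)%R.
have mphi : measurable_fun setT phi by apply: measurable_funB.
have H := @ge0_integral_pushforward _ _ _ _ R phi mphi leb setT g measurableT mg.
rewrite preimage_setT in H; rewrite -[LHS]H//; apply: eq_measure_integral => /= A mA _.
apply/esym/lebesgue_measure_unique => //= _ [[x y]] _ <-.
rewrite /pushforward (_ : phi @^-1` _ = `](x + a)%R, (y + a)%R]%classic); last first.
  apply/seteqP; split => u /=; rewrite /phi !in_itv/= => /andP[h1 h2]; apply/andP; split; lra.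
rewrite !lebesgue_measure_itv/= !lte_fin ltrD2r.
by case: ifP => // _; congr (_%:E); lra.
Qed.

(** Finiteness of [x] is what allows [q x] to be moved to the left: an infinite [x] would satisfy
    the inequality for every [a >= 0] once [q > 0]. Each use below has to supply it, by local
    integrability for the resolvent and by stopping for the first moment. *)
Lemma ge0_fin_contraction (x a : \bar R) (q : R) : 0 <= x -> x < +oo ->
  (0 <= q < 1)%R -> x <= a + q%:E * x -> x <= (1 - q)^-1%:E * a.
Proof.
move=> x0 xoo /andP[q0 q1].
have xf : x \is a fin_num by rewrite ge0_fin_numE.
rewrite -(fineK xf); move: (fine x) => {xf xoo x0} y.
have p1 : (0 < (1 - q)^-1)%R by rewrite invr_gt0 subr_gt0.
case: a => [a| |]; last by rewrite leeNy_eq.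
- rewrite -!EFinM -EFinD !lee_fin => H.
  by rewrite mulrC ler_pdivlMr ?subr_gt0//; lra.
- by move=> _; rewrite gt0_muley ?lte_fin// leey.
Qed.

End analysis_complements.

(** The factor may be [+oo], as an intensity may be along a path with infinitely many points. The
    product of the limits is then problematic only when the limit of [a] is 0, and monotonicity
    makes every term 0 in that case. *)
Lemma limn_nd_mulel {R : realType} (c : \bar R) (a : nat -> \bar R) :
  (0 <= c)%E -> (forall n, 0 <= a n)%E -> nondecreasing_seq a ->
  limn (fun n => c * a n)%E = (c * limn a)%E.
Proof.
move=> c0 a0 nda; have cva : cvgn a by exact: ereal_nondecreasing_is_cvgn.
case: c c0 => [c|_|//]; first by move=> c0; rewrite limeMl.
have ale n : (a n <= limn a)%E.
  have -> := cvg_lim (@ereal_hausdorff R) (ereal_nondecreasing_cvgn nda).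
  by apply: ereal_sup_ubound; exists n.
have := le_trans (a0 0) (ale 0%N); rewrite le_eqVlt => /orP[/eqP l0|l0].
  have an0 n : a n = 0%E by apply/eqP; rewrite eq_le a0 andbT l0.
  rewrite -l0 mule0; under eq_fun do rewrite an0 mule0.
  exact: lim_cst.
apply/cvg_lim => //; apply: (cvgeM _ (cvg_cst _) cva).
by rewrite mule_def_infty_neq0// gt_eqF.
Qed.

Lemma nneseries_mulel {R : realType} (c : \bar R) (u : nat -> \bar R) :
  (0 <= c)%E -> (forall n, 0 <= u n)%E ->
  (\sum_(n <oo) c * u n = c * \sum_(n <oo) u n)%E.
Proof.
move=> c0 u0; rewrite -limn_nd_mulel//.
- by apply: congr_lim; apply/funext => n; rewrite ge0_sume_distrr.
- by move=> n; exact: sume_ge0.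
- by move=> a b ab; exact: lee_sum_nneg_natr.
Qed.

Section disintegration.
Context {R : realType} (d : measure_display) (Y : measurableType d).
Local Notation s := (@lebesgue_measure R).
Context (Q : {sigma_finite_measure set Y -> \bar R}).
Context (mu : {measure set (R * Y)%type -> \bar R}).
Variables (D : set R) (mD : measurable D) (lam : R -> \bar R).
Hypothesis mlam : measurable_fun D lam.
Hypothesis lam0 : forall x, D x -> (0 <= lam x)%E.
Hypothesis muE : forall B, measurable B ->
  (mu B = \int[s]_(x in D) (lam x * Q (xsection B x)))%E.
Local Open Scope ereal_scope.
Import HBNNSimple.

Let simple (h : {nnsfun (R * Y)%type >-> R}) :
  \int[mu]_z (h z)%:E = \int[s]_(x in D) (lam x * \int[Q]_y (h (x, y))%:E).
Proof.
have ms r : measurable (h @^-1` [set r]) by exact: measurable_sfunP.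
have mxs r : measurable_fun [set: R] (fun x => Q (xsection (h @^-1` [set r]) x)).
  exact: measurable_fun_xsection.
have H x : \int[Q]_y (h (x, y))%:E = \sum_(r \in range h) (r%:E * Q (xsection (h @^-1` [set r]) x)).
  under eq_integral do rewrite fimfunE -fsumEFin//.
  rewrite ge0_integral_fsum//; last 2 first.
  - move=> r; apply/measurable_EFinP/measurable_funM => //.
    have mi : measurable_fun setT (\1_(h @^-1` [set r]) : _ -> R) by exact: measurable_indic.
    exact: (measurableT_comp mi (pair1_measurable x)).
  - by move=> r y _; rewrite nnfun_muleindic_ge0.
  apply: eq_fsbigr => r _.
  transitivity (\int[Q]_y (r * \1_(xsection (h @^-1` [set r]) x) y)%:E).
    by apply: eq_integral => y _; rewrite !indicE mem_xsection.
  rewrite (integralZl_indic _ (fun r => xsection (h @^-1` [set r]) x))//.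
  - by rewrite integral_indic ?setIT//; exact: measurable_xsection.
  - by move=> r0; rewrite preimage_nnfun0// xsection0.
  - exact: measurable_xsection.
under [RHS]eq_integral do rewrite H.
under [LHS]eq_integral do rewrite fimfunE -fsumEFin//.
rewrite ge0_integral_fsum//; last 2 first.
- by move=> r; apply/measurable_EFinP/measurable_funM.
- by move=> r y _; rewrite nnfun_muleindic_ge0.
transitivity (\int[s]_(x in D) \sum_(r \in range h) (r%:E * (lam x * Q (xsection (h @^-1` [set r]) x)))).
  rewrite ge0_integral_fsum//; last 2 first.
  - move=> r; apply: emeasurable_funM => //; apply: emeasurable_funM => //.
    exact: measurable_funTS (mxs r).
  - move=> r x Dx; have [r0|r0] := leP 0%R r.
      by rewrite mule_ge0// mule_ge0// lam0.
    by rewrite preimage_nnfun0// xsection0 measure0 !mule0.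
  apply: eq_fsbigr => r _.
  rewrite (integralZl_indic _ (fun r => h @^-1` [set r]))//; last first.
    by move=> r0; rewrite preimage_nnfun0.
  rewrite integral_indic// setIT muE//.
  have [r0|r0] := leP 0%R r.
    rewrite ge0_integralZl//.
    - apply: emeasurable_funM => //.
      exact: measurable_funTS (mxs r).
    - by move=> x Dx; rewrite mule_ge0// lam0.
  by rewrite preimage_nnfun0// !integral0_eq ?mule0// => x _;
    rewrite xsection0 measure0 !mule0.
apply: eq_integral => x /set_mem Dx; rewrite ge0_mule_fsumr//.
  by apply: eq_fsbigr => r _; rewrite muleCA.
move=> r; have [r0|r0] := leP 0%R r; first by rewrite mule_ge0.
by rewrite preimage_nnfun0// xsection0 measure0 !mule0.
Qed.

(** The hypothesis [muE] speaks of sets only, as the definition of a Hawkes process does. Simple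
    functions and monotone convergence carry it to integrands, with [lam] allowed to be infinite. *)
Lemma ge0_integral_disintegration (g : R * Y -> \bar R) :
  measurable_fun [set: R * Y] g -> (forall z, 0 <= g z) ->
  \int[mu]_z g z = \int[s]_(x in D) (lam x * \int[Q]_y g (x, y)).
Proof.
move=> mg g0; pose h := nnsfun_approx measurableT mg.
have hg z : limn (fun n => (h n z)%:E) = g z.
  by apply/cvg_lim => //; apply: cvg_nnsfun_approx => // *; exact: g0.
have nh z : nondecreasing_seq (fun n => (h n z)%:E).
  by move=> a b ab; rewrite lee_fin; exact/lefP/nd_nnsfun_approx.
have mhn n (x : R) : measurable_fun [set: Y] (fun y => (h n (x, y))%:E).
  exact/measurable_EFinP/measurableT_comp.
have mFn n : measurable_fun [set: R] (fun x => \int[Q]_y (h n (x, y))%:E).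
  apply: (measurable_fun_fubini_tonelli_F (EFin \o h n)); first exact/measurable_EFinP.
  by move=> z; rewrite lee_fin.
have nint x : nondecreasing_seq (fun n => \int[Q]_y (h n (x, y))%:E).
  move=> a b ab; apply: ge0_le_integral => //.
  - by move=> *; rewrite lee_fin.
  - by move=> y _; exact: nh.
transitivity (limn (fun n => \int[mu]_z (h n z)%:E)).
  rewrite -monotone_convergence//.
  - by apply: eq_integral => z _; rewrite hg.
  - by move=> n; exact/measurable_EFinP.
  - by move=> *; rewrite lee_fin.
have -> : (fun n => \int[mu]_z (h n z)%:E) = fun n => \int[s]_(x in D) (lam x * \int[Q]_y (h n (x, y))%:E).
  by apply/funext => n; rewrite simple.
rewrite -monotone_convergence//.
- apply: eq_integral => x /set_mem Dx.
  rewrite limn_nd_mulel//; first 1 last.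
  - exact: lam0.
  - by move=> n; apply: integral_ge0 => y _; rewrite lee_fin.
  rewrite -monotone_convergence//.
  - by congr (_ * _); apply: eq_integral => y _; rewrite hg.
  - by move=> n y _; rewrite lee_fin.
- by move=> n; apply: emeasurable_funM => //; exact: measurable_funTS (mFn n).
- by move=> n x Dx; rewrite mule_ge0 ?lam0//; apply: integral_ge0 => y _; rewrite lee_fin.
- by move=> x Dx a b ab; rewrite lee_wpmul2l ?lam0//; exact: nint.
Qed.
End disintegration.
Lemma measurable_addl {R : realType} (s : R) : measurable_fun [set: R] (fun u => s + u).
Proof. exact: (@measurable_funD _ _ R setT (cst s) id). Qed.

Lemma measurable_addr {R : realType} (s : R) : measurable_fun [set: R] (fun u => u + s).
Proof. exact: (@measurable_funD _ _ R setT id (cst s)). Qed.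

Lemma measurable_natr_bool {R : realType} (d : measure_display) (X : measurableType d)
    (D : set X) (b : X -> bool) :
  measurable_fun D b -> measurable_fun D (fun x => ((b x)%:R)%:E : \bar R).
Proof.
move=> mb; apply/measurable_EFinP.
exact: (measurableT_comp (f := fun c : bool => (c%:R : R))).
Qed.

(* Cut the square [k(u) k(s)] along its diagonal. *)
Lemma ge0_integral_sqr_le {R : realType} (k : R -> \bar R) :
  measurable_fun setT k -> (forall u, 0 <= k u)%E ->
  ((\int[lebesgue_measure]_u k u) * (\int[lebesgue_measure]_u k u) <= 2%:E * \int[lebesgue_measure]_u (k u * \int[lebesgue_measure]_s ((s <= u)%R%:R%:E * k s)))%E.
Proof.
move=> mk k0; set leb := lebesgue_measure; set I := (\int[leb]_u k u)%E.
pose g (z : R * R) := (k z.1 * ((z.2 <= z.1)%R%:R%:E * k z.2))%E.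
have mk1 : measurable_fun setT (fun z : R * R => k z.1) by exact: measurableT_comp mk measurable_fst.
have mk2 : measurable_fun setT (fun z : R * R => k z.2) by exact: measurableT_comp mk measurable_snd.
have mle : measurable_fun setT (fun z : R * R => (z.2 <= z.1)%R%:R%:E : \bar R).
  by apply: measurable_natr_bool; apply: measurable_fun_ler.
have mg : measurable_fun setT g by apply: emeasurable_funM => //; exact: emeasurable_funM.
have g0 z : (0 <= g z)%E by rewrite !mule_ge0 ?lee_fin.
pose h (z : R * R) := g (z.2, z.1).
have mh : measurable_fun setT h.
  by apply: (measurableT_comp mg); apply: measurable_fun_pair.
have h0 z : (0 <= h z)%E by exact: g0.
have mcut (u : R) : measurable_fun [set: R] (fun s : R => (s <= u)%R%:R%:E * k s)%E.
  by apply: emeasurable_funM => //; apply: measurable_natr_bool; exact: measurable_fun_ler.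
have kI u : (\int[leb]_s g (u, s) = k u * \int[leb]_s ((s <= u)%R%:R%:E * k s))%E.
  rewrite /g/= ge0_integralZl//; first exact: mcut.
  by move=> s _; rewrite mule_ge0 ?lee_fin.
under [in leRHS]eq_integral do rewrite -kI.
have swap : (\int[leb]_u \int[leb]_s g (u, s) = \int[leb]_u \int[leb]_s h (u, s))%E.
  exact: (@fubini_tonelli _ _ _ _ R leb leb _ mg g0).
have mgu : measurable_fun setT (fun u => \int[leb]_s g (u, s))%E.
  exact: (@measurable_fun_fubini_tonelli_F _ _ _ _ R leb).
have mhu : measurable_fun setT (fun u => \int[leb]_s h (u, s))%E.
  exact: (@measurable_fun_fubini_tonelli_F _ _ _ _ R leb).
rewrite mule_natl mule2n [X in (_ <= _ + X)%E]swap.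
have G0 u : (0 <= \int[leb]_s g (u, s))%E by apply: integral_ge0 => s _.
have H0 u : (0 <= \int[leb]_s h (u, s))%E by apply: integral_ge0 => s _.
rewrite -ge0_integralD; [|by []|by move=> u _; exact: G0|exact: mgu|by move=> u _; exact: H0|exact: mhu].
have I0 : (0 <= I)%E by exact: integral_ge0.
have -> : (I * I = \int[leb]_u (k u * I))%E.
  by rewrite ge0_integralZr; [|exact: measurableT|exact: mk|move=> u _; exact: k0|exact: I0].
(* Each pair lies in one of the two triangles, and in both on the diagonal, hence a bound instead of
   an identity. *)
have gh (u s : R) : (k u * k s <= g (u, s) + h (u, s))%E.
  have [su|us] := leP s u.
    have -> : g (u, s) = (k u * k s)%E by rewrite /g/= su mul1e.
    by apply: leeDl; exact: h0.
  have -> : h (u, s) = (k u * k s)%E by rewrite /h/g/= (ltW us) mul1e muleC.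
  by apply: leeDr; exact: g0.
have mg1 u : measurable_fun setT (fun s => g (u, s)).
  exact: (measurableT_comp mg (pair1_measurable u)).
have mh1 u : measurable_fun setT (fun s => h (u, s)).
  exact: (measurableT_comp mh (pair1_measurable u)).
apply: ge0_le_integral; first exact: measurableT.
- by move=> u _; exact: mule_ge0.
- by apply: emeasurable_funM => //; exact: measurable_cst.
- exact: (emeasurable_funD mgu mhu).
move=> u _.
rewrite -ge0_integralD; [|by []|by move=> s _; exact: g0|exact: mg1|by move=> s _; exact: h0|exact: mh1].
rewrite -ge0_integralZl; [|exact: measurableT|exact: mk|move=> s _; exact: k0|exact: k0].
apply: ge0_le_integral; first exact: measurableT.
- by move=> s _; exact: mule_ge0.
- by apply: emeasurable_funM => //; exact: measurable_cst.
- exact: (emeasurable_funD (mg1 u) (mh1 u)).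
move=> s _; exact: gh.
Qed.

(** Both sides integrate [a s * b u] over [u + s <= v]. For functions vanishing at negative times
    this is the commutativity of convolution, integrated up to [v]; it makes [F] the outer factor in
    the renewal equation. *)
Lemma tonelli_triangle {R : realType} (a b : R -> \bar R) (v : R) :
  measurable_fun setT a -> measurable_fun setT b ->
  (forall s, 0 <= a s)%E -> (forall s, 0 <= b s)%E ->
  (\int[lebesgue_measure]_s (a s * \int[lebesgue_measure]_u (b u * (u + s <= v)%R%:R%:E)) =
   \int[lebesgue_measure]_u (b u * \int[lebesgue_measure]_s (a s * (u + s <= v)%R%:R%:E)))%E.
Proof.
move=> ma mb a0 b0; set leb := lebesgue_measure.
pose g (z : R * R) := (a z.1 * (b z.2 * (z.2 + z.1 <= v)%R%:R%:E))%E.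
have mI2 : measurable_fun setT (fun z : R * R => (z.2 + z.1 <= v)%R%:R%:E : \bar R).
  by apply: measurable_natr_bool; apply: measurable_fun_ler => //; apply: measurable_funD.
have i0 (c : bool) : (0 <= c%:R%:E :> \bar R)%E by rewrite lee_fin.
have mg : measurable_fun setT g.
  apply: emeasurable_funM; first exact: (measurableT_comp ma measurable_fst).
  by apply: emeasurable_funM; first exact: (measurableT_comp mb measurable_snd).
have g0 z : (0 <= g z)%E by apply: mule_ge0 => //; exact: mule_ge0.
have mIl (s : R) : measurable_fun [set: R] (fun u : R => (b u * (u + s <= v)%R%:R%:E)%E).
  apply: emeasurable_funM => //; apply: measurable_natr_bool.
  by apply: measurable_fun_ler => //; exact: measurable_addr.
have mIr (u : R) : measurable_fun [set: R] (fun s : R => (a s * (u + s <= v)%R%:R%:E)%E).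
  apply: emeasurable_funM => //; apply: measurable_natr_bool.
  by apply: measurable_fun_ler => //; exact: measurable_addl.
transitivity (\int[leb]_s \int[leb]_u g (s, u))%E.
  apply: eq_integral => s _; rewrite /g /=.
  rewrite ge0_integralZl; [by []|exact: measurableT|exact: mIl|move=> u _; exact: mule_ge0|exact: a0].
rewrite (@fubini_tonelli _ _ _ _ R leb leb _ mg g0).
apply: eq_integral => u _; rewrite /g /=.
rewrite -ge0_integralZl; [|exact: measurableT|exact: mIr|move=> s _; exact: mule_ge0|exact: b0].
by apply: eq_integral => s _; rewrite muleCA.
Qed.

Lemma cvg_integral_cut {R : realType} (g : R -> \bar R) :
  measurable_fun setT g -> (forall s, 0 <= g s)%E ->
  (\int[lebesgue_measure]_s ((s <= n%:R)%R%:R%:E * g s))%E @[n --> \oo] -->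
  (\int[lebesgue_measure]_s g s)%E.
Proof.
move=> mg g0.
have -> : (\int[lebesgue_measure]_s g s =
    \int[lebesgue_measure]_s limn (fun n => ((s <= n%:R)%R%:R%:E * g s)))%E.
  apply: eq_integral => s _; apply/esym/cvg_lim => //.
  apply: cvg_near_cst; exists (Num.truncn s).+1 => // n /= sn.
  by rewrite (_ : s <= n%:R) ?mul1e//; apply: le_trans (ltW (truncnS_gt _)) _; rewrite ler_nat.
apply: cvg_monotone_convergence => //.
- move=> n; apply: emeasurable_funM => //; apply: measurable_natr_bool.
  exact: measurable_fun_ler.
- by move=> n s _; rewrite mule_ge0 ?lee_fin.
- move=> s _ i j ij; rewrite lee_wpmul2r// lee_fin ler_nat.
  by case: (leP s i%:R) => // si; rewrite (le_trans si)// ler_nat.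
Qed.

(** * The resolvent *)

Section renewal.
Context {R : realType}.
Local Notation leb := (@lebesgue_measure R).
Variables (F r : R -> R) (M q : R).
(** With the extension by zero, convolutions over [[0, t]] become integrals over the whole line,
    where translation and Tonelli apply without moving bounds. *)
Let F0 (u : R) : R := if 0 <= u then F u else 0.
Hypothesis mF0 : measurable_fun setT F0.
Hypothesis F_ge0 : forall t : R, 0 <= t -> 0 <= F t.
Hypothesis F_leM : forall t : R, 0 <= t -> F t <= M.
Hypothesis intF : (\int[leb]_u (F0 u)%:E = q%:E)%E.
Hypothesis q1 : q < 1.
Hypothesis hr : resolvent_opp F r.

Let F0_ge0 u : 0 <= F0 u.
Proof. by rewrite /F0; case: ifP => // /F_ge0. Qed.

Let F0_leM u : F0 u <= M.
Proof.
rewrite /F0; case: ifP => [/F_leM//|_].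
by apply: (@le_trans _ _ (F 0)); [exact: F_ge0|exact: F_leM].
Qed.

Let q0 : 0 <= q.
Proof. by rewrite -lee_fin -intF; apply: integral_ge0 => u _; rewrite lee_fin. Qed.

Let r0 (u : R) : R := if 0 <= u then r u else 0.

Let mr0 : measurable_fun setT r0.
Proof.
have H n : measurable_fun (`[0, n%:R]%classic : set R) r.
  have [/(_ n%:R (ler0n _ _))/integrableP[+ _] _] := hr.
  by move/measurable_EFinP.
have mr : measurable_fun (`[0, +oo[%classic : set R) r.
  rewrite itv0y_bigcup0S; apply/measurable_fun_bigcup => //.
rewrite (_ : r0 = r \_ `[0, +oo[%classic); last first.
  by apply/funext => u; rewrite patchE /r0 mem_setE in_itv/= andbT.
exact/(measurable_restrictT _ _).1.
Qed.

Let conv_le (t : R) : 0 <= t -> ((r t + F t)%:E <=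
  \int[leb]_s (F0 (t - s) * Num.max (r0 s) 0)%:E)%E.
Proof.
move=> t0; have [_ /(_ t t0) ->] := hr; rewrite subrK /convolution /Rintegral.
set x := (\int[_]_(_ in _) _)%E; set y := (\int[_]_(_ in _) _)%E.
have xy : (x <= y)%E.
  rewrite /x /y integral_mkcond [leLHS]integralE.
  apply: (@le_trans _ _ (\int[leb]_s (((fun s => (F (t - s) * r s)%:E) \_ `[0%R, t]%classic)^\+ s)))%E.
    by rewrite geeDl// oppe_le0; apply: integral_ge0.
  rewrite le_eqVlt; apply/orP; left; apply/eqP; apply: eq_integral => s _.
  rewrite funeposE patchE mem_setE in_itv/= /r0 /F0.
  case: (leP 0 s) => s0 /=; last by rewrite !maxxx mulr0.
  rewrite subr_ge0; case: (leP s t) => st /=; last by rewrite maxxx mul0r.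
  by rewrite -[0%E]/(0%R%:E) -EFin_max maxr_pMr ?mulr0// F_ge0// subr_ge0.
have y0 : (0 <= y)%E.
  by apply: integral_ge0 => s _; rewrite lee_fin mulr_ge0// le_max lexx orbT.
(* [convolution] takes the [fine] of [x], which is not yet known to be finite; an infinite [x] is
   read as 0, still below the nonnegative [y]. *)
by case: x y xy y0 => [x| |] [y| |].
Qed.

Let Fe u : \bar R := (F0 u)%:E.
Let re s : \bar R := (Num.max (r0 s) 0)%:E.

Let conv_le_re (t : R) : 0 <= t ->
  ((r t + F t)%:E <= \int[leb]_s (Fe (t - s)%R * re s))%E.
Proof. by move=> t0; under eq_integral do rewrite -EFinM; exact: conv_le. Qed.

Let mFe : measurable_fun setT Fe. Proof. exact/measurable_EFinP. Qed.

Let Fe_ge0 u : (0 <= Fe u)%E. Proof. by rewrite lee_fin. Qed.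

Let conv_tonelli (a : R -> \bar R) (v : R) :
  measurable_fun setT a -> (forall s, 0 <= a s)%E ->
  (\int[leb]_u ((u <= v)%R%:R%:E * \int[leb]_s (Fe (u - s)%R * a s)) =
   \int[leb]_s (a s * \int[leb]_u (Fe u * (u + s <= v)%R%:R%:E)))%E.
Proof.
move=> ma a0.
have mg : measurable_fun [set: R * R] (fun z : R * R => ((z.1 <= v)%R%:R%:E * (Fe (z.1 - z.2)%R * a z.2))%E).
  apply: emeasurable_funM.
    by apply: measurable_natr_bool; apply: measurable_fun_ler.
  apply: emeasurable_funM; last exact: measurableT_comp ma measurable_snd.
  by apply: (measurableT_comp mFe); apply: measurable_funB.
transitivity (\int[leb]_u \int[leb]_s ((u <= v)%R%:R%:E * (Fe (u - s)%R * a s)))%E.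
  apply: eq_integral => u _; rewrite ge0_integralZl//.
  - apply: emeasurable_funM => //.
    by apply: (measurableT_comp mFe); apply: measurable_funB.
  - by move=> s _; rewrite mule_ge0 ?lee_fin.
have g0 z : (0 <= (z.1 <= v)%R%:R%:E * (Fe (z.1 - z.2)%R * a z.2))%E.
  by rewrite !mule_ge0 ?lee_fin.
have /= -> := @fubini_tonelli _ _ _ _ R leb leb _ mg g0.
apply: eq_integral => s _.
rewrite -[X in (_ * X)%E](ge0_integral_shift s); last 2 first.
- apply: emeasurable_funM => //; apply: measurable_natr_bool.
  by apply: measurable_fun_ler => //; exact: measurable_addr.
- by move=> u; rewrite mule_ge0 ?lee_fin.
rewrite -ge0_integralZl//.
- by apply: eq_integral => u _; rewrite subrK muleA muleC; congr (_ * _)%E; exact: muleC.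
- apply: emeasurable_funM.
    by apply: (measurableT_comp mFe); apply: measurable_funB.
  under eq_fun do rewrite subrK.
  by apply: measurable_natr_bool; exact: measurable_fun_ler.
- by move=> u _; rewrite mule_ge0 ?lee_fin.
Qed.

(** A local form of Young's inequality: [Fe] vanishes at negative times, so the convolution up to
    [t] sees [a] only up to [t]. The factor [q] thus acts on truncated integrals, which local
    integrability makes finite. *)
Let int_cut (a : R -> \bar R) (t : R) : measurable_fun setT a -> (forall s, 0 <= a s)%E ->
  (\int[leb]_u ((u <= t)%R%:R%:E * \int[leb]_s (Fe (u - s)%R * a s)) <=
   q%:E * \int[leb]_s ((s <= t)%R%:R%:E * a s))%E.
Proof.
move=> ma a0; rewrite conv_tonelli// -ge0_integralZl//; last 2 first.
- apply: emeasurable_funM => //; apply: measurable_natr_bool.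
  exact: measurable_fun_ler.
- by move=> s _; rewrite mule_ge0 ?lee_fin.
have mI s : measurable_fun setT (fun u => (Fe u * (u + s <= t)%R%:R%:E)%E).
  apply: emeasurable_funM => //; apply: measurable_natr_bool.
  by apply: measurable_fun_ler => //; exact: measurable_addr.
apply: ge0_le_integral => //.
- move=> s _; rewrite mule_ge0//; apply: integral_ge0 => u _.
  by rewrite mule_ge0 ?lee_fin.
- apply: emeasurable_funM => //.
  apply: (@measurable_fun_fubini_tonelli_F _ _ _ _ R leb (fun z : R * R => (Fe z.2 * (z.2 + z.1 <= t)%R%:R%:E)%E)).
    apply: emeasurable_funM; first exact: measurableT_comp mFe measurable_snd.
    by apply: measurable_natr_bool; apply: measurable_fun_ler => //; apply: measurable_funD.
  by move=> z; rewrite mule_ge0 ?lee_fin.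
- apply: emeasurable_funM => //; apply: emeasurable_funM => //; apply: measurable_natr_bool.
  exact: measurable_fun_ler.
- move=> s _; rewrite muleA [leRHS]muleC lee_wpmul2l//.
  have [st|ts] := leP s t.
    rewrite mule1 -intF; apply: ge0_le_integral => //.
    + by move=> u _; rewrite mule_ge0 ?lee_fin.
    + exact: mI.
    + by move=> u _; rewrite -[leRHS]mule1 lee_wpmul2l ?lee_fin ?lern1//; case: (_ <= _).
  rewrite mule0 integral0_eq// => u _; rewrite /Fe /F0; case: leP => u0; last by rewrite mul0e.
  by rewrite (_ : (u + s <= t) = false) ?mule0//; apply/negbTE; rewrite -ltNge; lra.
Qed.

Let mcut (t : R) (a : R -> \bar R) : measurable_fun setT a ->
  measurable_fun setT (fun s : R => ((s <= t)%R%:R%:E * a s)%E).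
Proof.
move=> ma; apply: emeasurable_funM => //; apply: measurable_natr_bool.
exact: measurable_fun_ler.
Qed.

Let mFsub (t : R) (a : R -> \bar R) : measurable_fun setT a ->
  measurable_fun setT (fun s : R => (Fe (t - s)%R * a s)%E).
Proof.
move=> ma; apply: emeasurable_funM => //.
by apply: (measurableT_comp mFe); apply: measurable_funB.
Qed.

Let M0 : 0 <= M.
Proof. exact: le_trans (F0_ge0 0) (F0_leM 0). Qed.

Let conv_bound (a : R -> \bar R) (t : R) : measurable_fun setT a -> (forall s, 0 <= a s)%E ->
  (\int[leb]_s (Fe (t - s)%R * a s) <= M%:E * \int[leb]_s ((s <= t)%R%:R%:E * a s))%E.
Proof.
move=> ma a0; rewrite -ge0_integralZl//; last 2 first.
- exact: mcut.
- by move=> s _; rewrite mule_ge0 ?lee_fin.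
apply: ge0_le_integral => //.
- by move=> s _; rewrite mule_ge0 ?lee_fin.
- exact: mFsub.
- by apply: emeasurable_funM => //; exact: mcut.
move=> s _; rewrite muleA lee_wpmul2r//.
have [st|ts] := leP s t; first by rewrite mule1 lee_fin.
by rewrite mule0 /Fe /F0 subr_ge0 (leNgt s t) ts.
Qed.

Let intr_fin (t : R) : (\int[leb]_s ((s <= t)%R%:R%:E * `|(r0 s)%:E|) < +oo)%E.
Proof.
have [t0|t0] := ltP t 0.
  rewrite integral0_eq// => s _; case: (leP s t) => st; last by rewrite mul0e.
  by rewrite /r0 leNgt (le_lt_trans st t0)/= normr0 mule0.
have [/(_ t t0)/integrableP[_ +] _] := hr.
rewrite integral_mkcond; apply: le_lt_trans.
rewrite le_eqVlt; apply/orP; left; apply/eqP; apply: eq_integral => s _.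
rewrite patchE mem_setE in_itv/= /r0.
case: (leP 0 s) => s0 /=; last by rewrite normr0 mule0.
by case: (leP s t) => st /=; rewrite ?mul1e ?mul0e.
Qed.

Let mre : measurable_fun setT re.
Proof. by apply/measurable_EFinP; apply: measurable_maxr. Qed.

Let re_ge0 s : (0 <= re s)%E.
Proof. by rewrite lee_fin le_max lexx orbT. Qed.

(** The positive part of [r] is dominated by its convolution with [F], so its integral [a] up to [t]
    satisfies [a <= q a] and, being finite, is 0. As [F] is bounded by [M], the convolution is then
    at most [M a = 0] at every [t], not only at almost every one. This gives the sign of [- r],
    after which all integrals are of nonnegative functions. *)
Lemma resolvent_le0 (t : R) : 0 <= t -> r t + F t <= 0.
Proof.
move=> t0; pose a := (\int[leb]_s ((s <= t)%R%:R%:E * re s))%E.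
have a0 : (0 <= a)%E.
  by apply: integral_ge0 => s _; apply: mule_ge0; rewrite ?re_ge0 ?lee_fin.
have afin : (a < +oo)%E.
  apply: le_lt_trans (intr_fin t); apply: ge0_le_integral => //.
  - by move=> s _; apply: mule_ge0; rewrite ?re_ge0 ?lee_fin.
  - exact: mcut.
  - by apply: mcut; apply: measurableT_comp => //; exact/measurable_EFinP.
  - move=> s _; rewrite lee_wpmul2l ?lee_fin//.
    by rewrite ge_max ler_norm normr_ge0.
have le_conv u : (re u <= \int[leb]_s (Fe (u - s)%R * re s))%E.
  have C0 : (0 <= \int[leb]_s (Fe (u - s)%R * re s))%E.
    by apply: integral_ge0 => s _; apply: mule_ge0; rewrite ?re_ge0 ?lee_fin.
  rewrite {1}/re EFin_max ge_max C0 andbT.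
  have [u0|u0] := leP 0 u; last by rewrite /r0 (leNgt 0 u) u0.
  have := conv_le_re u0; apply: le_trans; rewrite lee_fin /r0 u0.
  by rewrite lerDl F_ge0.
have aq : (a <= 0 + q%:E * a)%E.
  rewrite add0e; apply: (le_trans _ (int_cut t mre re_ge0)).
  apply: ge0_le_integral => //.
  - by move=> s _; apply: mule_ge0; rewrite ?re_ge0 ?lee_fin.
  - exact: mcut.
  - apply: mcut.
    apply: (@measurable_fun_fubini_tonelli_F _ _ _ _ R leb (fun z : R * R => (Fe (z.1 - z.2)%R * re z.2)%E)).
      apply: emeasurable_funM; last exact: measurableT_comp mre measurable_snd.
      by apply: (measurableT_comp mFe); apply: measurable_funB.
    by move=> z; apply: mule_ge0; rewrite ?re_ge0 ?lee_fin.
  - by move=> s _; rewrite lee_wpmul2l ?lee_fin.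
have q01 : 0 <= q < 1 by rewrite q0.
have := ge0_fin_contraction a0 afin q01 aq; rewrite mule0 => ale0.
rewrite -lee_fin; apply: le_trans (conv_le_re t0) _.
apply: le_trans (conv_bound t mre re_ge0) _.
by rewrite -/a (_ : a = 0%E) ?mule0//; apply/eqP; rewrite eq_le ale0 a0.
Qed.

Let Re (s : R) : \bar R := (- r0 s)%:E.

Let Re_ge0 s : (0 <= Re s)%E.
Proof.
rewrite /Re lee_fin /r0; case: ifP => [s0|_]; last by rewrite oppr0.
by have := resolvent_le0 s0; have := F_ge0 s0; lra.
Qed.

Let mRe : measurable_fun setT Re.
Proof. by apply/measurable_EFinP; exact: measurableT_comp. Qed.

Let Re_fin t : (\int[leb]_s ((s <= t)%R%:R%:E * Re s) < +oo)%E.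
Proof.
apply: le_lt_trans (intr_fin t); rewrite le_eqVlt; apply/orP; left; apply/eqP.
apply: eq_integral => s _; congr (_ * _)%E.
by rewrite abse_EFin -normrN ger0_norm// -lee_fin; exact: Re_ge0.
Qed.

Let ReE (t : R) : Re t = (Fe t + \int[leb]_s (Fe (t - s)%R * Re s))%E.
Proof.
have [t0|t0] := ltP t 0.
  rewrite /Re /Fe /r0 /F0 (leNgt 0 t) t0/= oppr0 add0e integral0_eq// => s _.
  case: (leP 0 s) => s0; last by rewrite oppr0 mule0.
  by rewrite (leNgt 0 (t - s)) (_ : t - s < 0) ?mul0e//; lra.
(* [F] is bounded and [Re] is locally integrable, so the convolution is finite and the [fine] hidden
   in [convolution] loses nothing. *)
have Cfin : (\int[leb]_s (Fe (t - s)%R * Re s))%E \is a fin_num.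
  rewrite ge0_fin_numE; last by apply: integral_ge0 => s _; apply: mule_ge0; rewrite ?Re_ge0 ?lee_fin.
  apply: le_lt_trans (conv_bound t mRe Re_ge0) _.
  by rewrite lte_mul_pinfty ?lee_fin//.
have [_ /(_ t t0) rE] := hr.
rewrite /Re /Fe {1}/r0 {1}/F0 t0 rE /convolution /Rintegral.
rewrite integral_mkcond (_ : (\int[_]_(_ in _) _)%E = - (\int[leb]_s (Fe (t - s)%R * Re s))%E)%E.
  by rewrite -[in RHS](fineK Cfin) fineN -EFinD; congr (_%:E); lra.
rewrite -integral_ge0N//; last by move=> s _; apply: mule_ge0; rewrite ?Re_ge0 ?lee_fin.
apply: eq_integral => s _; rewrite patchE mem_setE in_itv/= /Fe /Re /r0 /F0.
case: (leP 0 s) => s0 /=; last by rewrite oppr0 mulr0 oppr0.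
rewrite subr_ge0; case: (leP s t) => st /=; last by rewrite mul0r oppr0.
by rewrite mulrN opprK.
Qed.

Let b v := (\int[leb]_s ((s <= v)%R%:R%:E * Re s))%E.
Let psi v := (1 + b v)%E.

Let b_ge0 v : (0 <= b v)%E.
Proof. by apply: integral_ge0 => s _; apply: mule_ge0; rewrite ?Re_ge0 ?lee_fin. Qed.

Let bE (v : R) : b v = (\int[leb]_u ((u <= v)%R%:R%:E * Fe u) +
  \int[leb]_u ((u <= v)%R%:R%:E * \int[leb]_s (Fe (u - s)%R * Re s)))%E.
Proof.
rewrite -ge0_integralD//; last 4 first.
- by move=> s _; apply: mule_ge0; rewrite ?lee_fin.
- exact: mcut.
- move=> s _; apply: mule_ge0; rewrite ?lee_fin//; apply: integral_ge0 => u _.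
  by apply: mule_ge0; rewrite ?Re_ge0 ?lee_fin.
- apply: mcut.
  apply: (@measurable_fun_fubini_tonelli_F _ _ _ _ R leb (fun z : R * R => (Fe (z.1 - z.2)%R * Re z.2)%E)).
    apply: emeasurable_funM; last exact: measurableT_comp mRe measurable_snd.
    by apply: (measurableT_comp mFe); apply: measurable_funB.
  by move=> z; apply: mule_ge0; rewrite ?Re_ge0 ?lee_fin.
apply: eq_integral => u _; rewrite ReE ge0_muleDr ?lee_fin//.
by apply: integral_ge0 => s _; apply: mule_ge0; rewrite ?Re_ge0 ?lee_fin.
Qed.

(** Integrate [R = F + F * R] up to [v] and exchange the integrals: the factor of [F u] becomes
    [1 + b (v - u)], which is [psi (v - u)]. *)
Lemma resolvent_renewal (v : R) : 
  psi v = (1 + \int[leb]_u (Fe u * ((u <= v)%R%:R%:E * psi (v - u)%R)))%E.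
Proof.
congr (_ + _)%E; rewrite bE conv_tonelli//.
rewrite (tonelli_triangle v mRe mFe Re_ge0 Fe_ge0).
rewrite -ge0_integralD//; last 4 first.
- by move=> s _; apply: mule_ge0; rewrite ?lee_fin.
- exact: mcut.
- move=> s _; apply: mule_ge0; rewrite ?lee_fin//; apply: integral_ge0 => u _.
  by apply: mule_ge0; rewrite ?Re_ge0 ?lee_fin.
- apply: emeasurable_funM => //.
  apply: (@measurable_fun_fubini_tonelli_F _ _ _ _ R leb (fun z : R * R => (Re z.2 * (z.1 + z.2 <= v)%R%:R%:E)%E)).
    apply: emeasurable_funM; first exact: measurableT_comp mRe measurable_snd.
    by apply: measurable_natr_bool; apply: measurable_fun_ler => //; apply: measurable_funD.
  by move=> z; apply: mule_ge0; rewrite ?Re_ge0 ?lee_fin.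
apply: eq_integral => u _.
have -> : (\int[leb]_s (Re s * (u + s <= v)%R%:R%:E) = (u <= v)%R%:R%:E * b (v - u)%R)%E.
  have [uv|vu] := leP u v.
    by rewrite mul1e; apply: eq_integral => s _; rewrite muleC lerBrDl.
  rewrite mul0e integral0_eq// => s _; rewrite /Re /r0; case: leP => s0; last by rewrite oppr0 mul0e.
  by rewrite (leNgt (u + s)) (_ : v < u + s) ?mule0//; lra.
rewrite /psi [in RHS]ge0_muleDr// mule1 [in RHS]ge0_muleDr ?lee_fin//.
  by congr (_ + _)%E; exact: muleC.
by rewrite mule_ge0 ?lee_fin.
Qed.

Lemma measurable_resolvent : measurable_fun setT r0.
Proof. exact: mr0. Qed.

(** Integrating the resolvent equation gives [b <= q + q b] for the finite primitive [b v], hence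
    the bound [q / (1 - q)], uniform in [v]. *)
Lemma resolvent_L1_lty : (\int[leb]_s Re s < +oo)%E.
Proof.
have bq (v : R) : (b v <= (1 - q)^-1%:E * q%:E)%E.
  apply: ge0_fin_contraction => //; [exact: Re_fin|by rewrite q0|].
  rewrite {1}bE; apply: leeD; last exact: int_cut.
  rewrite -intF; apply: ge0_le_integral => //.
  - by move=> s _; apply: mule_ge0; rewrite ?lee_fin.
  - exact: mcut.
  - move=> s _; case: (s <= v); rewrite ?mul1e ?mul0e// lee_fin//.
apply: (@le_lt_trans _ _ ((1 - q)^-1%:E * q%:E)%E); last by rewrite ltry.
have /cvg_lim <- // := cvg_integral_cut mRe Re_ge0; apply: lime_le; first by apply/cvg_ex; eexists; exact: cvg_integral_cut.
by apply: nearW => n; exact: bq.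
Qed.

End renewal.

(** * Paths of marked point processes *)

Lemma nneseries_ord {R : realType} (f : nat -> \bar R) (n : nat) :
  (forall k, 0 <= f k)%E -> (forall k, (n <= k)%N -> f k = 0%E) ->
  (\sum_(k <oo) f k = \sum_(k < n) f k)%E.
Proof.
move=> f0 fn; rewrite (nneseries_split 0 n)// add0n eseries0 ?adde0 ?big_mkord//.
by move=> k nk _; exact: fn.
Qed.

Section marked_point_process_paths.
Context {R : realType} {dO dE : measure_display}.
Context {Omega : measurableType dO} {E : measurableType dE}.
Variables (T : nat -> Omega -> \bar R) (X : nat -> Omega -> option E).
Hypothesis hTX : marked_point_process T X.
Local Open Scope ereal_scope.

(* [point] is an arbitrary mark; it is used at no finite time. *)
Definition mpp_eval (g : R * E -> \bar R) (n : nat) (w : Omega) : \bar R :=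
  if (T n w < +oo) then g (fine (T n w), odflt point (X n w)) else 0.

Lemma mpp_eval_ge0 g n w : (forall y, 0 <= g y) -> 0 <= mpp_eval g n w.
Proof. by rewrite /mpp_eval; case: ifP. Qed.

Lemma mpp_fineK n w : T n w < +oo -> (fine (T n w))%:E = T n w.
Proof.
by move=> Too; rewrite fineK// ge0_fin_numE//; exact/ltW/(mpp_time_gt0 hTX).
Qed.

Lemma integral_mpp_atom g n w : measurable_fun setT g ->
  \int[mpp_atom (T n w) (X n w)]_y g y = mpp_eval g n w.
Proof.
move=> mg; rewrite /mpp_eval /mpp_atom.
have := mpp_time_gt0 hTX n w; have := mpp_mark_external hTX n w.
case: (T n w) => [t| |] //; case: (X n w) => [x|] // [H1 H2] _.
- by rewrite ltry integral_dirac// diracT mul1e.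
- by have := H1 erefl.
- by rewrite ltxx; apply: integral_measure_zero.
- by rewrite ltxx; apply: integral_measure_zero.
Qed.

Lemma integral_mpp g w : measurable_fun setT g -> (forall y, 0 <= g y) ->
  \int[mpp_measure T X w]_y g y = \sum_(n <oo) mpp_eval g n w.
Proof.
move=> mg g0; rewrite ge0_integral_measure_series//.
by apply: eq_eseriesr => n _; exact: integral_mpp_atom.
Qed.

Lemma mpp_measureE A w : measurable A ->
  mpp_measure T X w A = \sum_(n <oo) mpp_eval (fun y => (y \in A)%:R%:E) n w.
Proof.
move=> mA; rewrite -[A in LHS]setIT -integral_indic// integral_mpp//.
by apply/measurable_EFinP; exact: measurable_indic.
Qed.

Lemma mpp_time_homo w : {homo (fun n => T n w) : i j / (i <= j)%N >-> i <= j}.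
Proof.
by apply: homo_leq => [//|y x z|i]; [exact: le_trans|exact: (mpp_time_le hTX)].
Qed.

Lemma mpp_time_lt_lt w i j : (i < j)%N -> T i w < +oo -> T i w < T j w.
Proof.
move=> ij Ti; apply: lt_le_trans (mpp_time_lt hTX Ti) _; exact: mpp_time_homo.
Qed.

Lemma mpp_countE (q : R) A w : measurable A ->
  mpp_count (mpp_measure T X) q A w =
  \sum_(n <oo) mpp_eval (fun y => ((y.1 <= q)%R && (y.2 \in A))%:R%:E) n w.
Proof.
move=> mA; rewrite /mpp_count mpp_measureE; last exact: measurableX.
apply: eq_eseriesr => n _; rewrite /mpp_eval; case: ifPn => // Too.
congr ((_ : bool)%:R%:E); apply/idP/idP.
- by rewrite inE/= in_itv/= => -[/andP[_ ->]] /mem_set.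
- move=> /andP[h1 /set_mem h2]; rewrite inE/= in_itv/= h1 andbT; split => //.
  by rewrite -lte_fin mpp_fineK//; exact: (mpp_time_gt0 hTX).
Qed.

(** The natural filtration is generated by counts and not by the times; this is how the events
    [T n <= q] are found in it. The shift to [n.+1] comes from indices starting at 0. *)
Lemma mpp_time_le_count n (q : R) w :
  (T n w <= q%:E) = (n.+1%:R%:E <= mpp_count (mpp_measure T X) q setT w).
Proof.
rewrite mpp_countE//.
have e0 i : 0 <= mpp_eval (fun y => ((y.1 <= q)%R && (y.2 \in setT))%:R%:E) i w.
  by apply: mpp_eval_ge0 => y; rewrite lee_fin.
have eE i : mpp_eval (fun y => ((y.1 <= q)%R && (y.2 \in setT))%:R%:E) i w = (T i w <= q%:E)%E%:R%:E.
  rewrite /mpp_eval; case: ifPn => Ti.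
    by rewrite in_setT andbT -lee_fin mpp_fineK.
  by move: Ti; rewrite ltey negbK => /eqP ->.
apply/idP/idP => [Tq|].
  rewrite (le_trans _ (nneseries_lim_ge n.+1 _))//.
  rewrite big_mkord (eq_bigr (fun=> 1%:E)).
    by rewrite sumEFin sumr_const card_ord.
  by move=> i _; rewrite eE (le_trans _ Tq)//; apply: mpp_time_homo; rewrite -ltnS.
apply: contraTT; rewrite -!ltNge => qT.
rewrite (nneseries_split 0 n)// add0n eseries0 ?adde0; last first.
  move=> i ni _; rewrite eE leNgt (lt_le_trans qT)//; exact: mpp_time_homo.
apply: (@le_lt_trans _ _ (\sum_(0 <= i < n) 1%:E)).
  by apply: lee_sum => i _; rewrite eE lee_fin lern1; case: (_ <= _).
by rewrite big_mkord sumEFin sumr_const card_ord lte_fin ltr_nat.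
Qed.

Lemma measurable_mpp_eval (W : Omega * (R * E) -> \bar R) n : measurable_fun setT W ->
  measurable_fun setT (fun w => mpp_eval (fun y => W (w, y)) n w).
Proof.
move=> mW; rewrite /mpp_eval; have mT := mpp_measurable_time hTX n.
apply: measurable_fun_ifT => //.
  exact: measurable_fun_lte.
apply: (measurableT_comp mW); apply: measurable_fun_pair => //=.
apply: measurable_fun_pair => //=; first exact: measurableT_comp.
move=> _ B mB; rewrite setTI.
rewrite (_ : _ @^-1` B = X n @^-1` (odflt point @^-1` B)) //.
by apply: (mpp_measurable_mark hTX); rewrite (_ : _ @^-1` _ = B).
Qed.

Lemma measurable_integral_mpp (W : Omega * (R * E) -> \bar R) : measurable_fun setT W ->
  (forall z, 0 <= W z) ->
  measurable_fun setT (fun w => \int[mpp_measure T X w]_y W (w, y)).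
Proof.
move=> mW W0.
apply: (eq_measurable_fun (fun w => \sum_(n <oo) mpp_eval (fun y => W (w, y)) n w)).
  move=> w _; rewrite integral_mpp//; exact: measurableT_comp.
apply: ge0_emeasurable_sum => [n w _|n _].
  by move=> _; exact: mpp_eval_ge0.
exact: measurable_mpp_eval.
Qed.

End marked_point_process_paths.

(** * Predictability *)

Section predictability.
Context {R : realType} {dO dE : measure_display}.
Context {Omega : measurableType dO} {E : measurableType dE}.
Variables (T : nat -> Omega -> \bar R) (X : nat -> Omega -> option E).
Hypothesis hTX : marked_point_process T X.
Let N := mpp_measure T X.
Let Fl := natural_filtration N.
Let PS := g_sigma_algebraType (predictable_rectangles Fl).

Let Fl_setT t : Fl t setT.
Proof. exact: (@measurableT _ (g_sigma_algebraType _)). Qed.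

Let count_measurable (p q : R) A (B : set (\bar R)) : 0 <= p <= q -> measurable A ->
  measurable B -> Fl q (mpp_count N p A @^-1` B).
Proof. by move=> pq mA mB; apply: sub_sigma_algebra; exists p, A, B. Qed.

Lemma measurable_predictable_cyl (q : R) (B : set Omega) : 0 <= q -> Fl q B ->
  measurable ([set z | B z.1 /\ q < z.2] : set PS).
Proof.
move=> q0 FB.
rewrite (_ : [set z | _] = \bigcup_k (B `*` `]q, q + k%:R]%classic)).
  apply: bigcup_measurable => k _; apply: sub_sigma_algebra; right.
  by exists q, (q + k%:R), B; split => //; rewrite lerDl.
apply/seteqP; split => [[w u]/= [Bw qu]|[w u] /= [k _ [/= Bw]]].
  exists (Num.truncn (u - q)).+1 => //; split => //=; rewrite in_itv/= qu/=.
  by rewrite -lerBlDl; apply/ltW/truncnS_gt.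
by rewrite in_itv/= => /andP[].
Qed.

(** The generating rectangles contain no negative time, so the sigma-algebra they generate does not
    separate negative times. The time truncated at 0 is the part of the coordinate that stays
    measurable. *)
Lemma measurable_predictable_time : measurable_fun setT (fun z : PS => Num.max 0 z.2).
Proof.
apply: (measurability _ (RGenOInfty.measurableE R)) => _ [_ [a ->] <-].
rewrite setTI; have [a0|a0] := ltP a 0.
  rewrite (_ : _ @^-1` _ = setT)//; apply/seteqP; split => //= z _ /=.
  by rewrite in_itv/= andbT lt_max a0.
have := measurable_predictable_cyl a0 (@Fl_setT a); congr measurable.
apply/seteqP; split => z /=; rewrite in_itv/= andbT lt_max.
  by move=> [_ ->]; rewrite orbT.
by rewrite ltNge a0.
Qed.

Lemma measurable_predictable_domain : measurable ([set z | 0 <= z.2] : set PS).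
Proof.
rewrite (_ : [set z | _] = (setT `*` [set 0]) `|` [set z | [set: Omega] z.1 /\ 0 < z.2]).
  apply: measurableU; last exact: measurable_predictable_cyl.
  by apply: sub_sigma_algebra; left; exists setT.
apply/seteqP; split => [[w u] /=|[w u] /= [[_ ->//]|[_ /ltW//]]].
by rewrite le_eqVlt => /orP[/eqP ->|u0]; [left|right].
Qed.

Let nnrat (k : nat) : R := `|ratr (odflt 0 (unpickle k))|.

Let nnrat_ge0 k : 0 <= nnrat k. Proof. by rewrite /nnrat. Qed.

Let nnrat_dense (a b : R) : 0 <= a -> a < b -> exists k, a < nnrat k < b.
Proof.
move=> a0 ab; have [q] := rat_in_itvoo ab; rewrite in_itv/= => /andP[aq qb].
exists (pickle q); rewrite /nnrat pickleK/= ger0_norm ?aq//.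
exact: le_trans a0 (ltW aq).
Qed.

(** In the complement, [T n < u] holds exactly when some rational [k] has [T n <= k < u], and the
    event [T n <= k] is known at time [k]. The strict inequality [k < u] is where left-continuity
    enters. *)
Lemma measurable_predictable_after n :
  measurable_fun setT (fun z : PS => (z.2%:E <= T n z.1)%E).
Proof.
apply: (measurable_fun_bool false); rewrite setTI.
rewrite (_ : _ @^-1` _ = \bigcup_k [set z | (T n z.1 <= (nnrat k)%:E)%E /\ nnrat k < z.2]).
  apply: bigcup_measurable => k _.
  apply: (measurable_predictable_cyl (B := [set w | (T n w <= (nnrat k)%:E)%E])).
    exact: nnrat_ge0.
  rewrite (_ : [set w | _] = mpp_count N (nnrat k) setT @^-1` `[n.+1%:R%:E, +oo[%classic).
    by apply: count_measurable => //; rewrite ?nnrat_ge0 ?lexx//; exact: emeasurable_itv.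
  by apply/seteqP; split => w /=; rewrite in_itv/= andbT (mpp_time_le_count hTX).
apply/seteqP; split => [[w u] /=|[w u] /= [k _ [/= Tk ku]]].
  move=> /negbT; rewrite -ltNge => Tu.
  have Tf := lt_trans Tu (ltry u).
  have T0 : 0 <= fine (T n w) by apply: fine_ge0; exact/ltW/(mpp_time_gt0 hTX).
  have [|k /andP[Tk ku]] := nnrat_dense T0 (b := u).
    by rewrite -lte_fin (mpp_fineK hTX).
  by exists k => //; split => //=; rewrite -(mpp_fineK hTX Tf) lee_fin ltW.
by apply/negbTE; rewrite -ltNge (le_lt_trans Tk).
Qed.

(* The points strictly before time [u], as a kernel; the restriction to
   [u <= T n] keeps it finite, so that a Dynkin argument applies. *)
Definition mpp_before (n : nat) (z : Omega * R) : {measure set (R * E)%type -> \bar R} :=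
  let atom i : {measure set (R * E)%type -> \bar R} :=
    if (T i z.1 < z.2%:E)%E then mpp_atom (T i z.1) (X i z.1) else mzero in
  if (z.2%:E <= T n z.1)%E then (msum atom n : {measure set _ -> \bar R}) else mzero.

Lemma integral_mpp_before n z (H : R * E -> \bar R) : measurable_fun setT H ->
  (forall y, 0 <= H y)%E ->
  (\int[mpp_before n z]_y H y = if (z.2%:E <= T n z.1)%E then
     \sum_(i < n) (if (T i z.1 < z.2%:E)%E then mpp_eval T X H i z.1 else 0) else 0)%E.
Proof.
move=> mH H0; rewrite /mpp_before; case: ifPn => _; last exact: integral_measure_zero.
rewrite ge0_integral_measure_sum//; apply: eq_bigr => i _.
by case: ifPn => _; [exact: integral_mpp_atom|exact: integral_measure_zero].
Qed.

Lemma mpp_beforeE n z A : measurable A -> (mpp_before n z A = if (z.2%:E <= T n z.1)%E then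
  \sum_(i < n) (if (T i z.1 < z.2%:E)%E then mpp_eval T X (fun y => (y \in A)%:R%:E) i z.1 else 0) else 0)%E.
Proof.
move=> mA; rewrite -[A in LHS]setIT -integral_indic// integral_mpp_before//.
by apply/measurable_EFinP; exact: measurable_indic.
Qed.

Let mpp_last_before n (w : Omega) (u : R) : 0 < u -> exists2 a : R, 0 <= a < u &
  forall i, (i < n)%N -> (T i w < u%:E)%E -> (T i w <= a%:E)%E.
Proof.
move=> u0; elim: n => [|n [a /andP[a0 au] IH]]; first by exists 0; rewrite ?lexx.
have [Tu|Tu] := ltP (T n w) u%:E; last first.
  exists a; rewrite ?a0// => i; rewrite ltnS leq_eqVlt => /orP[/eqP ->|/IH//].
  by rewrite ltNge Tu.
exists (fine (T n w)).
  by rewrite -lee_fin -lte_fin (mpp_fineK hTX) ?Tu ?(lt_trans Tu (ltry _))// ltW// (mpp_time_gt0 hTX).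
move=> i + _; rewrite ltnS (mpp_fineK hTX) ?(lt_trans Tu (ltry _))//.
exact: (mpp_time_homo hTX).
Qed.

(** A count already known strictly before the current time. Truncating [s] at 0 keeps the count
    within the times allowed by the filtration and loses nothing, as no point occurs at or before
    0. *)
Let g (s : R) A (k : nat) (z : PS) : \bar R :=
  if nnrat k < z.2 then mpp_count N (Num.min (nnrat k) (Num.max 0 s)) A z.1 else 0.

Let mg s A k : measurable A -> measurable_fun setT (g s A k).
Proof.
move=> mA _ B mB; rewrite setTI.
have mq : measurable ([set z | setT z.1 /\ nnrat k < z.2] : set PS).
  exact: measurable_predictable_cyl.
have mc : measurable ([set z | mpp_count N (Num.min (nnrat k) (Num.max 0 s)) A z.1 \in B
    /\ nnrat k < z.2] : set PS).
  apply: (measurable_predictable_cyl (B := [set w | _ \in B])) => //.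
  rewrite (_ : [set w | _] = mpp_count N (Num.min (nnrat k) (Num.max 0 s)) A @^-1` B).
    by apply: count_measurable => //; rewrite le_min nnrat_ge0 le_max lexx/= ge_min lexx.
  by apply/seteqP; split => w /=; rewrite inE.
have [B0|B0] := pselect (B 0%E).
  rewrite (_ : _ @^-1` _ = [set z | mpp_count N (Num.min (nnrat k) (Num.max 0 s)) A z.1 \in B
    /\ nnrat k < z.2] `|` ~` [set z | [set: Omega] z.1 /\ nnrat k < z.2]).
    by apply: measurableU => //; exact: measurableC.
  apply/seteqP; split => z /=; rewrite /g; case: ifPn => // qz.
  - by move=> Bz; left; rewrite inE.
  - by move=> _; right => -[].
  - by move=> [[/set_mem]|[]].
rewrite (_ : _ @^-1` _ = [set z | mpp_count N (Num.min (nnrat k) (Num.max 0 s)) A z.1 \in B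
    /\ nnrat k < z.2])//.
apply/seteqP; split => z /=; rewrite /g; case: ifPn => // qz.
- by rewrite inE.
- by move=> [/set_mem].
- by case.
Qed.

Let before_rect n (s : R) A (z : PS) : measurable A -> (z.2%:E <= T n z.1)%E ->
  mpp_before n z (`]-oo, s]%classic `*` A) = esups (fun k => g s A k z) 0.
Proof.
move=> mA zT; rewrite mpp_beforeE ?zT; last exact: measurableX.
pose e i := (if (T i z.1 < z.2%:E)%E then mpp_eval T X (fun y => (y \in `]-oo, s]%classic `*` A)%:R%:E) i z.1 else 0%E).
have gE k : nnrat k < z.2 -> g s A k z = (\sum_(i < n) if (T i z.1 <= (nnrat k)%:E)%E then e i else 0)%E.
  move=> kz; rewrite /g kz (mpp_countE hTX)// (nneseries_ord (n := n)).
  - apply: eq_bigr => i _; rewrite /e /mpp_eval; case: ifPn => Tf; last first.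
      by rewrite !if_same.
    have T0 := mpp_time_gt0 hTX i z.1.
    rewrite -(mpp_fineK hTX Tf) lee_fin lte_fin; rewrite -(mpp_fineK hTX Tf) lte_fin in T0.
    have -> : ((fine (T i z.1), odflt point (X i z.1)) \in `]-oo, s]%classic `*` A) =
      (fine (T i z.1) <= s) && (odflt point (X i z.1) \in A).
      apply/idP/idP; first by rewrite inE/= in_itv/= => -[-> /mem_set].
      by move=> /andP[h1 /set_mem h2]; rewrite inE/= in_itv.
    rewrite /= le_min le_max [_ <= 0]leNgt T0/=.
    case: (leP (fine _) (nnrat k)) => //= h; first by rewrite (le_lt_trans h kz).
  - by move=> i; apply: mpp_eval_ge0 => y; rewrite lee_fin.
  (* From index [n] on, the points are at or after [z.2], hence after the rational time
     [nnrat k]. *)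
  - move=> i ni; rewrite /mpp_eval; case: ifPn => // Tf.
    rewrite (_ : (fine _ <= _) = false)//; apply/negbTE; rewrite -ltNge gt_min.
    apply/orP; left; apply: (lt_le_trans kz).
    by rewrite -lee_fin (mpp_fineK hTX Tf) (le_trans zT)//; exact: (mpp_time_homo hTX).
have e0 i : (0 <= e i)%E.
  by rewrite /e; case: ifP => // _; apply: mpp_eval_ge0 => y; rewrite lee_fin.
apply/eqP; rewrite eq_le; apply/andP; split.
  have [z0|z0] := leP z.2 0.
    rewrite big1 => [|i _]; last by rewrite ltNge (le_trans _ (ltW (mpp_time_gt0 hTX _ _))).
    apply: (@le_trans _ _ (g s A 0%N z)); last by apply: ereal_sup_ubound; exists 0%N.
    by rewrite /g; case: ifP => // _; exact: measure_ge0.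
  (* Only finitely many points are concerned, so they stay away from [z.2]; a rational time in the
     gap attains the supremum. *)
  have [a /andP[a0 az] Ha] := mpp_last_before n z.1 z0.
  have [k /andP[ak kz]] := nnrat_dense a0 az.
  apply: (@le_trans _ _ (g s A k z)); last by apply: ereal_sup_ubound; exists k.
  rewrite gE//; apply: lee_sum => i _; rewrite -/(e i).
  rewrite /e; case: ifPn => Tz; last by rewrite if_same.
  have -> // : (T i z.1 <= (nnrat k)%:E)%E.
  by apply: (le_trans (Ha _ (ltn_ord i) Tz)); rewrite lee_fin ltW.
apply: ge_ereal_sup => _ [k _ <-].
have [kz|zk] := ltP (nnrat k) z.2.
  rewrite gE//; apply: lee_sum => i _; rewrite -/(e i).
  by case: ifP.
by rewrite /g ltNge zk; apply: sume_ge0 => i _; exact: e0.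
Qed.

Let mpp_before_fin n z V : measurable V -> mpp_before n z V \is a fin_num.
Proof.
move=> mV; rewrite ge0_fin_numE//; apply: (@le_lt_trans _ _ n%:R%:E); last exact: ltry.
rewrite mpp_beforeE//; case: ifP => _; last by rewrite lee_fin.
rewrite (@le_trans _ _ (\sum_(i < n) 1)%E)//; last by rewrite sumEFin sumr_const card_ord.
apply: lee_sum => i _; case: ifP => // _; rewrite /mpp_eval; case: ifP => // _.
by rewrite lee_fin lern1; case: (_ \in _).
Qed.

Let mpp_before_setC n V : measurable V -> measurable_fun setT (fun z : PS => mpp_before n z setT) ->
  measurable_fun setT (fun z : PS => mpp_before n z V) ->
  measurable_fun setT (fun z : PS => mpp_before n z (~` V)).
Proof.
move=> mV mT mVf.
apply: (eq_measurable_fun (fun z : PS => mpp_before n z setT - mpp_before n z V)%E).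
  move=> z _; rewrite -(setUv V) measureU ?setICr//; last exact: measurableC.
  by rewrite addeAC subee ?add0e// mpp_before_fin.
exact: emeasurable_funB.
Qed.

Let mpp_before_bigcup n (V : (set (R * E))^nat) : (forall k, measurable (V k)) ->
  trivIset setT V -> (forall k, measurable_fun setT (fun z : PS => mpp_before n z (V k))) ->
  measurable_fun setT (fun z : PS => mpp_before n z (\bigcup_k V k)).
Proof.
move=> mV tV mVf.
apply: (eq_measurable_fun (fun z : PS => \sum_(k <oo) mpp_before n z (V k))%E).
  by move=> z _; rewrite measure_semi_bigcup//; exact: bigcup_measurable.
by apply: ge0_emeasurable_sum.
Qed.

(** A first Dynkin argument, in the time variable only and with the mark set fixed: counts give the
    rays, and complements of rays generate the Borel sets. A second one, below, goes from rectangles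
    to the product sigma-algebra. *)
Let measurable_before_rect n A B : measurable A -> measurable B ->
  measurable_fun setT (fun z : PS => mpp_before n z (A `*` B)).
Proof.
move=> + mB.
have mray s C : measurable C -> measurable_fun setT (fun z : PS => mpp_before n z (`]-oo, s]%classic `*` C)).
  move=> mC.
  apply: (eq_measurable_fun (fun z : PS => if (z.2%:E <= T n z.1)%E then esups (fun k => g s C k z) 0 else 0%E)).
    move=> z _; case: ifPn => zT; first by rewrite -(before_rect s mC zT).
    by rewrite mpp_beforeE ?(negbTE zT)//; exact: measurableX.
  apply: measurable_fun_ifT => //; first exact: measurable_predictable_after.
  by apply: measurable_fun_esups => k; exact: mg.
have mT : measurable_fun setT (fun z : PS => mpp_before n z (setT `*` B)).
  apply: (emeasurable_fun_cvg (fun k (z : PS) => mpp_before n z (`]-oo, (k%:R : R)]%classic `*` B))).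
    by move=> k; exact: mray.
  move=> z _; rewrite (_ : setT `*` B = \bigcup_k (`]-oo, (k%:R : R)]%classic `*` B)).
    apply: nondecreasing_cvg_mu.
    - by move=> k; exact: measurableX.
    - by apply: bigcup_measurable => k _; exact: measurableX.
    - move=> i j ij; apply/subsetPset => -[x y] [/= + By]; rewrite in_itv/= => xi.
      by split => //=; rewrite in_itv/= (le_trans xi)// ler_nat.
  apply/seteqP; split => [[s x] [_ /= Bx]|[s x] [k _ [_ /= Bx]]//].
  exists (Num.truncn s).+1 => //; split => //=; rewrite in_itv/=.
  exact/ltW/truncnS_gt.
have mcompl C : measurable C -> measurable_fun setT (fun z : PS => mpp_before n z (C `*` B)) ->
    measurable_fun setT (fun z : PS => mpp_before n z (~` C `*` B)).
  move=> mC mCf.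
  apply: (eq_measurable_fun (fun z : PS => mpp_before n z (setT `*` B) - mpp_before n z (C `*` B))%E).
    move=> z _; have -> : setT `*` B = (C `*` B) `|` (~` C `*` B).
      apply/seteqP; split => [[x y] [_ /= By]|[x y] [|] []//].
      by have [xA|xA] := pselect (C x); [left|right].
    rewrite measureU; first last.
    - by rewrite -setXI setICr set0X.
    - by apply: measurableX => //; exact: measurableC.
    - exact: measurableX.
    by rewrite addeAC subee ?add0e// mpp_before_fin//; exact: measurableX.
  exact: emeasurable_funB.
move=> mA; have {mA} : <<s @RGenOInfty.G R>> A.
  by rewrite -[X in X A](RGenOInfty.measurableE R).
move: A; apply: dynkin_induction.
- exact: RGenOInfty.measurableE.
- move=> _ _ [a ->] [b ->]; exists (Num.max a b); apply/seteqP.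
  by split => u /=; rewrite !in_itv/= !andbT gt_max => /andP.
- exact: mT.
- move=> _ [a ->]; rewrite -(setCK `]a, +oo[%classic) setCitvr.
  by apply: mcompl => //; exact: mray.
- by move=> A mA; exact: mcompl.
- move=> V mV tV mVf; rewrite setX_bigcupl; apply: mpp_before_bigcup => //.
    by move=> k; exact: measurableX.
  apply/trivIsetP => i j _ _ ij; rewrite -setXI.
  by move/trivIsetP : tV => /(_ i j Logic.I Logic.I ij) ->; rewrite set0X.
Qed.

Lemma measurable_mpp_before n U : measurable U ->
  measurable_fun setT (fun z : PS => mpp_before n z U).
Proof.
move=> mU.
have mTT : measurable_fun setT (fun z : PS => mpp_before n z setT).
  by have := @measurable_before_rect n setT setT measurableT measurableT; rewrite setXTT.
move: U mU; rewrite [in X in forall U, X U -> _]measurable_prod_measurableType.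
apply: dynkin_induction => //.
- exact: measurable_prod_measurableType.
- move=> _ _ [A1 mA1 [A2 mA2 <-]] [B1 mB1 [B2 mB2 <-]].
  exists (A1 `&` B1); first exact: measurableI.
  exists (A2 `&` B2); first exact: measurableI.
  by rewrite setXI.
- by move=> _ [A mA [B mB <-]]; exact: measurable_before_rect.
- by move=> V mV mVf; exact: mpp_before_setC.
- by move=> V mV tV mVf; exact: mpp_before_bigcup.
Qed.

Lemma measurable_integral_before n (H : R * E -> \bar R) : measurable_fun setT H ->
  (forall y, 0 <= H y)%E ->
  measurable_fun setT (fun z : PS => \int[mpp_before n z]_y H y)%E.
Proof.
move=> mH H0; apply: measurable_fun_integral_kernel => // U.
exact: measurable_mpp_before.
Qed.

Lemma measurable_mpp_count (p : R) A : measurable A -> measurable_fun setT (mpp_count N p A).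
Proof.
move=> mA; rewrite (_ : mpp_count N p A = fun w => \int[N w]_y (y \in `]0, p]%classic `*` A)%:R%:E)%E.
  apply: (measurable_integral_mpp hTX (W := fun z => (z.2 \in `]0, p]%classic `*` A)%:R%:E)).
    apply/measurable_EFinP.
    have mi : measurable_fun setT (\1_(`]0, p]%classic `*` A) : R * E -> R).
      by apply: measurable_indic; exact: measurableX.
    exact: (measurableT_comp mi measurable_snd).
  by move=> z; rewrite lee_fin.
apply/funext => w; rewrite /mpp_count -[X in _ X = _]setIT -integral_indic//.
exact: measurableX.
Qed.

Lemma natural_filtration_measurable t B : Fl t B -> measurable B.
Proof.
apply: smallest_sub; first exact: sigma_algebra_measurable.
move=> _ [p [A [C [_ mA mC ->]]]]; rewrite -[X in measurable X]setTI.
exact: measurable_mpp_count.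
Qed.

Lemma predictable_measurable (B : set (Omega * R)) :
  measurable (B : set PS) -> measurable B.
Proof.
apply: smallest_sub; first exact: sigma_algebra_measurable.
move=> _ [[C FC ->]|[s [t [C [_ _ FC ->]]]]]; apply: measurableX => //;
  exact: natural_filtration_measurable FC.
Qed.

Lemma predictable_measurable_fun (Y : Omega * R -> \bar R) :
  measurable_fun setT (Y : PS -> \bar R) -> measurable_fun setT Y.
Proof.
move=> mY _ B mB; rewrite setTI; apply: predictable_measurable.
by have := mY measurableT B mB; rewrite setTI.
Qed.

(** Products of a predictable process and a deterministic function are the only fields to which the
    duality is applied. On the domain time is nonnegative, so it may be replaced by its measurable
    truncation. *)
Lemma predictable_field_mul (Y : Omega * R -> \bar R) (H : R * E -> \bar R) :
  measurable_fun setT (Y : PS -> \bar R) -> measurable_fun setT H ->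
  predictable_field Fl (fun y => Y y.1 * H (y.1.2, y.2))%E.
Proof.
move=> mY mH.
apply: (eq_measurable_fun (fun y : PS * E => Y y.1 * H (Num.max 0%R y.1.2, y.2))%E).
  move=> [[w u] x] /set_mem [[_ /=]]; rewrite in_itv/= andbT => u0 _.
  by rewrite max_r.
apply: measurable_funTS; apply: emeasurable_funM; first exact: measurableT_comp.
apply: (measurableT_comp mH); apply: measurable_fun_pair => //.
exact: (measurableT_comp measurable_predictable_time).
Qed.

End predictability.

(** * The compensator of a Hawkes process *)

Section hawkes.
Context {R : realType} {dO dE : measure_display}.
Context {Omega : measurableType dO} {E : measurableType dE}.
Variables (P : probability Omega R) (Q : probability E R).
Variables (m : R) (f : R -> E -> R).
Hypothesis m0 : 0 <= m.
Hypothesis hf : hawkes_fertility Q f.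
Variables (T : nat -> Omega -> \bar R) (X : nat -> Omega -> option E).
Hypothesis hTX : marked_point_process T X.
Let N := mpp_measure T X.
Let Fl := natural_filtration N.
Let PS := g_sigma_algebraType (predictable_rectangles Fl).
Variable nu : Omega -> {measure set (R * E)%type -> \bar R}.
Hypothesis hcomp : compensator P Fl N nu.
Hypothesis nuE : forall w (B : set (R * E)), measurable B ->
  (nu w B = \int[lebesgue_measure]_(t in `[0%R, +oo[%classic)
     hawkes_kernel Q m f N w t (xsection B t))%E.
Local Notation leb := (@lebesgue_measure R).
Local Open Scope ereal_scope.

(* The fertility extended by zero; dropping the time [0] encodes the strict
   inequality [s < t] in the intensity. *)
Definition fertility (y : R * E) : \bar R := if (0 < y.1)%R then (f y.1 y.2)%:E else 0.

Lemma fertility_ge0 y : 0 <= fertility y.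
Proof.
rewrite /fertility; case: ifPn => // y0; rewrite lee_fin.
by have [_ h _ _] := hf; apply/h/ltW.
Qed.

Lemma measurable_fertility : measurable_fun setT fertility.
Proof.
have [mf _ _ _] := hf.
have mD : measurable (`]0%R, +oo[%classic `*` setT : set (R * E)) by exact: measurableX.
rewrite (_ : fertility = (fun y => (f y.1 y.2)%:E) \_ (`]0%R, +oo[%classic `*` setT)).
  apply/(measurable_restrictT _ _).1 => //; apply/measurable_EFinP.
  apply: measurable_funS mf; first exact: measurableX.
  by move=> [u x] [/= + _]; rewrite !in_itv/= !andbT => /ltW u0; split => //=; rewrite in_itv/= u0.
apply/funext => -[u x]; rewrite patchE /fertility/=.
case: ifPn => u0; first by rewrite mem_set//; split => //=; rewrite in_itv/= u0.
by rewrite memNset//= in_itv/= andbT => -[/(negP u0)].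
Qed.

Lemma measurable_fertility_sub (t : R) : measurable_fun setT (fun y : R * E => fertility ((t - y.1)%R, y.2)).
Proof.
apply: (measurableT_comp measurable_fertility); apply: measurable_fun_pair => //.
exact: measurable_funB.
Qed.

(** Kept as a series over the points, the form in which it is exchanged with the time integral. It
    may be infinite: that a path has finitely many points up to [t] is derived later, and only
    almost surely. *)
Definition intensity (w : Omega) (t : R) : \bar R :=
  m%:E + \sum_(i <oo) mpp_eval T X (fun y => fertility ((t - y.1)%R, y.2)) i w.

Lemma intensity_ge0 w t : 0 <= intensity w t.
Proof.
rewrite adde_ge0 ?lee_fin//; apply: nneseries_ge0 => i _ _; apply: mpp_eval_ge0 => y.
exact: fertility_ge0.
Qed.

Lemma measurable_intensity w : measurable_fun setT (intensity w).
Proof.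
apply: emeasurable_funD => //; apply: ge0_emeasurable_sum => [i t _ _|i _].
  by apply: mpp_eval_ge0 => y; exact: fertility_ge0.
rewrite /mpp_eval; case: (T i w < +oo) => //; apply: (measurableT_comp measurable_fertility).
by apply: measurable_fun_pair => //; exact: measurable_funB.
Qed.

Lemma hawkes_kernelE w t A : (0 <= t)%R -> hawkes_kernel Q m f N w t A = intensity w t * Q A.
Proof.
move=> t0; rewrite /hawkes_kernel; congr ((_ + _) * _); rewrite integral_mkcond.
pose g (y : R * E) : \bar R := if (0 < y.1)%R then fertility ((t - y.1)%R, y.2) else 0.
rewrite (_ : _ \_ _ = g); last first.
  apply/funext => -[s x]; rewrite patchE /g/fertility/= subr_gt0.
  case: (ltP 0%R s) => s0; last first.
    by rewrite memNset//= in_itv/= (ltNge 0%R s) s0 => -[].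
  case: (ltP s t) => st.
    by rewrite mem_set//=; split => //; rewrite in_itv/= s0.
  by rewrite memNset//= in_itv/= (ltNge s t) st andbF => -[].
rewrite (integral_mpp hTX).
- apply: eq_eseriesr => i _; rewrite /mpp_eval; case: ifPn => // Ti.
  by rewrite /g/= -lte_fin (mpp_fineK hTX Ti) (mpp_time_gt0 hTX).
- apply: measurable_fun_ifT => //; last exact: measurable_fertility_sub.
  by apply: measurable_fun_ltr => //; exact: measurable_fst.
- by move=> y; rewrite /g; case: ifP => // _; exact: fertility_ge0.
Qed.

Lemma integral_compensator w (g : R * E -> \bar R) : measurable_fun setT g -> (forall y, 0 <= g y) ->
  \int[nu w]_y g y = \int[leb]_(t in `[0%R, +oo[) (intensity w t * \int[Q]_x g (t, x)).
Proof.
move=> mg g0.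
apply: ge0_integral_disintegration => //.
- exact: (measurable_funTS (@measurable_intensity w)).
- by move=> t _; exact: intensity_ge0.
- move=> B mB; rewrite nuE//; apply: eq_integral => t; rewrite inE/= in_itv/= andbT => t0.
  by rewrite hawkes_kernelE.
Qed.

(** Exchanging the time integral with the series turns the intensity back into points: the
    [nu]-integral of [g] is a constant plus the [N]-integral of the mean of [g] over the direct
    offspring of a point. Both the first moment bound and the pathwise cancellation start from this
    form. *)
Lemma integral_compensator_series w (g : R * E -> \bar R) : measurable_fun setT g -> (forall y, 0 <= g y) ->
  \int[nu w]_y g y = m%:E * \int[leb]_(t in `[0%R, +oo[) \int[Q]_x g (t, x) +
    \sum_(i <oo) mpp_eval T X (fun y => \int[leb]_(t in `[0%R, +oo[)
       (fertility ((t - y.1)%R, y.2) * \int[Q]_x g (t, x))) i w.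
Proof.
move=> mg g0; rewrite integral_compensator//.
have mh : measurable_fun setT (fun t => \int[Q]_x g (t, x)).
  exact: (@measurable_fun_fubini_tonelli_F _ _ _ _ R Q).
have h0 t : 0 <= \int[Q]_x g (t, x) by exact: integral_ge0.
have mfi i : measurable_fun [set: R] (fun t : R => mpp_eval T X (fun y => fertility ((t - y.1)%R, y.2)) i w).
  rewrite /mpp_eval; case: (T i w < +oo) => //; apply: (measurableT_comp measurable_fertility).
  by apply: measurable_fun_pair => //; exact: measurable_funB.
have f0 i t : 0 <= mpp_eval T X (fun y => fertility ((t - y.1)%R, y.2)) i w.
  by apply: mpp_eval_ge0 => y; exact: fertility_ge0.
transitivity (\int[leb]_(t in `[0%R, +oo[) (m%:E * \int[Q]_x g (t, x) +
    \sum_(i <oo) (\int[Q]_x g (t, x) * mpp_eval T X (fun y => fertility ((t - y.1)%R, y.2)) i w))).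
  apply: eq_integral => t _; rewrite /intensity ge0_muleDl ?lee_fin//; last exact: nneseries_ge0.
  by rewrite nneseries_mulel// [X in _ = _ + X]muleC.
rewrite ge0_integralD//; last 4 first.
- by move=> t _; rewrite mule_ge0.
- by apply: measurable_funTS; exact: emeasurable_funM.
- by move=> t _; apply: nneseries_ge0 => i _ _; exact: mule_ge0.
- apply: measurable_funTS; apply: ge0_emeasurable_sum => [i t _ _|i _]; first exact: mule_ge0.
  by apply: emeasurable_funM => //; exact: mfi.
rewrite ge0_integralZl//; last exact: measurable_funTS.
congr (_ + _); rewrite integral_nneseries//; last 2 first.
- by move=> i; apply: measurable_funTS; apply: emeasurable_funM => //; exact: mfi.
- by move=> i t _; exact: mule_ge0.
apply: eq_eseriesr => i _; rewrite /mpp_eval; case: ifPn => Ti /=.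
  by apply: eq_integral => t _; rewrite muleC.
by rewrite integral0_eq// => t _; rewrite mule0.
Qed.

Section duality.
Variables (Y : Omega * R -> \bar R) (H : R * E -> \bar R) (t : R).
Hypothesis mY : measurable_fun setT (Y : PS -> \bar R).
Hypothesis Y0 : forall z, 0 <= Y z.
Hypothesis mH : measurable_fun setT H.
Hypothesis H0 : forall y, 0 <= H y.
Hypothesis Hlt0 : forall y, (y.1 < 0)%R -> H y = 0.
Hypothesis Hgt : forall y, (t < y.1)%R -> H y = 0.

Let W w (y : R * E) := Y (w, y.1) * H y.

Let W0 w y : 0 <= W w y. Proof. by rewrite mule_ge0. Qed.

Lemma measurable_field : measurable_fun setT (fun z : Omega * (R * E) => W z.1 z.2).
Proof.
apply: emeasurable_funM; last exact: (measurableT_comp mH measurable_snd).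
apply: (measurableT_comp (predictable_measurable_fun hTX mY)).
apply: measurable_fun_pair => //.
exact: (measurableT_comp measurable_fst measurable_snd).
Qed.

Lemma measurable_field_path w : measurable_fun setT (W w).
Proof. exact: (measurableT_comp measurable_field (pair1_measurable w)). Qed.

Lemma measurable_integral_mpp_field :
  measurable_fun setT (fun w => \int[N w]_y W w y).
Proof.
apply: (measurable_integral_mpp hTX measurable_field) => z; exact: W0.
Qed.

Let field_pred : predictable_field Fl (fun y => Y y.1 * H (y.1.2, y.2)).
Proof. exact: predictable_field_mul. Qed.

Let field_ge0 z : 0 <= Y z.1 * H (z.1.2, z.2). Proof. by rewrite mule_ge0. Qed.

Lemma integral_mpp_compensator :
  \int[P]_w \int[N w]_y W w y = \int[P]_w \int[nu w]_y W w y.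
Proof.
have dual := compensator_dual hcomp field_pred field_ge0.
have WD w : (fun y : R * E => Y (w, y.1) * H (y.1, y.2)) \_ (`[0%R, +oo[%classic `*` [set: E]) = W w.
  apply/funext => -[u x]; rewrite patchE /W/=; case: (leP 0%R u) => u0.
    by rewrite mem_set//; split => //=; rewrite in_itv/= u0.
  rewrite memNset; first by rewrite (Hlt0 (y := (u, x)))// mule0.
  by rewrite /= in_itv/= andbT leNgt u0 => -[].
have mkE (mu : {measure set (R * E) -> \bar R}) w :
    \int[mu]_(y in `[0%R, +oo[%classic `*` [set: E]) (Y (w, y.1) * H (y.1, y.2)) =
    \int[mu]_y W w y.
  by rewrite integral_mkcond WD.
transitivity (\int[P]_w \int[N w]_(y in `[0%R, +oo[%classic `*` [set: E])
    (Y (w, y.1) * H (y.1, y.2))).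
  by apply: eq_integral => w _; rewrite mkE.
by apply: etrans dual _; apply: eq_integral => w _; exact: mkE.
Qed.

Lemma predictable_integral_compensator :
  measurable_fun setT (fun z : PS => \int[nu z.1]_y ((y.1 <= z.2)%R%:R%:E * W z.1 y)).
Proof.
have := compensator_predictable hcomp field_pred field_ge0.
rewrite /predictable_process => mK.
have mD : measurable ([set: Omega] `*` `[0%R, +oo[%classic : set PS).
  have := @measurable_predictable_domain _ _ _ _ _ T X; congr measurable.
  apply/seteqP; split => [[w u]/= u0|[w u] /= [_]]; last by rewrite in_itv/= andbT.
  by split => //=; rewrite in_itv/= u0.
move/(measurable_restrictT _ mD) : mK; congr measurable_fun.
apply/funext => -[w u]; rewrite patchE /=; case: (leP 0%R u) => u0.
  rewrite mem_set; last by split => //=; rewrite in_itv/= u0.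
  rewrite integral_mkcond; apply: eq_integral => -[s x] _; rewrite patchE /W/=.
  case: (leP 0%R s) => s0; last first.
    rewrite memNset ?(Hlt0 (y := (s, x)))// ?mule0 ?mule0//.
    by rewrite /= in_itv/= leNgt s0 => -[].
  case: (leP s u) => su.
    by rewrite mem_set ?mul1e//; split => //=; rewrite in_itv/= s0.
  by rewrite memNset ?mul0e// /= in_itv/= s0 leNgt su => -[].
rewrite memNset; last by rewrite /= in_itv/= andbT leNgt u0 => -[].
rewrite integral0_eq// => -[s x] _ /=; case: leP => su; last by rewrite mul0e.
by rewrite /W Hlt0 ?mule0//=; exact: le_lt_trans u0.
Qed.

(** Predictability of the compensator concerns integrals up to a running time. Its section at time
    [t] is the full integral, because [H] vanishes after [t]. *)
Lemma measurable_integral_compensator :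
  measurable_fun setT (fun w => \int[nu w]_y W w y).
Proof.
have := predictable_measurable_fun hTX predictable_integral_compensator.
move=> /measurableT_comp /(_ (pair2_measurable t)).
congr measurable_fun; apply/funext => w /=; apply: eq_integral => -[s x] _ /=.
by case: leP => st; rewrite ?mul1e// mul0e /W Hgt ?mule0.
Qed.

End duality.

(** The indicator that stops the process at [T n]. The non-strict inequality makes it predictable
    and keeps the point [T n] itself, so the stopped sums have [n.+1] terms. *)
Definition mpp_alive (n : nat) (z : Omega * R) : \bar R := (z.2%:E <= T n z.1)%E%:R%:E.

Lemma measurable_mpp_alive n : measurable_fun setT (mpp_alive n : PS -> \bar R).
Proof. by apply: measurable_natr_bool; exact: (@measurable_predictable_after _ _ _ _ _ _ X hTX). Qed.

Lemma mpp_alive_ge0 n z : 0 <= mpp_alive n z. Proof. by rewrite lee_fin. Qed.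

Lemma mpp_alive_le n z w (u : R) : (u <= z)%R -> mpp_alive n (w, z) <= mpp_alive n (w, u).
Proof.
move=> uz; rewrite /mpp_alive lee_fin ler_nat/=.
case: (leP z%:E) => // zT; rewrite (le_trans _ zT)//.
Qed.

Lemma integral_mpp_alive n (H : R * E -> \bar R) w : measurable_fun setT H -> (forall y, 0 <= H y) ->
  \int[N w]_y (mpp_alive n (w, y.1) * H y) = \sum_(i < n.+1) mpp_eval T X H i w.
Proof.
move=> mH H0; rewrite (integral_mpp hTX); last 2 first.
- apply: emeasurable_funM => //.
  apply: (measurableT_comp (predictable_measurable_fun hTX (@measurable_mpp_alive n))).
  by apply: measurable_fun_pair => //; exact: measurable_cst.
- by move=> y; rewrite mule_ge0 ?mpp_alive_ge0.
rewrite (nneseries_ord (n := n.+1)).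
- apply: eq_bigr => i _; rewrite /mpp_eval; case: ifPn => // Ti.
  by rewrite /mpp_alive/= (mpp_fineK hTX Ti) (mpp_time_homo hTX) ?mul1e// -ltnS.
- by move=> i; apply: mpp_eval_ge0 => y; rewrite mule_ge0 ?mpp_alive_ge0.
- move=> i ni; rewrite /mpp_eval; case: ifPn => // Ti.
  rewrite /mpp_alive/= (mpp_fineK hTX Ti) leNgt (mpp_time_lt_lt hTX)//= ?mul0e//.
  by apply: le_lt_trans Ti; apply: (mpp_time_homo hTX); exact: ltnW.
Qed.

Section first_moment.
Variable q : R.
Hypothesis q01 : (0 <= q < 1)%R.
Hypothesis hq : \int[Q]_x \int[leb]_u fertility (u, x) = q%:E.
Variable t : R.
Hypothesis t0 : (0 <= t)%R.

Let cut (y : R * E) : \bar R := (0 <= y.1 <= t)%R%:R%:E.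

Let mcut : measurable_fun setT cut.
Proof.
apply: measurable_natr_bool; apply: measurable_and.
  by apply: measurable_fun_ler => //; exact: measurable_fst.
by apply: measurable_fun_ler => //; exact: measurable_fst.
Qed.

Let cut0 y : 0 <= cut y. Proof. by rewrite lee_fin. Qed.

Let phi x := \int[leb]_u fertility (u, x).

Let mphi : measurable_fun setT phi.
Proof.
apply: (@measurable_fun_fubini_tonelli_G _ _ _ _ R leb fertility).
  exact: measurable_fertility.
exact: fertility_ge0.
Qed.

Let phi0 x : 0 <= phi x.
Proof. by apply: integral_ge0 => u _; exact: fertility_ge0. Qed.

Let cutphi (y : R * E) := cut y * phi y.2.

Let mcutphi : measurable_fun setT cutphi.
Proof. apply: emeasurable_funM => //; exact: measurableT_comp mphi measurable_snd. Qed.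

Let cutphi0 y : 0 <= cutphi y. Proof. by rewrite mule_ge0. Qed.

Let W n w (y : R * E) := mpp_alive n (w, y.1) * cut y.

Let Wphi n w (y : R * E) := mpp_alive n (w, y.1) * cutphi y.

Let mW n w : measurable_fun setT (W n w).
Proof. by apply: measurable_field_path => //; exact: measurable_mpp_alive. Qed.

Let mWphi n w : measurable_fun setT (Wphi n w).
Proof. by apply: measurable_field_path => //; exact: measurable_mpp_alive. Qed.

Let W0 n w y : 0 <= W n w y. Proof. by rewrite mule_ge0 ?mpp_alive_ge0. Qed.

Let Wphi0 n w y : 0 <= Wphi n w y. Proof. by rewrite mule_ge0 ?mpp_alive_ge0. Qed.

Let Q1 (g : R -> \bar R) u : \int[Q]_x (cst (g u) x) = g u.
Proof. by rewrite integral_cst//= [X in _ * X](@probability_setT _ _ _ Q) mule1. Qed.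

(** A child at time [u] of a point at [s < u] can be alive and before [t] only if its parent is,
    since both indicators decrease along positive times. Moving them from [u] to [s] leaves the
    integral of the fertility over [u], which is [phi] of the parent's mark. *)
Let compensator_cut_le n w :
  \int[nu w]_y W n w y <= (m * t)%:E + \int[N w]_y Wphi n w y.
Proof.
rewrite integral_compensator_series//.
have QW u : \int[Q]_x W n w (u, x) = mpp_alive n (w, u) * (0 <= u <= t)%R%:R%:E.
  exact: (Q1 (fun u => mpp_alive n (w, u) * (0 <= u <= t)%R%:R%:E) u).
under eq_integral do rewrite QW.
have mQW : measurable_fun [set: R] (fun u : R => mpp_alive n (w, u) * (0 <= u <= t)%R%:R%:E).
  by have := measurableT_comp (mW n w) (pair2_measurable (point : E)).
apply: leeD.
  rewrite EFinM lee_wpmul2l ?lee_fin//.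
  apply: (@le_trans _ _ (\int[leb]_(u in `[0%R, +oo[) (\1_`[0%R, t] u)%:E)).
    apply: ge0_le_integral => //.
    - by move=> u _; rewrite mule_ge0 ?mpp_alive_ge0 ?lee_fin.
    - exact: measurable_funTS mQW.
    - by apply/measurable_EFinP/measurable_funTS; exact: measurable_indic.
    move=> u _; rewrite indicE mem_setE in_itv/= -[leRHS]mul1e lee_wpmul2r ?lee_fin//.
    by rewrite lern1; case: (_ <= _).
  rewrite integral_indic//; apply: (@le_trans _ _ (leb `[0%R, t]%classic)).
    by apply: le_measure; rewrite ?inE//; exact: measurableI.
  by rewrite lebesgue_measure_itv/= lte_fin; case: ltP; rewrite ?oppr0 ?addr0 ?lee_fin.
rewrite (integral_mpp hTX)//; apply: lee_nneseries => [i _ _|i _].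
  apply: mpp_eval_ge0 => y; apply: integral_ge0 => u _; rewrite mule_ge0 ?fertility_ge0//.
  by apply: integral_ge0.
rewrite /mpp_eval; case: ifPn => // Ti.
have := mpp_time_gt0 hTX i w; rewrite -{1}(mpp_fineK hTX Ti) lte_fin.
move: (fine (T i w)) (odflt _ _) => s x s0 /=; rewrite /Wphi/= /cutphi/=.
pose c := mpp_alive n (w, s) * cut (s, x).
have c0 : 0 <= c by rewrite mule_ge0 ?mpp_alive_ge0.
have mfs : measurable_fun [set: R] (fun u : R => fertility ((u - s)%R, x)).
  apply: (measurableT_comp measurable_fertility); apply: measurable_fun_pair => //.
  exact: measurable_addr.
have mfx : measurable_fun [set: R] (fun u : R => fertility (u, x)).
  exact: (measurableT_comp measurable_fertility (pair2_measurable x)).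
have phiE : \int[leb]_u fertility ((u - s)%R, x) = phi x.
  by apply: (ge0_integral_shift s mfx) => u; exact: fertility_ge0.
rewrite muleA -/c -phiE.
apply: (@le_trans _ _ (\int[leb]_(u in `[0%R, +oo[) (c * fertility ((u - s)%R, x)))).
  apply: ge0_le_integral => //.
  - by move=> u _; rewrite mule_ge0 ?fertility_ge0// QW mule_ge0 ?mpp_alive_ge0 ?lee_fin.
  - apply: measurable_funTS; apply: emeasurable_funM => //.
    by under eq_fun do rewrite QW.
  - by apply: measurable_funTS; exact: emeasurable_funM.
  move=> u _; rewrite QW muleC /fertility/=.
  case: ifPn => [|_]; last by rewrite !mule0.
  rewrite subr_gt0 => su; apply: lee_wpmul2r.
    by have [_ h _ _] := hf; rewrite lee_fin; apply: h; rewrite subr_ge0 ltW.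
  apply: lee_pmul; rewrite ?mpp_alive_ge0 ?lee_fin//.
    by apply: mpp_alive_le; exact: ltW.
  rewrite ler_nat /= (ltW s0)/= (ltW (lt_trans s0 su))/=.
  by case: leP => // ut; rewrite (le_trans (ltW su)).
rewrite ge0_integralZl//; last 2 first.
- exact: measurable_funTS.
- by move=> u _; exact: fertility_ge0.
rewrite lee_wpmul2l//; apply: ge0_subset_integral => //.
by move=> u _; exact: fertility_ge0.
Qed.

(** Under [nu] the marks have law [Q] at each time, and [q] is the [Q]-mean of [phi]. *)
Let compensator_cutphi n w : \int[nu w]_y Wphi n w y = q%:E * \int[nu w]_y W n w y.
Proof.
rewrite !integral_compensator//.
have QW u : \int[Q]_x W n w (u, x) = mpp_alive n (w, u) * (0 <= u <= t)%R%:R%:E.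
  exact: (Q1 (fun u => mpp_alive n (w, u) * (0 <= u <= t)%R%:R%:E) u).
have QWphi u : \int[Q]_x Wphi n w (u, x) = q%:E * \int[Q]_x W n w (u, x).
  have c0 : 0 <= mpp_alive n (w, u) * (0 <= u <= t)%R%:R%:E.
    by rewrite mule_ge0 ?mpp_alive_ge0 ?lee_fin.
  rewrite QW muleC -hq -(ge0_integralZl _ measurableT mphi (fun x _ => phi0 x) c0).
  by apply: eq_integral => x _; rewrite /Wphi/cutphi/cut muleA.
under eq_integral do rewrite QWphi muleCA.
rewrite ge0_integralZl//.
- apply: measurable_funTS; apply: emeasurable_funM; first exact: measurable_intensity.
  exact: (@measurable_fun_fubini_tonelli_F _ _ _ _ R Q _ (@mW n w) (@W0 n w)).
- by move=> u _; rewrite mule_ge0 ?intensity_ge0//; exact: integral_ge0.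
- by rewrite lee_fin; case/andP: q01.
Qed.

Let cut_lt0 y : (y.1 < 0)%R -> cut y = 0.
Proof. by move=> y0; rewrite /cut leNgt y0. Qed.

Let cut_gt y : (t < y.1)%R -> cut y = 0.
Proof. by move=> yt; rewrite /cut (leNgt y.1) yt andbF. Qed.

Let cutphi_lt0 y : (y.1 < 0)%R -> cutphi y = 0.
Proof. by move=> y0; rewrite /cutphi cut_lt0// mul0e. Qed.

(** With [x] the stopped first moment, duality, the offspring bound, and duality again for [Wphi]
    give [x <= m t + q x]. Stopping supplies [x <= n.+1], hence the finiteness required to absorb
    [q x]. *)
Let alive_moment n : \int[P]_w \int[N w]_y W n w y <= (1 - q)^-1%:E * (m * t)%:E.
Proof.
have mal := @measurable_mpp_alive n.
have dual := integral_mpp_compensator mal (@mpp_alive_ge0 n) mcut cut0 cut_lt0.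
have dualphi := integral_mpp_compensator mal (@mpp_alive_ge0 n) mcutphi cutphi0 cutphi_lt0.
have mnu := measurable_integral_compensator mal (@mpp_alive_ge0 n) mcut cut0 cut_lt0 cut_gt.
have mNphi := measurable_integral_mpp_field mal (@mpp_alive_ge0 n) mcutphi cutphi0.
apply: ge0_fin_contraction => //.
- by apply: integral_ge0 => w _; exact: integral_ge0.
- apply: (@le_lt_trans _ _ (\int[P]_w (cst n.+1%:R%:E w))).
    apply: ge0_le_integral => //.
    + by move=> w _; exact: integral_ge0.
    + exact: (measurable_integral_mpp_field mal (@mpp_alive_ge0 n) mcut cut0).
    move=> w _; rewrite integral_mpp_alive//=.
    rewrite (@le_trans _ _ (\sum_(i < n.+1) 1))//; last by rewrite sumEFin sumr_const card_ord.
    apply: lee_sum => i _; rewrite /mpp_eval; case: ifP => // _; rewrite ?lee_fin//.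
    by rewrite lern1; case: (_ && _).
  by rewrite integral_cst//= [X in _ * X](@probability_setT _ _ _ P) mule1 ltry.
rewrite {1}dual.
apply: (@le_trans _ _ (\int[P]_w ((m * t)%:E + \int[N w]_y Wphi n w y))).
  apply: ge0_le_integral => //.
  - by move=> w _; apply: integral_ge0 => y _; exact: W0.
  - by apply: emeasurable_funD => //; exact: measurable_cst.
  - by move=> w _; exact: compensator_cut_le.
rewrite ge0_integralD//; last 2 first.
- by move=> w _; rewrite lee_fin mulr_ge0.
- by move=> w _; exact: integral_ge0.
rewrite (_ : \int[P]_w (m * t)%:E = (m * t)%:E); last first.
  by rewrite integral_cst//= [X in _ * X](@probability_setT _ _ _ P) mule1.
apply: leeD => //; rewrite [leLHS]dualphi.
under eq_integral do rewrite compensator_cutphi.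
rewrite ge0_integralZl//.
- by rewrite lee_wpmul2l ?lee_fin//; [case/andP: q01|rewrite [leRHS]dual].
- by move=> w _; exact: integral_ge0.
- by rewrite lee_fin; case/andP: q01.
Qed.

Lemma first_moment : \int[P]_w \int[N w]_y cut y <= (1 - q)^-1%:E * (m * t)%:E.
Proof.
have NE w : \int[N w]_y cut y = \sum_(i <oo) mpp_eval T X cut i w by exact: integral_mpp.
under eq_integral do rewrite NE.
have me i : measurable_fun setT (fun w => mpp_eval T X cut i w).
  by apply: (measurable_mpp_eval (W := fun z => cut z.2) hTX); exact: measurableT_comp mcut measurable_snd.
have e0 i w : 0 <= mpp_eval T X cut i w by exact: mpp_eval_ge0.
rewrite integral_nneseries//; apply: lime_le.
  by apply: is_cvg_nneseries => i _ _; exact: integral_ge0.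
apply: nearW => n; apply: le_trans (alive_moment n).
under [leRHS]eq_integral do rewrite integral_mpp_alive//.
rewrite big_mkord -ge0_integral_sum//; apply: ge0_le_integral => //.
- by move=> w _; exact: sume_ge0.
- exact: emeasurable_sum.
- exact: emeasurable_sum.
- by move=> w _; rewrite big_ord_recr leeDl.
Qed.

End first_moment.

End hawkes.

(** * Second moments *)

Section hawkes_isometry.
Context {R : realType} {dO dE : measure_display}.
Context {Omega : measurableType dO} {E : measurableType dE}.
Variables (P : probability Omega R) (Q : probability E R).
Variables (m : R) (f : R -> E -> R).
Hypothesis m0 : 0 <= m.
Hypothesis hf : hawkes_fertility Q f.
Variables (T : nat -> Omega -> \bar R) (X : nat -> Omega -> option E).
Hypothesis hTX : marked_point_process T X.
Let N := mpp_measure T X.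
Let Fl := natural_filtration N.
Let PS := g_sigma_algebraType (predictable_rectangles Fl).
Variable nu : Omega -> {measure set (R * E)%type -> \bar R}.
Hypothesis hcomp : compensator P Fl N nu.
Hypothesis nuE : forall w (B : set (R * E)), measurable B ->
  (nu w B = \int[lebesgue_measure]_(t in `[0%R, +oo[%classic)
     hawkes_kernel Q m f N w t (xsection B t))%E.
Local Notation leb := (@lebesgue_measure R).
Local Open Scope ereal_scope.

Variables (n : nat) (t c : R) (H : R * E -> R).
Hypothesis t0 : (0 <= t)%R.
Hypothesis mH : measurable_fun setT H.
Hypothesis H0 : forall y, (0 <= H y)%R.
Hypothesis Hc : forall y, (H y <= c)%R.
Hypothesis Hlt0 : forall y, (y.1 < 0)%R -> H y = 0%R.
Hypothesis Hgt : forall y, (t < y.1)%R -> H y = 0%R.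

Let He (y : R * E) : \bar R := (H y)%:E.
Let mHe : measurable_fun setT He. Proof. exact/measurable_EFinP. Qed.
Let He0 y : 0 <= He y. Proof. by rewrite lee_fin. Qed.
Let Helt0 y : (y.1 < 0)%R -> He y = 0. Proof. by rewrite /He => /Hlt0 ->. Qed.
Let Hegt y : (t < y.1)%R -> He y = 0. Proof. by rewrite /He => /Hgt ->. Qed.

Let al := mpp_alive T n.
Let mal : measurable_fun setT (al : PS -> \bar R) := measurable_mpp_alive hTX n.
Let al0 z : 0 <= al z := mpp_alive_ge0 T n z.

Let W w (y : R * E) := al (w, y.1) * He y.
Let J w := \int[N w]_y W w y.
Let K w := \int[nu w]_y W w y.

Let Jm (z : Omega * R) := \int[mpp_before T X n z]_y He y.
Let mJm : measurable_fun setT (Jm : PS -> \bar R).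
Proof. exact: (measurable_integral_before hTX). Qed.
Let Jm0 z : 0 <= Jm z. Proof. by apply: integral_ge0 => y _. Qed.

Let Kc (z : Omega * R) := \int[nu z.1]_y ((y.1 <= z.2)%R%:R%:E * W z.1 y).
Let mKc : measurable_fun setT (Kc : PS -> \bar R).
Proof. exact: (predictable_integral_compensator hcomp mal al0 mHe He0 Helt0). Qed.
Let W0 w y : 0 <= W w y. Proof. exact: mule_ge0. Qed.
Let Kc0 z : 0 <= Kc z.
Proof. by apply: integral_ge0 => y _; apply: mule_ge0; rewrite ?W0 ?lee_fin. Qed.

(** [Kc] freezes after [T n] but does not vanish there. The factor [al] stops the integral of [Kc];
    in the [nu]-integral it is also what turns [He] back into [W]. *)
Let KA z := Kc z * al z.
Let mKA : measurable_fun setT (KA : PS -> \bar R). Proof. exact: emeasurable_funM. Qed.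
Let KA0 z : 0 <= KA z. Proof. exact: mule_ge0. Qed.

Let WJ w (y : R * E) := Jm (w, y.1) * He y.
Let WK w (y : R * E) := KA (w, y.1) * He y.
Let H2 y := He y * He y.
Let mH2 : measurable_fun setT H2. Proof. exact: emeasurable_funM. Qed.
Let H20 y : 0 <= H2 y. Proof. exact: mule_ge0. Qed.
Let H2lt0 y : (y.1 < 0)%R -> H2 y = 0. Proof. by rewrite /H2 => /Helt0 ->; rewrite mule0. Qed.
Let W2 w (y : R * E) := al (w, y.1) * H2 y.

Let mW w : measurable_fun setT (W w).
Proof. exact: (measurable_field_path hTX mal mHe w). Qed.

Let e w i : R := if T i w < +oo then H (fine (T i w), odflt point (X i w)) else 0%R.

Let eE w i : mpp_eval T X He i w = (e w i)%:E.
Proof. by rewrite /mpp_eval /e; case: ifP. Qed.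

Let e0 w i : (0 <= e w i)%R. Proof. by rewrite /e; case: ifP. Qed.

Let JE w : J w = \sum_(i < n.+1) (e w i)%:E.
Proof. by rewrite /J (integral_mpp_alive hTX)//; apply: eq_bigr => i _; rewrite eE. Qed.

Let JmE w i : T i w < +oo -> (i < n.+1)%N ->
  Jm (w, fine (T i w)) = \sum_(j < i) (e w j)%:E.
Proof.
move=> Ti ni; rewrite /Jm (integral_mpp_before hTX)//= (mpp_fineK hTX Ti).
have -> : T i w <= T n w by apply: (mpp_time_homo hTX); rewrite -ltnS.
rewrite -(big_mkord xpredT (fun j => if T j w < T i w then mpp_eval T X He j w else 0)).
rewrite -(big_mkord xpredT (fun j => (e w j)%:E)).
rewrite (@big_cat_nat _ _ _ i)//= [X in _ + X]big1_seq ?adde0; last first.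
  move=> j /andP[_]; rewrite mem_index_iota => /andP[ij _].
  by rewrite ltNge (mpp_time_homo hTX).
rewrite big_nat_cond [RHS]big_nat_cond; apply: eq_bigr => j /andP[/andP[_ ji] _].
rewrite (mpp_time_lt_lt hTX)// ?eE//.
by apply: le_lt_trans Ti; apply: (mpp_time_homo hTX); exact: ltnW.
Qed.

Let NWJ w : \int[N w]_y WJ w y = \sum_(i < n.+1) (\sum_(j < i) (e w j)%:E) * (e w i)%:E.
Proof.
rewrite (integral_mpp hTX); last 2 first.
- exact: (measurable_field_path hTX mJm mHe w).
- by move=> y; exact: mule_ge0.
rewrite (nneseries_ord (n := n.+1)).
- apply: eq_bigr => i _; rewrite -eE /mpp_eval; case: ifPn => Ti; last by rewrite mule0.
  by rewrite /WJ/= JmE.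
- by move=> i; apply: mpp_eval_ge0 => y; exact: mule_ge0.
- move=> i ni; rewrite /mpp_eval; case: ifPn => // Ti.
  rewrite /WJ/= /Jm (integral_mpp_before hTX)//= (mpp_fineK hTX Ti) leNgt.
  rewrite (mpp_time_lt_lt hTX)//= ?mul0e//.
  by apply: le_lt_trans Ti; apply: (mpp_time_homo hTX); exact: ltnW.
Qed.

Let NW2 w : \int[N w]_y W2 w y = \sum_(i < n.+1) (e w i)%:E * (e w i)%:E.
Proof.
rewrite (integral_mpp_alive hTX)//; apply: eq_bigr => i _; rewrite -eE /mpp_eval.
by case: ifP => // _; rewrite mule0.
Qed.

Let JJ w : J w * J w = 2%:E * (\int[N w]_y WJ w y) + \int[N w]_y W2 w y.
Proof.
rewrite NWJ NW2 JE.
have -> : \sum_(i < n.+1) (\sum_(j < i) (e w j)%:E) * (e w i)%:E =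
    (\sum_(i < n.+1) (\sum_(j < i) e w j) * e w i)%R%:E.
  by rewrite -sumEFin; apply: eq_bigr => i _; rewrite sumEFin EFinM.
have -> : \sum_(i < n.+1) (e w i)%:E * (e w i)%:E = (\sum_(i < n.+1) e w i * e w i)%R%:E.
  by rewrite -sumEFin; apply: eq_bigr => i _; rewrite EFinM.
rewrite sumEFin -!EFinM -EFinD; congr (_%:E).
elim: n.+1 => [|k IH]; first by rewrite !big_ord0; ring.
rewrite !big_ord_recr/= mulrDl !mulrDr IH; ring.
Qed.

Let mcutW w (b : R * E -> bool) : measurable_fun setT b ->
  measurable_fun setT (fun y => (b y)%:R%:E * W w y).
Proof. by move=> mb; apply: emeasurable_funM => //; exact: measurable_natr_bool. Qed.

Let cutW0 w (b : R * E -> bool) y : 0 <= (b y)%:R%:E * W w y.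
Proof. by apply: mule_ge0; rewrite ?W0 ?lee_fin. Qed.

Let JmW w y : \sum_(i < n.+1) (e w i)%:E * ((T i w < y.1%:E)%E%:R%:E * W w y) = WJ w y.
Proof.
rewrite /WJ /Jm (integral_mpp_before hTX)//= /W /al /mpp_alive/=.
case: ifPn => [yT|_]; last first.
  by rewrite !mul0e big1// => i _; rewrite !mule0.
(* The term of index [n] is void: it requires [T n < y.1], while being alive means [y.1 <= T n]. *)
rewrite mul1e big_ord_recr/= (ltNge (T n w)) yT/= mul0e mule0 adde0 ge0_sume_distrl; last first.
  by move=> i _; case: ifP => // _; rewrite eE lee_fin.
apply: eq_bigr => i _; rewrite eE.
by case: (T i w < _); rewrite ?mul1e// !mul0e mule0.
Qed.

(** Integration by parts: at each point, [K] splits into the part up to [T i] and the part after it.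
    Weighted by [e w i] and summed, the former give the [N]-integral of [WK]; the latter, exchanged
    with the finite sum, give the [nu]-integral of [WJ]. *)
Let JK w : J w * K w = \int[nu w]_y WJ w y + \int[N w]_y WK w y.
Proof.
have mgt (a : \bar R) : measurable_fun setT (fun y : R * E => (a < y.1%:E)%E).
  apply: measurable_fun_lte => //.
  by apply/measurable_EFinP; exact: measurable_fst.
have mle (a : R) : measurable_fun setT (fun y : R * E => (y.1 <= a)%R).
  by apply: measurable_fun_ler => //; exact: measurable_fst.
have -> : \int[nu w]_y WJ w y =
    \sum_(i < n.+1) \int[nu w]_y ((e w i)%:E * ((T i w < y.1%:E)%E%:R%:E * W w y)).
  rewrite -ge0_integral_sum//.
  - by apply: eq_integral => y _; rewrite JmW.
  - by move=> i; apply: emeasurable_funM => //; exact: mcutW.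
  - move=> i y _; apply: mule_ge0; first by rewrite lee_fin.
    exact: (cutW0 w (fun y : R * E => T i w < y.1%:E)).
have -> : \int[N w]_y WK w y = \sum_(i < n.+1) mpp_eval T X (fun y => Kc (w, y.1) * He y) i w.
  rewrite -(integral_mpp_alive hTX).
  - by apply: eq_integral => y _; rewrite /WK /KA [RHS]muleA; congr (_ * _); exact: muleC.
  - exact: (measurable_field_path hTX mKc mHe w).
  - by move=> y; exact: mule_ge0.
rewrite JE ge0_sume_distrl; last by move=> i _; rewrite lee_fin.
rewrite -big_split/=; apply: eq_bigr => i _.
rewrite addeC /mpp_eval /e; case: ifPn => Ti; last first.
  by rewrite mul0e add0e integral0_eq// => y _; rewrite mul0e.
set s := fine (T i w); set x := odflt _ _.
rewrite (ge0_integralZl _ measurableT (mcutW w (mgt (T i w)))) ?lee_fin//; last first.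
  by move=> y _; exact: (cutW0 w (fun y : R * E => T i w < y.1%:E)).
have -> : K w = Kc (w, s) + \int[nu w]_y ((T i w < y.1%:E)%E%:R%:E * W w y).
  rewrite /Kc -ge0_integralD//; last 4 first.
  - by move=> y _; exact: (cutW0 w (fun y : R * E => y.1 <= s)%R).
  - exact: mcutW.
  - by move=> y _; exact: (cutW0 w (fun y : R * E => T i w < y.1%:E)).
  - exact: mcutW.
  apply: eq_integral => y _; rewrite -(mpp_fineK hTX Ti) lte_fin -/s/=.
  by case: leP => _; rewrite mul1e mul0e ?adde0 ?add0e.
rewrite ge0_muleDr//; last by apply: integral_ge0 => y _; exact: (cutW0 w (fun y : R * E => T i w < y.1%:E)).
by rewrite /= muleC.
Qed.

(** In time, [nu] has a density: [K] is the integral of [k] over the line and [Kc] its primitive, so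
    the claim is the cut of a square along its diagonal. Only this inequality is proved, and it goes
    in the direction needed. *)
Let KK w : K w * K w <= 2%:E * \int[nu w]_y WK w y.
Proof.
pose h u := \int[Q]_x W w (u, x).
have h0 u : 0 <= h u by apply: integral_ge0 => x _; exact: W0.
have mh : measurable_fun setT h.
  exact: (@measurable_fun_fubini_tonelli_F _ _ _ _ R Q _ (mW w) (W0 w)).
pose k := (fun u => intensity m f T X w u * h u) \_ `[0%R, +oo[%classic.
have k0 u : 0 <= k u.
  by rewrite /k patchE; case: ifP => // _; apply: mule_ge0 => //; exact: (intensity_ge0 m0 hf).
have mk : measurable_fun setT k.
  apply/(measurable_restrictT _ _).1 => //; apply: measurable_funTS.
  by apply: emeasurable_funM => //; exact: (measurable_intensity m hf T X).
have KE : K w = \int[leb]_u k u.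
  by rewrite /K (integral_compensator m0 hf hTX nuE w (mW w) (W0 w)) integral_mkcond.
have KcE u : Kc (w, u) = \int[leb]_s ((s <= u)%R%:R%:E * k s).
  rewrite /Kc (integral_compensator m0 hf hTX nuE); last 2 first.
  - by apply: mcutW; apply: measurable_fun_ler => //; exact: measurable_fst.
  - by move=> y; exact: (cutW0 w (fun y : R * E => y.1 <= u)%R).
  rewrite integral_mkcond; apply: eq_integral => s _; rewrite /k !patchE.
  case: ifPn => _; last by rewrite mule0.
  rewrite muleCA; congr (_ * _); rewrite /= ge0_integralZl//.
  exact: (measurableT_comp (mW w) (pair1_measurable s)).
have WKE : \int[nu w]_y WK w y = \int[leb]_u (k u * \int[leb]_s ((s <= u)%R%:R%:E * k s)).
  rewrite (integral_compensator m0 hf hTX nuE); last 2 first.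
  - exact: (measurable_field_path hTX mKA mHe w).
  - by move=> y; exact: mule_ge0.
  rewrite integral_mkcond; apply: eq_integral => u _; rewrite -KcE /k !patchE.
  case: ifPn => _; last by rewrite mul0e.
  rewrite -muleA (muleC (h u)); congr (_ * _).
  rewrite /h -ge0_integralZl//.
  - by apply: eq_integral => x _; rewrite /WK/KA/W muleA.
  - exact: (measurableT_comp (mW w) (pair1_measurable u)).
by rewrite KE WKE; exact: ge0_integral_sqr_le.
Qed.

Let J0 w : 0 <= J w. Proof. by apply: integral_ge0 => y _; exact: W0. Qed.
Let K0 w : 0 <= K w. Proof. by apply: integral_ge0 => y _; exact: W0. Qed.

Let mJ : measurable_fun setT J.
Proof. exact: (measurable_integral_mpp_field hTX mal al0 mHe He0). Qed.

Let mK : measurable_fun setT K.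
Proof. exact: (measurable_integral_compensator hTX hcomp mal al0 mHe He0 Helt0 Hegt). Qed.

Let c0 : (0 <= c)%R. Proof. exact: le_trans (H0 (0%R, point)) (Hc _). Qed.

Let J_le w : J w <= (c *+ n.+1)%:E.
Proof.
rewrite JE sumEFin lee_fin; apply: (@le_trans _ _ (\sum_(i < n.+1) c)%R).
  by apply: ler_sum => i _; rewrite /e; case: ifP.
by rewrite sumr_const card_ord.
Qed.

Let dualJ : \int[P]_w J w = \int[P]_w K w.
Proof. exact: (integral_mpp_compensator hcomp mal al0 mHe He0 Helt0). Qed.

(** [J] is at most [c] times [n.+1], and by duality [K] has the same mean as [J]. *)
Let EJK_lty : \int[P]_w (J w * K w) < +oo.
Proof.
have cn0 : (0 <= c *+ n.+1)%R by rewrite mulrn_wge0.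
apply: (@le_lt_trans _ _ (\int[P]_w ((c *+ n.+1)%:E * K w))).
  apply: ge0_le_integral => //.
  - by move=> w _; exact: mule_ge0.
  - exact: emeasurable_funM.
  - exact: emeasurable_funM.
  - by move=> w _; rewrite lee_wpmul2r.
rewrite ge0_integralZl ?lee_fin//.
rewrite -dualJ lte_mul_pinfty ?lee_fin//.
apply: (@le_lt_trans _ _ (\int[P]_w (cst (c *+ n.+1)%:E w))).
  by apply: ge0_le_integral.
by rewrite integral_cst//= [X in _ * X](@probability_setT _ _ _ P) mule1 ltry.
Qed.

(** Written without subtracting the product, since [K] may be infinite where [J] is finite; both
    sides are then [+oo]. *)
Let sqr_sub w : (J w - K w) * (J w - K w) + 2%:E * (J w * K w) = J w * J w + K w * K w.
Proof.
have := J0 w; have := K0 w.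
have : J w \is a fin_num by rewrite ge0_fin_numE// (le_lt_trans (J_le w))// ltry.
case: (J w) => // j _; case: (K w) => [k| |] // _ j0.
  by rewrite -EFinB -!EFinM -!EFinD; congr (_%:E); ring.
rewrite /= mulNyNy addye; last first.
  have h : 0 <= 2%:E * (j%:E * +oo) by apply: mule_ge0; rewrite ?lee_fin// mule_ge0 ?leey.
  by apply/eqP => E1; rewrite E1 in h.
by rewrite mulyy addey.
Qed.

(* The Ito isometry without martingales. With [J_-] the integral of [H] over the
   past of the integration point, [J^2 = 2 int J_- dN + int H^2 dN],
   [J K = int J_- dnu + int Kc dN] and [K^2 <= 2 int Kc dnu]; since [J_-] and
   [Kc] are predictable, all cross terms cancel in expectation. Stopping at the
   [n]-th point bounds [J], which keeps the subtraction legitimate. *)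
Lemma stopped_isometry_le : \int[P]_w ((J w - K w) * (J w - K w)) <= \int[P]_w \int[nu w]_y W2 w y.
Proof.
have dWJ := integral_mpp_compensator hcomp mJm Jm0 mHe He0 Helt0.
have dWK := integral_mpp_compensator hcomp mKA KA0 mHe He0 Helt0.
have dW2 := integral_mpp_compensator hcomp mal al0 mH2 H20 H2lt0.
have mNWJ := measurable_integral_mpp_field hTX mJm Jm0 mHe He0.
have mNWK := measurable_integral_mpp_field hTX mKA KA0 mHe He0.
have mNW2 := measurable_integral_mpp_field hTX mal al0 mH2 H20.
have mnWJ := measurable_integral_compensator hTX hcomp mJm Jm0 mHe He0 Helt0 Hegt.
have mnWK := measurable_integral_compensator hTX hcomp mKA KA0 mHe He0 Helt0 Hegt.
have sq0 w : 0 <= (J w - K w) * (J w - K w).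
  by have [h|h] := leP 0 (J w - K w); [exact: mule_ge0|rewrite mule_le0// ltW].
have EJK0 : 0 <= \int[P]_w (J w * K w) by apply: integral_ge0 => w _; exact: mule_ge0.
have EJKf : 2%:E * \int[P]_w (J w * K w) \is a fin_num.
  by rewrite fin_numM// ge0_fin_numE.
(* Adding the finite term [2 E[J K]] to both sides leaves only sums of nonnegative terms. *)
rewrite -(leeD2rE _ _ EJKf).
have mJK : measurable_fun setT (fun w => J w * K w) by exact: emeasurable_funM.
have JK0 w : 0 <= J w * K w by exact: mule_ge0.
have two0 : (0 : \bar R) <= 2%:E by rewrite lee_fin.
rewrite -ge0_integralZl; [|exact: measurableT|exact: mJK|by move=> w _; exact: JK0|exact: two0].
rewrite -ge0_integralD; [|exact: measurableT|by move=> w _; exact: sq0| |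
  by move=> w _; exact: mule_ge0|]; last 2 first.
- by apply: emeasurable_funM; exact: (emeasurable_funB mJ mK).
- by apply: emeasurable_funM; [exact: measurable_cst|exact: mJK].
have NWJ0 w : 0 <= \int[N w]_y WJ w y by apply: integral_ge0 => y _; exact: mule_ge0.
have NW20 w : 0 <= \int[N w]_y W2 w y by apply: integral_ge0 => y _; exact: mule_ge0.
have NWK0 w : 0 <= \int[N w]_y WK w y by apply: integral_ge0 => y _; exact: mule_ge0.
have nWJ0 w : 0 <= \int[nu w]_y WJ w y by apply: integral_ge0 => y _; exact: mule_ge0.
have nWK0 w : 0 <= \int[nu w]_y WK w y by apply: integral_ge0 => y _; exact: mule_ge0.
under eq_integral do rewrite sqr_sub.
rewrite ge0_integralD; [|exact: measurableT|by move=> w _; exact: mule_ge0|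
  exact: (emeasurable_funM mJ mJ)|by move=> w _; exact: mule_ge0|exact: (emeasurable_funM mK mK)].
have -> : \int[P]_w (2%:E * (J w * K w)) =
    2%:E * (\int[P]_w \int[nu w]_y WJ w y + \int[P]_w \int[N w]_y WK w y).
  rewrite ge0_integralZl; [|exact: measurableT|exact: mJK|by move=> w _; exact: JK0|exact: two0].
  congr (_ * _); rewrite -ge0_integralD;
    [|exact: measurableT|by move=> w _; exact: nWJ0|exact: mnWJ|by move=> w _; exact: NWK0|exact: mNWK].
  by apply: eq_integral => w _; exact: JK.
have -> : \int[P]_w (J w * J w) =
    2%:E * (\int[P]_w \int[N w]_y WJ w y) + \int[P]_w \int[N w]_y W2 w y.
  rewrite -ge0_integralZl; [|exact: measurableT|exact: mNWJ|by move=> w _; exact: NWJ0|exact: two0].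
  rewrite -ge0_integralD; [|exact: measurableT|by move=> w _; exact: mule_ge0| |
    by move=> w _; exact: NW20|exact: mNW2].
  - by apply: eq_integral => w _; exact: JJ.
  - by apply: emeasurable_funM; [exact: measurable_cst|exact: mNWJ].
(* After duality, [a], [b] and [d] are the means of the [nu]-integrals of [WJ], [W2] and [WK], and
   [k] is the mean of [K * K]; the left side comes from [J J + K K], the right one from [W2] and
   [2 J K]. *)
have comb (a b d k : \bar R) : 0 <= a -> 0 <= d -> k <= 2%:E * d ->
    2%:E * a + b + k <= b + 2%:E * (a + d).
  move=> a0 d0 kd; rewrite [in leRHS]ge0_muleDr// (addeC _ b) -addeA.
  by apply: leeD => //; exact: leeD.
have EKK : \int[P]_w (K w * K w) <= 2%:E * \int[P]_w \int[nu w]_y WK w y.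
  rewrite -ge0_integralZl; [|exact: measurableT|exact: mnWK|by move=> w _; exact: nWK0|exact: two0].
  apply: ge0_le_integral.
  - exact: measurableT.
  - by move=> w _; exact: mule_ge0.
  - exact: (emeasurable_funM mK mK).
  - by apply: emeasurable_funM; [exact: measurable_cst|exact: mnWK].
  - by move=> w _; exact: KK.
have -> : \int[P]_w \int[N w]_y WJ w y = \int[P]_w \int[nu w]_y WJ w y := dWJ.
have -> : \int[P]_w \int[N w]_y W2 w y = \int[P]_w \int[nu w]_y W2 w y := dW2.
have -> : \int[P]_w \int[N w]_y WK w y = \int[P]_w \int[nu w]_y WK w y := dWK.
apply: comb => //.
- by apply: integral_ge0 => w _; exact: nWJ0.
- by apply: integral_ge0 => w _; exact: nWK0.
Qed.

End hawkes_isometry.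

Section hawkes_second_moment.
Context {R : realType} {dO dE : measure_display}.
Context {Omega : measurableType dO} {E : measurableType dE}.
Variables (P : probability Omega R) (Q : probability E R).
Variables (m : R) (f : R -> E -> R).
Hypothesis m0 : 0 <= m.
Hypothesis hf : hawkes_fertility Q f.
Variables (T : nat -> Omega -> \bar R) (X : nat -> Omega -> option E).
Hypothesis hTX : marked_point_process T X.
Let N := mpp_measure T X.
Let Fl := natural_filtration N.
Let PS := g_sigma_algebraType (predictable_rectangles Fl).
Variable nu : Omega -> {measure set (R * E)%type -> \bar R}.
Hypothesis hcomp : compensator P Fl N nu.
Hypothesis nuE : forall w (B : set (R * E)), measurable B ->
  (nu w B = \int[lebesgue_measure]_(t in `[0%R, +oo[%classic)
     hawkes_kernel Q m f N w t (xsection B t))%E.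
Local Notation leb := (@lebesgue_measure R).
Local Open Scope ereal_scope.

Variable q : R.
Hypothesis q01 : (0 <= q < 1)%R.
Hypothesis hq : \int[Q]_x \int[leb]_u fertility f (u, x) = q%:E.
Variable t : R.
Hypothesis t0 : (0 <= t)%R.

Let cut (y : R * E) : \bar R := (0 <= y.1 <= t)%R%:R%:E.
Let mcut : measurable_fun setT cut.
Proof.
apply: measurable_natr_bool; apply: measurable_and.
  by apply: measurable_fun_ler => //; exact: measurable_fst.
by apply: measurable_fun_ler => //; exact: measurable_fst.
Qed.
Let cut0 y : 0 <= cut y. Proof. by rewrite lee_fin. Qed.
Let cut_lt0 y : (y.1 < 0)%R -> cut y = 0.
Proof. by move=> y0; rewrite /cut leNgt y0. Qed.
Let cut_gt y : (t < y.1)%R -> cut y = 0.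
Proof. by move=> yt; rewrite /cut (leNgt y.1) yt andbF. Qed.

(** The constant process specialises the duality to deterministic integrands. *)
Let one (z : Omega * R) : \bar R := 1.
Let mone : measurable_fun setT (one : PS -> \bar R). Proof. exact: measurable_cst. Qed.
Let one0 z : 0 <= one z. Proof. by []. Qed.

Lemma measurable_integral_mpp_det (g : R * E -> \bar R) : measurable_fun setT g ->
  (forall y, 0 <= g y) -> measurable_fun setT (fun w => \int[N w]_y g y).
Proof.
move=> mg g0; have := measurable_integral_mpp_field hTX mone one0 mg g0.
congr measurable_fun; apply/funext => w.
by apply: eq_integral => y _; rewrite mul1e.
Qed.

Lemma measurable_integral_compensator_det (g : R * E -> \bar R) : measurable_fun setT g ->
  (forall y, 0 <= g y) -> (forall y, (y.1 < 0)%R -> g y = 0) -> (forall y, (t < y.1)%R -> g y = 0) ->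
  measurable_fun setT (fun w => \int[nu w]_y g y).
Proof.
move=> mg g0 glt ggt.
have := measurable_integral_compensator hTX hcomp mone one0 mg g0 glt ggt.
congr measurable_fun; apply/funext => w.
by apply: eq_integral => y _; rewrite mul1e.
Qed.

(** [nu] sees only the mark average of [g], which is at most [C] on [[0, t]] and 0 elsewhere. So [g]
    may be compared with [C] times the indicator of [[0, t]], whose mean integral is the first
    moment. *)
Lemma mean_integral_compensator_le (g : R * E -> \bar R) (C : R) : measurable_fun setT g ->
  (forall y, 0 <= g y) -> (0 <= C)%R ->
  (forall y, (y.1 < 0)%R -> g y = 0) -> (forall y, (t < y.1)%R -> g y = 0) ->
  (forall u, \int[Q]_x g (u, x) <= C%:E) ->
  \int[P]_w \int[nu w]_y g y <= C%:E * ((1 - q)^-1%:E * (m * t)%:E).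
Proof.
move=> mg g0 C0 glt ggt gC.
have mnucut := measurable_integral_compensator_det mcut cut0 cut_lt0 cut_gt.
apply: (@le_trans _ _ (C%:E * \int[P]_w \int[nu w]_y cut y)).
  rewrite -ge0_integralZl//; last by move=> w _; exact: integral_ge0.
  apply: ge0_le_integral => //.
  - by move=> w _; exact: integral_ge0.
  - exact: measurable_integral_compensator_det.
  - exact: emeasurable_funM.
  move=> w _; rewrite !(integral_compensator m0 hf hTX nuE)//.
  have mQ (h : R * E -> \bar R) : measurable_fun setT h -> (forall y, 0 <= h y) ->
      measurable_fun [set: R] (fun u => intensity m f T X w u * \int[Q]_x h (u, x)).
    move=> mh h0; apply: emeasurable_funM; first exact: (measurable_intensity m hf T X).
    exact: (@measurable_fun_fubini_tonelli_F _ _ _ _ R Q h).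
  have lam0 u : 0 <= intensity m f T X w u := intensity_ge0 m0 hf T X w u.
  rewrite -ge0_integralZl//; last 2 first.
  - by apply: measurable_funTS; exact: mQ.
  - by move=> u _; rewrite mule_ge0//; exact: integral_ge0.
  apply: ge0_le_integral => //.
  - by move=> u _; rewrite mule_ge0//; exact: integral_ge0.
  - by apply: measurable_funTS; exact: mQ.
  - by apply: measurable_funTS; apply: emeasurable_funM => //; exact: mQ.
  move=> u; rewrite /= in_itv/= andbT => u0; rewrite muleCA lee_wpmul2l//.
  have [ut|tu] := leP u t; last first.
    rewrite integral0_eq => [|x _]; last by rewrite ggt.
    by rewrite mule_ge0//; exact: integral_ge0.
  have -> : \int[Q]_x cut (u, x) = 1.
    rewrite (eq_integral (cst 1)); last by move=> x _; rewrite /cut/= u0 ut.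
    by rewrite integral_cst//= [X in _ * X](@probability_setT _ _ _ Q) mule1.
  by rewrite mule1.
rewrite lee_wpmul2l ?lee_fin//.
have := integral_mpp_compensator hcomp mone one0 mcut cut0 cut_lt0.
under eq_integral => w _ do under eq_integral do rewrite mul1e.
under [in RHS]eq_integral => w _ do under eq_integral do rewrite mul1e.
by move=> <-; exact: (first_moment m0 hf hTX hcomp nuE q01 hq t0).
Qed.

Lemma mpp_ae_finite : {ae P, forall w, \int[N w]_y cut y < +oo}.
Proof.
have mNcut := measurable_integral_mpp_det mcut cut0.
have H := first_moment m0 hf hTX hcomp nuE q01 hq t0.
have int : P.-integrable setT (fun w => \int[N w]_y cut y).
  apply/integrableP; split => //.
  under eq_integral => w _ do rewrite gee0_abs ?integral_ge0//.
  by apply: (le_lt_trans H); rewrite -EFinM ltry.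
have := integrable_ae measurableT int.
by apply: filterS => w /(_ Logic.I); rewrite ge0_fin_numE// integral_ge0.
Qed.

Lemma mpp_time_gt_near w : \int[N w]_y cut y < +oo -> exists n, t%:E < T n w.
Proof.
move=> Nfin; apply/not_existsP => H.
have HT n : T n w <= t%:E by rewrite leNgt; exact/negP/H.
have : \int[N w]_y cut y = mpp_count N t setT w.
  rewrite (integral_mpp hTX)// (mpp_countE hTX)//; apply: eq_eseriesr => n _.
  rewrite /mpp_eval; case: ifPn => // Ti; congr (_%:R%:E).
  rewrite in_setT andbT /= (_ : (0 <= fine (T n w))%R)//.
  by apply: fine_ge0; exact/ltW/(mpp_time_gt0 hTX).
move=> E1; move: Nfin; rewrite E1 => Nfin.
have N0 : 0 <= mpp_count N t setT w by exact: measure_ge0.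
have Nf : mpp_count N t setT w \is a fin_num by rewrite ge0_fin_numE.
(* If all times were at most [t], the count would exceed the integer part of its own value by
   one. *)
have := HT (Num.truncn (fine (mpp_count N t setT w))).
rewrite (mpp_time_le_count hTX) -/N -[X in _ <= X](fineK Nf) lee_fin leNgt.
by rewrite truncnS_gt.
Qed.

Section limit.
Variables (c : R) (H : R * E -> R).
Hypothesis mH : measurable_fun setT H.
Hypothesis H0 : forall y, (0 <= H y)%R.
Hypothesis Hc : forall y, (H y <= c)%R.
Hypothesis Hlt0 : forall y, (y.1 < 0)%R -> H y = 0%R.
Hypothesis Hgt : forall y, (t < y.1)%R -> H y = 0%R.

Let He (y : R * E) : \bar R := (H y)%:E.
Let mHe : measurable_fun setT He. Proof. exact/measurable_EFinP. Qed.
Let He0 y : 0 <= He y. Proof. by rewrite lee_fin. Qed.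
Let Helt0 y : (y.1 < 0)%R -> He y = 0. Proof. by rewrite /He => /Hlt0 ->. Qed.
Let Hegt y : (t < y.1)%R -> He y = 0. Proof. by rewrite /He => /Hgt ->. Qed.

(** The squares of the stopped integrals are not monotone in [n]. Where [t < T n], stopping changes
    nothing; so the unstopped square restricted to that event is below the stopped one, and it
    increases to the full square almost surely, since almost no path explodes before [t]. *)
Lemma isometry_le : \int[P]_w ((\int[N w]_y He y - \int[nu w]_y He y) * (\int[N w]_y He y - \int[nu w]_y He y))
  <= \int[P]_w \int[nu w]_y (He y * He y).
Proof.
pose J n w := \int[N w]_y (mpp_alive T n (w, y.1) * He y).
pose K n w := \int[nu w]_y (mpp_alive T n (w, y.1) * He y).
have sq0 (x : \bar R) : 0 <= x * x.
  by have [h|h] := leP 0 x; [exact: mule_ge0|rewrite mule_le0// ltW].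
have mJ n : measurable_fun setT (J n).
  exact: (measurable_integral_mpp_field hTX (measurable_mpp_alive hTX n) (mpp_alive_ge0 T n) mHe He0).
have mK n : measurable_fun setT (K n).
  exact: (measurable_integral_compensator hTX hcomp (measurable_mpp_alive hTX n) (mpp_alive_ge0 T n) mHe He0 Helt0 Hegt).
have mJi := measurable_integral_mpp_det mHe He0.
have mKi := measurable_integral_compensator_det mHe He0 Helt0 Hegt.
pose D n w := (J n w - K n w) * (J n w - K n w).
have mD n : measurable_fun setT (D n).
  by apply: emeasurable_funM; apply: emeasurable_funB.
have D0 n w : 0 <= D n w by exact: sq0.
have Dle n : \int[P]_w D n w <= \int[P]_w \int[nu w]_y (He y * He y).
  apply: le_trans (stopped_isometry_le m0 hf hTX hcomp nuE n mH H0 Hc Hlt0 Hgt) _.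
  have HH0 y : 0 <= He y * He y by exact: mule_ge0.
  have mHH : measurable_fun setT (fun y => He y * He y) by exact: emeasurable_funM.
  have HHlt y : (y.1 < 0)%R -> He y * He y = 0 by move=> /Helt0 ->; rewrite mule0.
  have HHgt y : (t < y.1)%R -> He y * He y = 0 by move=> /Hegt ->; rewrite mule0.
  apply: ge0_le_integral => //.
  - by move=> w _; apply: integral_ge0 => y _; rewrite mule_ge0// mpp_alive_ge0.
  - exact: (measurable_integral_compensator hTX hcomp (measurable_mpp_alive hTX n) (mpp_alive_ge0 T n) mHH HH0 HHlt HHgt).
  - exact: measurable_integral_compensator_det.
  move=> w _; apply: ge0_le_integral => //.
  - by move=> y _; rewrite mule_ge0// mpp_alive_ge0.
  - exact: (measurable_field_path hTX (measurable_mpp_alive hTX n) mHH w).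
  - move=> y _; rewrite -[leRHS]mul1e lee_wpmul2r// lee_fin lern1.
    by case: (_ <= _).
pose Di w := (\int[N w]_y He y - \int[nu w]_y He y) * (\int[N w]_y He y - \int[nu w]_y He y).
have mDi : measurable_fun setT Di by apply: emeasurable_funM; exact: emeasurable_funB.
have Di0 w : 0 <= Di w by exact: sq0.
pose g n w := (t%:E < T n w)%E%:R%:E * Di w.
have g0 n w : 0 <= g n w by rewrite mule_ge0 ?lee_fin.
have mb n : measurable_fun setT (fun w => t%:E < T n w)%E.
  by apply: measurable_fun_lte => //; exact: (mpp_measurable_time hTX).
have mg n : measurable_fun setT (g n).
  by apply: emeasurable_funM => //; exact: measurable_natr_bool.
have ndg w : nondecreasing_seq (g ^~ w).
  move=> i j ij; rewrite /g lee_wpmul2r// lee_fin ler_nat.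
  by case: (ltP t%:E (T i w)) => // tT; rewrite (lt_le_trans tT)//; exact: (mpp_time_homo hTX).
have gle n : \int[P]_w g n w <= \int[P]_w \int[nu w]_y (He y * He y).
  apply: le_trans (Dle n); apply: ge0_le_integral => //.
  move=> w _; rewrite /g; case: ltP => tT; last by rewrite mul0e.
  have aliveE y : mpp_alive T n (w, y.1) * He y = He y.
    have [yt|ty] := leP y.1 t; last by rewrite Hegt// mule0.
    have yT : y.1%:E <= T n w by apply: le_trans (ltW tT); rewrite lee_fin.
    by rewrite /mpp_alive/= yT mul1e.
  rewrite mul1e /Di /D /J /K.
  have -> : \int[N w]_y (mpp_alive T n (w, y.1) * He y) = \int[N w]_y He y.
    by apply: eq_integral => y _; exact: aliveE.
  have -> : \int[nu w]_y (mpp_alive T n (w, y.1) * He y) = \int[nu w]_y He y.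
    by apply: eq_integral => y _; exact: aliveE.
  by [].
rewrite (_ : \int[P]_w _ = \int[P]_w limn (g ^~ w)).
  rewrite monotone_convergence//; apply: lime_le.
    apply: ereal_nondecreasing_is_cvgn => i j ij; apply: ge0_le_integral => //.
    by move=> w _; exact: ndg.
  by apply: nearW.
have cvg_g w : cvgn (g ^~ w) by exact: ereal_nondecreasing_is_cvgn.
apply: ge0_ae_eq_integral => //.
- exact: (emeasurable_fun_cvg g).
- by move=> w _; apply: lime_ge => //; apply: nearW.
apply: filterS mpp_ae_finite => w /mpp_time_gt_near [n0 tn0] _.
apply/esym/cvg_lim => //; apply: cvg_near_cst; exists n0 => // n /= nn.
rewrite /g (_ : (t%:E < T n w) = true) ?mul1e//.
by apply: lt_le_trans tn0 _; exact: (mpp_time_homo hTX).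
Qed.

End limit.

End hawkes_second_moment.

Lemma sqr_le_add1 {R : realType} (x y : \bar R) : (0 <= x -> 0 <= y -> x <= 1 + y ->
  x * x <= 2%:E + 2%:E * (y * y))%E.
Proof.
move: x y => [x| |] [y| |]//=; rewrite ?lee_fin.
- move=> x0 y0 xy; rewrite -?EFinM -?EFinD ?lee_fin.
  have : (x * x <= (1 + y) * (1 + y))%R by apply: ler_pM.
  have : (0 <= (1 - y) ^+ 2)%R by exact: sqr_ge0.
  rewrite expr2; nra.
- by move=> _ _ _; rewrite mulyy gt0_muley ?lte_fin// addey// leey.
- by move=> _ _ _; rewrite mulyy gt0_muley ?lte_fin// addey// leey.
Qed.

(** * The variance of the marked count *)

Section hawkes_variance.
Context {R : realType} {dO dE : measure_display}.
Context {Omega : measurableType dO} {E : measurableType dE}.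
Variables (P : probability Omega R) (Q : probability E R).
Variables (m : R) (f : R -> E -> R).
Hypothesis m0 : 0 <= m.
Hypothesis hf : hawkes_fertility Q f.
Variables (T : nat -> Omega -> \bar R) (X : nat -> Omega -> option E).
Hypothesis hTX : marked_point_process T X.
Let N := mpp_measure T X.
Let Fl := natural_filtration N.
Let PS := g_sigma_algebraType (predictable_rectangles Fl).
Variable nu : Omega -> {measure set (R * E)%type -> \bar R}.
Hypothesis hcomp : compensator P Fl N nu.
Hypothesis nuE : forall w (B : set (R * E)), measurable B ->
  (nu w B = \int[lebesgue_measure]_(t in `[0%R, +oo[%classic)
     hawkes_kernel Q m f N w t (xsection B t))%E.
Local Notation leb := (@lebesgue_measure R).
Local Open Scope ereal_scope.

Variables (q M S kap : R).
Hypothesis q01 : (0 <= q < 1)%R.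
Let phi x := \int[leb]_u fertility f (u, x).
Hypothesis hq : \int[Q]_x phi x = q%:E.
Hypothesis fM : forall u x, (0 <= u)%R -> (f u x <= M)%R.
Hypothesis hS : \int[Q]_x (phi x * phi x) = S%:E.
Let Fe u := \int[Q]_x fertility f (u, x).
Variable psi : R -> \bar R.
Hypothesis mpsi : measurable_fun setT psi.
Hypothesis psi0 : forall v, 0 <= psi v.
Hypothesis psi_le : forall v, psi v <= kap%:E.
Hypothesis psiE : forall v, (0 <= v)%R ->
  psi v = 1 + \int[leb]_u (Fe u * ((u <= v)%R%:R%:E * psi (v - u)%R)).
Variables (A : set E) (t : R).
Hypothesis mA : measurable A.
Hypothesis t0 : (0 <= t)%R.

Let cut (y : R * E) : \bar R := (0 <= y.1 <= t)%R%:R%:E.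
Let mcut : measurable_fun setT cut.
Proof.
apply: measurable_natr_bool; apply: measurable_and.
  by apply: measurable_fun_ler => //; exact: measurable_fst.
by apply: measurable_fun_ler => //; exact: measurable_fst.
Qed.
Let cut0 y : 0 <= cut y. Proof. by rewrite lee_fin. Qed.
Let QA := fine (Q A).
Let QAE : Q A = QA%:E. Proof. by rewrite /QA fineK// fin_num_measure. Qed.
Let QA0 : (0 <= QA)%R. Proof. by rewrite -lee_fin -QAE. Qed.
Let QA1 : (QA <= 1)%R. Proof. by rewrite -lee_fin -QAE probability_le1. Qed.
Let kap0 : (0 <= kap)%R. Proof. by rewrite -lee_fin; exact: le_trans (psi0 0%R) (psi_le 0%R). Qed.
Let M0 : (0 <= M)%R.
Proof. by have [_ h _ _] := hf; apply: le_trans (fM (point : E) (lexx 0%R)); exact: h. Qed.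
Let ft0 := fertility_ge0 hf.
Let mft := measurable_fertility hf.

Let mphi : measurable_fun setT phi.
Proof. exact: (@measurable_fun_fubini_tonelli_G _ _ _ _ R leb (fertility f)). Qed.
Let phi0 x : 0 <= phi x. Proof. by apply: integral_ge0 => u _; exact: ft0. Qed.
Let mFe : measurable_fun setT Fe.
Proof. exact: (@measurable_fun_fubini_tonelli_F _ _ _ _ R Q (fertility f)). Qed.
Let Fe0 u : 0 <= Fe u. Proof. by apply: integral_ge0 => x _; exact: ft0. Qed.

Let cp (u : R) : \bar R := (u <= t)%R%:R%:E * psi (t - u)%R.
Let cp0 u : 0 <= cp u. Proof. by rewrite mule_ge0 ?lee_fin. Qed.
Let cp_le u : cp u <= kap%:E.
Proof.
rewrite /cp; case: (leP u t) => _; first by rewrite mul1e.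
by rewrite mul0e lee_fin.
Qed.
Let mcp : measurable_fun setT cp.
Proof.
apply: emeasurable_funM.
  by apply: measurable_natr_bool; exact: measurable_fun_ler.
apply: (measurableT_comp mpsi); exact: measurable_funB.
Qed.

Let fs (y : R * E) (u : R) : \bar R := fertility f ((u - y.1)%R, y.2).
Let fs0 y u : 0 <= fs y u. Proof. exact: ft0. Qed.
Let mfs y : measurable_fun [set: R] (fs y).
Proof.
apply: (measurableT_comp mft); apply: measurable_fun_pair => //.
exact: measurable_addr.
Qed.
Let mfscp y : measurable_fun [set: R] (fun u => fs y u * cp u).
Proof. exact: (emeasurable_funM (mfs y) mcp). Qed.
Let fscp0 y u : 0 <= fs y u * cp u. Proof. exact: mule_ge0. Qed.

(** In the branching picture, the mean number of descendants up to [t] of a point [y]. The horizon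
    [t] enters through [cp], which vanishes after it. *)
Let G (y : R * E) := \int[leb]_u (fs y u * cp u).
Let G0 y : 0 <= G y. Proof. by apply: integral_ge0 => u _; exact: fscp0. Qed.
Let mfs2 : measurable_fun setT (fun z : (R * E) * R => fs z.1 z.2 * cp z.2).
Proof.
apply: emeasurable_funM; last exact: (measurableT_comp mcp measurable_snd).
apply: (measurableT_comp mft); apply: measurable_fun_pair => /=.
  apply: measurable_funB; first exact: measurable_snd.
  exact: (measurableT_comp measurable_fst measurable_fst).
exact: (measurableT_comp measurable_snd measurable_fst).
Qed.
Let mG : measurable_fun setT G.
Proof.
exact: (@measurable_fun_fubini_tonelli_F _ _ _ _ R leb (fun z => fs z.1 z.2 * cp z.2) mfs2
  (fun z => fscp0 z.1 z.2)).
Qed.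

Let fs_int y : \int[leb]_u fs y u = phi y.2.
Proof.
apply: (ge0_integral_shift y.1 (g := fun u => fertility f (u, y.2))) => [|u]; last exact: ft0.
exact: (measurableT_comp mft (pair2_measurable y.2)).
Qed.

(** Uniform in [t], but [phi] need not be bounded over the marks: this bound serves the variance,
    through the second moment [S] of [phi]. *)
Let G_le_phi y : G y <= kap%:E * phi y.2.
Proof.
rewrite -fs_int -ge0_integralZl;
  [|exact: measurableT|exact: mfs|by move=> u _; exact: fs0|by rewrite lee_fin].
apply: ge0_le_integral.
- exact: measurableT.
- by move=> u _; exact: fscp0.
- exact: mfscp.
- by apply: emeasurable_funM; [exact: measurable_cst|exact: mfs].
- by move=> u _; rewrite muleC lee_wpmul2r//; exact: cp_le.
Qed.

(** Uniform over the marks but growing with [t]: this bound serves finiteness only, that of the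
    integrand in the isometry and that of [B]. *)
Let G_le y : (0 <= y.1)%R -> G y <= (M * kap * t)%:E.
Proof.
move=> y0.
apply: (@le_trans _ _ (\int[leb]_u ((M * kap)%:E * (\1_`[0%R, t] u)%:E))).
  apply: ge0_le_integral.
  - exact: measurableT.
  - by move=> u _; exact: fscp0.
  - exact: mfscp.
  - by apply: emeasurable_funM; [exact: measurable_cst|apply/measurable_EFinP; exact: measurable_indic].
  move=> u _; rewrite /fs /fertility/= subr_gt0 indicE mem_setE in_itv/=.
  case: ifPn => [yu|_]; last by rewrite mul0e mule_ge0 ?lee_fin ?mulr_ge0.
  rewrite (le_trans y0 (ltW yu))/= /cp; case: (leP u t) => ut; last by rewrite mul0e !mule0.
  rewrite mul1e mule1 EFinM; apply: lee_pmul => //.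
    by have [_ h _ _] := hf; rewrite lee_fin; apply: h; rewrite subr_ge0 ltW.
  by rewrite lee_fin; apply: fM; rewrite subr_ge0 ltW.
rewrite ge0_integralZl; [|exact: measurableT|by apply/measurable_EFinP; exact: measurable_indic|
  by move=> u _; rewrite lee_fin|by rewrite lee_fin mulr_ge0].
have lebt : leb `[0%R, t]%classic = t%:E.
  by rewrite lebesgue_measure_itv/= lte_fin; case: ltgtP t0 => // [_ _|<- _]; rewrite ?oppr0 ?adde0.
rewrite integral_indic// setIT; apply: (@le_trans _ _ ((M * kap)%:E * t%:E)); last by rewrite EFinM.
by rewrite -lebt.
Qed.

(** After averaging over marks and a shift by [u], this is the renewal equation at [t - u]. *)
Let psiG u : (0 <= u <= t)%R -> 1 + \int[Q]_x G (u, x) = psi (t - u)%R.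
Proof.
move=> /andP[u0 ut]; rewrite psiE ?subr_ge0//; congr (_ + _).
pose h (z : E * R) := fs (u, z.1) z.2 * cp z.2.
have mh : measurable_fun setT h.
  apply: emeasurable_funM; last exact: (measurableT_comp mcp measurable_snd).
  apply: (measurableT_comp mft); apply: measurable_fun_pair => /=; last exact: measurable_fst.
  by apply: measurable_funB; [exact: measurable_snd|exact: measurable_cst].
have h0 z : 0 <= h z by exact: mule_ge0.
have := @fubini_tonelli _ _ _ _ R Q leb h mh h0; rewrite /h/= => E1.
transitivity (\int[leb]_v (Fe (v - u)%R * cp v)).
  rewrite /G E1; apply: eq_integral => v _; rewrite ge0_integralZr//.
  exact: (measurableT_comp mft (pair1_measurable (v - u)%R)).
pose g (v : R) := Fe v * ((v <= t - u)%R%:R%:E * psi (t - u - v)%R).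
have mg : measurable_fun setT g.
  apply: emeasurable_funM => //; apply: emeasurable_funM.
    by apply: measurable_natr_bool; exact: measurable_fun_ler.
  by apply: (measurableT_comp mpsi); exact: measurable_funB.
have g0 v : 0 <= g v by rewrite !mule_ge0 ?lee_fin.
rewrite -(ge0_integral_shift u mg g0); apply: eq_integral => v _.
rewrite /g /cp lerD2r; congr (_ * (_ * psi _)); lra.
Qed.

(* By the renewal equation of [psi], the [nu]-integral of [He] is a constant plus
   [QA * int G dN], a term which also occurs in its [N]-integral; hence the
   compensated integral of [He] is the centered count. *)
Let He (y : R * E) := cut y * ((y.2 \in A)%:R%:E + QA%:E * G y).
Let c := (1 + QA * (M * kap * t))%R.
Let mH1 : measurable_fun setT (fun y : R * E => (y.2 \in A)%:R%:E : \bar R).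
Proof.
apply/measurable_EFinP.
have mi : measurable_fun setT (\1_A : E -> R) by exact: measurable_indic.
exact: (measurableT_comp mi measurable_snd).
Qed.
Let mHe : measurable_fun setT He.
Proof.
apply: emeasurable_funM => //; apply: emeasurable_funD => //.
by apply: emeasurable_funM => //; exact: measurable_cst.
Qed.
Let He0 y : 0 <= He y.
Proof. by rewrite mule_ge0// adde_ge0 ?lee_fin// mule_ge0 ?lee_fin. Qed.
Let He_le y : He y <= c%:E.
Proof.
rewrite /He /cut; case: (boolP (0 <= y.1 <= t)%R) => [/andP[y0 _]|_].
  rewrite mul1e /c EFinD EFinM; apply: leeD; first by rewrite lee_fin lern1; case: (_ \in _).
  by rewrite lee_wpmul2l ?lee_fin//; exact: G_le.
by rewrite mul0e lee_fin addr_ge0// !mulr_ge0.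
Qed.
Let He_lt0 y : (y.1 < 0)%R -> He y = 0.
Proof. by move=> y0; rewrite /He /cut leNgt y0/= mul0e. Qed.
Let He_gt y : (t < y.1)%R -> He y = 0.
Proof. by move=> y0; rewrite /He /cut (leNgt y.1) y0 andbF mul0e. Qed.
Let H y := fine (He y).
Let HE y : (H y)%:E = He y.
Proof. by rewrite fineK// ge0_fin_numE// (le_lt_trans (He_le y))// ltry. Qed.

(** [He] is at most [1 + kap phi x], because [QA <= 1], and [(1 + y)^2 <= 2 + 2 y^2] gives the
    constant. It depends on neither [u] nor [t], whence a variance linear in [t]. *)
Let He_sqr u : \int[Q]_x (He (u, x) * He (u, x)) <= (2 + 2 * (kap ^+ 2 * S))%:E.
Proof.
have mr : measurable_fun setT (fun x : E => 2%:E + (2 * kap ^+ 2)%:E * (phi x * phi x)).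
  apply: emeasurable_funD; first exact: measurable_cst.
  by apply: emeasurable_funM; [exact: measurable_cst|exact: (emeasurable_funM mphi mphi)].
have mHu : measurable_fun setT (fun x : E => He (u, x)).
  exact: (measurableT_comp mHe (pair1_measurable u)).
apply: (@le_trans _ _ (\int[Q]_x (2%:E + (2 * kap ^+ 2)%:E * (phi x * phi x)))).
  apply: ge0_le_integral.
  - exact: measurableT.
  - by move=> x _; exact: mule_ge0.
  - exact: emeasurable_funM.
  - exact: mr.
  move=> x _; apply: le_trans (sqr_le_add1 (y := kap%:E * phi x) _ _ _) _ => //.
  - by rewrite mule_ge0 ?lee_fin.
  - rewrite /He /cut; case: (boolP (0 <= (u, x).1 <= t)%R) => _; last first.
      by rewrite mul0e adde_ge0// ?mule_ge0 ?lee_fin.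
    rewrite mul1e; apply: leeD; first by rewrite lee_fin lern1; case: (_ \in _).
    rewrite -[leRHS]mul1e; apply: lee_pmul => //; exact: G_le_phi.
  - by rewrite (muleACA kap%:E) -EFinM -expr2 (muleA 2%:E) -EFinM.
rewrite ge0_integralD; [|exact: measurableT|by move=> x _; rewrite lee_fin|exact: measurable_cst|
  by move=> x _; rewrite mule_ge0 ?lee_fin ?mulr_ge0 ?sqr_ge0 ?mule_ge0|
  by apply: emeasurable_funM; [exact: measurable_cst|exact: (emeasurable_funM mphi mphi)]].
rewrite ge0_integralZl; [|exact: measurableT|exact: (emeasurable_funM mphi mphi)|
  by move=> x _; exact: mule_ge0|by rewrite lee_fin mulr_ge0 ?sqr_ge0].
rewrite hS integral_cst//= [X in _ * X + _](@probability_setT _ _ _ Q) mule1.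
by rewrite -EFinM -EFinD mulrA.
Qed.

Let QHe u : \int[Q]_x He (u, x) = (0 <= u <= t)%R%:R%:E * (QA%:E * psi (t - u)%R).
Proof.
rewrite /He /cut /=; case: (boolP (0 <= u <= t)%R) => ut; last first.
  by rewrite mul0e integral0_eq// => x _; rewrite mul0e.
under eq_integral do rewrite mul1e.
have mGu : measurable_fun setT (fun x : E => G (u, x)).
  exact: (measurableT_comp mG (pair1_measurable u)).
rewrite ge0_integralD; [|exact: measurableT|by move=> x _; rewrite lee_fin| |
  by move=> x _; rewrite mule_ge0 ?lee_fin|by apply: emeasurable_funM; [exact: measurable_cst|exact: mGu]];
  last first.
  exact: (measurableT_comp mH1 (pair1_measurable u)).
rewrite ge0_integralZl; [|exact: measurableT|exact: mGu|by move=> x _; exact: G0|by rewrite lee_fin].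
have iG0 : 0 <= \int[Q]_x G (u, x) by apply: integral_ge0 => x _; exact: G0.
rewrite -psiG// (ge0_muleDr _ _ iG0)//.
rewrite mul1e mule1; congr (_ + _); rewrite -QAE -[in RHS](setIT A).
by rewrite -integral_indic.
Qed.

Let ct := m%:E * \int[leb]_(u in `[0%R, +oo[) ((0 <= u <= t)%R%:R%:E * (QA%:E * psi (t - u)%R)).

Let B w := QA%:E * \int[N w]_y (cut y * G y).
Let mcutG : measurable_fun setT (fun y => cut y * G y). Proof. exact: (emeasurable_funM mcut mG). Qed.
Let cutG0 y : 0 <= cut y * G y. Proof. exact: mule_ge0. Qed.

Let intN w : \int[N w]_y He y = mpp_count N t A w + B w.
Proof.
have mc1 : measurable_fun setT (fun y : R * E => cut y * (y.2 \in A)%:R%:E).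
  exact: (emeasurable_funM mcut mH1).
transitivity (\int[N w]_y (cut y * (y.2 \in A)%:R%:E + QA%:E * (cut y * G y))).
  apply: eq_integral => y _; rewrite /He ge0_muleDr ?lee_fin// ?mule_ge0 ?lee_fin//.
  by rewrite [X in _ + X]muleCA.
rewrite ge0_integralD; [|exact: measurableT|by move=> y _; rewrite mule_ge0 ?lee_fin|exact: mc1|
  by move=> y _; rewrite mule_ge0 ?lee_fin|by apply: emeasurable_funM; [exact: measurable_cst|exact: mcutG]].
rewrite ge0_integralZl; [|exact: measurableT|exact: mcutG|by move=> y _; exact: cutG0|by rewrite lee_fin].
congr (_ + _); rewrite (integral_mpp hTX w mc1); last by move=> y; rewrite mule_ge0 ?lee_fin.
rewrite (mpp_countE hTX)//; apply: eq_eseriesr => i _; rewrite /mpp_eval; case: ifPn => // Ti.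
rewrite /cut/= (_ : (0 <= fine (T i w))%R)/=; last by apply: fine_ge0; exact/ltW/(mpp_time_gt0 hTX).
by rewrite -EFinM -natrM mulnb.
Qed.

Let intnu w : \int[nu w]_y He y = ct + B w.
Proof.
rewrite (integral_compensator_series m0 hf hTX nuE w mHe He0); congr (_ + _).
  by congr (_ * _); apply: eq_integral => u _; rewrite QHe.
rewrite /B (integral_mpp hTX w mcutG cutG0) -nneseries_mulel ?lee_fin//; last first.
  by move=> i; exact: mpp_eval_ge0.
apply: eq_eseriesr => i _; rewrite /mpp_eval; case: ifPn => Ti; last by rewrite mule0.
have := mpp_time_gt0 hTX i w; rewrite -{1}(mpp_fineK hTX Ti) lte_fin.
move: (fine (T i w)) (odflt _ _) => s x s0 /=.
(* After [t] the cut removes nothing, since [G] vanishes there. *)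
have -> : cut (s, x) * G (s, x) = G (s, x).
  rewrite /cut/= (ltW s0)/=; case: (leP s t) => st; first by rewrite mul1e.
  rewrite mul0e /G integral0_eq// => u _; rewrite /fs /fertility/= subr_gt0 /cp.
  case: ifPn => su; last by rewrite mul0e.
  by rewrite (leNgt u) (lt_trans st su) mul0e mule0.
rewrite /G -ge0_integralZl; [|exact: measurableT|exact: mfscp|by move=> u _; exact: fscp0|by rewrite lee_fin].
rewrite [LHS]integral_mkcond; apply: eq_integral => u _; rewrite patchE QHe /fs /fertility/= subr_gt0.
case: ifPn => [_|]; last first.
  rewrite mem_setE in_itv/= andbT -ltNge => u0.
  by rewrite (_ : (s < u)%R = false) ?mul0e ?mule0//; apply/negbTE; rewrite -leNgt; lra.
case: ifPn => su; last by rewrite !mul0e mule0.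
by rewrite /cp (ltW (lt_trans s0 su))/= [RHS]muleCA; congr (_ * _); exact: muleCA.
Qed.

Let cancel_fin (x y b : \bar R) : b \is a fin_num -> (x + b) - (y + b) = x - y.
Proof.
move: b x y => [b| |] [x| |] [y| |]//= _.
by rewrite -!EFinB; congr (_%:E); ring.
Qed.

Let B_fin w : \int[N w]_y cut y < +oo -> B w \is a fin_num.
Proof.
move=> Nfin; have B0 : 0 <= \int[N w]_y (cut y * G y) by apply: integral_ge0 => y _; exact: cutG0.
rewrite /B fin_numM// ge0_fin_numE//.
apply: (@le_lt_trans _ _ ((M * kap * t)%:E * \int[N w]_y cut y)).
  rewrite -ge0_integralZl; [|exact: measurableT|exact: mcut|by move=> y _; exact: cut0|by rewrite lee_fin !mulr_ge0].
  apply: ge0_le_integral.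
  - exact: measurableT.
  - by move=> y _; exact: cutG0.
  - exact: mcutG.
  - by apply: emeasurable_funM; [exact: measurable_cst|exact: mcut].
  move=> y _; rewrite /cut; case: (boolP (0 <= y.1 <= t)%R) => [/andP[y0 _]|_].
    by rewrite mul1e mule1; exact: G_le.
  by rewrite mul0e mule0.
by rewrite lte_mul_pinfty ?lee_fin ?mulr_ge0.
Qed.

Lemma mpp_count_variance_le : \int[P]_w ((mpp_count N t A w - ct) * (mpp_count N t A w - ct))
  <= (2 + 2 * (kap ^+ 2 * S))%:E * ((1 - q)^-1%:E * (m * t)%:E).
Proof.
have mH : measurable_fun setT H by exact: (measurableT_comp _ mHe).
have H0 y : (0 <= H y)%R by apply: fine_ge0; exact: He0.
have Hc y : (H y <= c)%R by rewrite -lee_fin HE; exact: He_le.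
have Hlt0 y : (y.1 < 0)%R -> H y = 0%R by rewrite /H => /He_lt0 ->.
have Hgt y : (t < y.1)%R -> H y = 0%R by rewrite /H => /He_gt ->.
have iso := isometry_le m0 hf hTX hcomp nuE q01 hq t0 mH H0 Hc Hlt0 Hgt.
have INE w : \int[N w]_y (H y)%:E = \int[N w]_y He y by apply: eq_integral => y _; exact: HE.
have InuE w : \int[nu w]_y (H y)%:E = \int[nu w]_y He y by apply: eq_integral => y _; exact: HE.
have sq0 (x : \bar R) : 0 <= x * x.
  by have [h|h] := leP 0 x; [exact: mule_ge0|rewrite mule_le0// ltW].
have mIN := measurable_integral_mpp_det hTX mHe He0.
have mInu := measurable_integral_compensator_det hTX hcomp mHe He0 He_lt0 He_gt.
have mcount := measurable_mpp_count hTX t mA.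
have mL : measurable_fun setT (fun w => (mpp_count N t A w - ct) * (mpp_count N t A w - ct)).
  by apply: emeasurable_funM; apply: emeasurable_funB => //; exact: measurable_cst.
have mR : measurable_fun setT (fun w => (\int[N w]_y He y - \int[nu w]_y He y) * (\int[N w]_y He y - \int[nu w]_y He y)).
  by apply: emeasurable_funM; exact: (emeasurable_funB mIN mInu).
have -> : \int[P]_w ((mpp_count N t A w - ct) * (mpp_count N t A w - ct)) =
    \int[P]_w ((\int[N w]_y (H y)%:E - \int[nu w]_y (H y)%:E) * (\int[N w]_y (H y)%:E - \int[nu w]_y (H y)%:E)).
  transitivity (\int[P]_w ((\int[N w]_y He y - \int[nu w]_y He y) * (\int[N w]_y He y - \int[nu w]_y He y))).
    (* The term [B] cancels only where it is finite, which holds on the almost sure event of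
       finitely many points up to [t]. *)
    apply: ge0_ae_eq_integral => //.
    apply: filterS (mpp_ae_finite m0 hf hTX hcomp nuE q01 hq t0) => w /B_fin Bf _.
    by rewrite intN intnu cancel_fin.
  by apply: eq_integral => w _; rewrite INE InuE.
apply: le_trans iso _.
have -> : \int[P]_w \int[nu w]_y ((H y)%:E * (H y)%:E) = \int[P]_w \int[nu w]_y (He y * He y).
  by apply: eq_integral => w _; apply: eq_integral => y _; rewrite HE.
apply: (mean_integral_compensator_le m0 hf hTX hcomp nuE q01 hq t0).
- exact: (emeasurable_funM mHe mHe).
- by move=> y; exact: mule_ge0.
- have S0 : (0 <= S)%R by rewrite -lee_fin -hS; apply: integral_ge0 => x _; exact: mule_ge0.
  by rewrite addr_ge0// mulr_ge0// mulr_ge0// sqr_ge0.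
- by move=> y /He_lt0 ->; rewrite mule0.
- by move=> y /He_gt ->; rewrite mule0.
- exact: He_sqr.
Qed.

Lemma centering_integralE : ct = (m * QA)%:E * \int[leb]_(u in `[0%R, t]) psi (t - u)%R.
Proof.
have mpt : measurable_fun [set: R] (fun u : R => psi (t - u)%R).
  by apply: (measurableT_comp mpsi); exact: measurable_funB.
rewrite EFinM -muleA; congr (_ * _).
rewrite -ge0_integralZl; [|exact: measurable_itv|exact: (measurable_funTS mpt)|by move=> u _; exact: psi0|by rewrite lee_fin].
rewrite [LHS]integral_mkcond [RHS]integral_mkcond; apply: eq_integral => u _.
rewrite !patchE !mem_setE !in_itv/= andbT.
by case: (0 <= u)%R => //=; case: (u <= t)%R; rewrite ?mul1e ?mul0e.
Qed.

End hawkes_variance.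

(** * Asymptotics *)

Section resolvent_asymptotics.
Context {R : realType}.
Local Notation leb := (@lebesgue_measure R).
Local Open Scope ereal_scope.
Variables (g : R -> \bar R) (rho : R).
Hypothesis mg : measurable_fun setT g.
Hypothesis g0 : forall s, 0 <= g s.
Hypothesis intg : \int[leb]_s g s = rho%:E.
Let psi v := 1 + \int[leb]_s ((s <= v)%R%:R%:E * g s).

Let mcut (v : R) : measurable_fun setT (fun s : R => (s <= v)%R%:R%:E * g s).
Proof.
apply: emeasurable_funM => //; apply: measurable_natr_bool.
exact: measurable_fun_ler.
Qed.
Let cut0 (v s : R) : 0 <= (s <= v)%R%:R%:E * g s.
Proof. by rewrite mule_ge0 ?lee_fin. Qed.

Lemma measurable_one_primitive : measurable_fun setT psi.
Proof.
apply: emeasurable_funD => //.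
apply: (@measurable_fun_fubini_tonelli_F _ _ _ _ R leb
  (fun z : R * R => (z.2 <= z.1)%R%:R%:E * g z.2)) => [|z]; last exact: cut0.
apply: emeasurable_funM; last exact: measurableT_comp mg measurable_snd.
by apply: measurable_natr_bool; exact: measurable_fun_ler.
Qed.

Lemma one_primitive_ge0 v : 0 <= psi v.
Proof. by rewrite adde_ge0// integral_ge0. Qed.

Lemma one_primitive_le v : psi v <= (1 + rho)%:E.
Proof.
rewrite EFinD leeD2l// -intg; apply: ge0_le_integral; [by []|by move=> s _|exact: mcut|exact: mg|].
by move=> s _; case: (s <= v)%R; rewrite ?mul1e ?mul0e.
Qed.

Lemma one_primitive_nd (v w : R) : (v <= w)%R -> psi v <= psi w.
Proof.
move=> vw; rewrite leeD2l//; apply: ge0_le_integral; [by []|by move=> s _|exact: mcut|exact: mcut|move=> s _].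
rewrite lee_wpmul2r// lee_fin ler_nat.
by case: (leP s v) => // /le_trans->.
Qed.

Lemma one_primitive_near (e : R) : (0 < e)%R ->
  exists2 b, (0 <= b)%R & (1 + rho - e)%:E <= psi b.
Proof.
move=> e0; have := cvg_integral_cut mg g0; rewrite intg.
move=> /fine_cvgP[fin /cvgrPdist_le/(_ e e0) cv].
near \oo => n; exists n%:R => //.
rewrite /psi.
have fn : \int[leb]_s ((s <= n%:R)%R%:R%:E * g s) \is a fin_num by near: n.
have : (`|rho - fine (\int[leb]_s ((s <= n%:R)%R%:R%:E * g s))| <= e)%R by near: n.
rewrite -{2}(fineK fn) -EFinD lee_fin ler_norml => /andP[]; lra.
Unshelve. all: by end_near. Qed.

(** Once its argument exceeds [b], [psi] is within [e] of its limit [1 + rho]. So only the last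
    stretch of [[0, t]], of length [b], escapes the lower bound and costs [(1 + rho) * b]. The
    restriction [e <= 1] keeps [1 + rho - e] nonnegative. *)
Lemma mean_one_primitive_near (e : R) : (0 < e <= 1)%R ->
  exists2 b, (0 <= b)%R & forall t : R, (0 <= t)%R ->
   exists2 c : R, \int[leb]_(u in `[0%R, t]) psi (t - u)%R = c%:E &
     (`|c - (1 + rho) * t| <= (1 + rho) * b + e * t)%R.
Proof.
move=> /andP[e0 e1]; have [b b0 hb] := one_primitive_near e0.
have rho0 : (0 <= rho)%R by rewrite -lee_fin -intg integral_ge0.
exists b => // t t0.
have mp : measurable_fun [set: R] (fun u : R => psi (t - u)%R).
  by apply: (measurableT_comp measurable_one_primitive); exact: measurable_funB.
have lt : leb `[0%R, t] = t%:E.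
  rewrite lebesgue_measure_itv/= lte_fin; case: ltgtP t0 => // [_ _|<- _].
    by rewrite sube0.
  by [].
have up : \int[leb]_(u in `[0%R, t]) psi (t - u)%R <= ((1 + rho) * t)%:E.
  apply: (@le_trans _ _ (\int[leb]_(u in `[0%R, t]) (1 + rho)%:E)).
    apply: ge0_le_integral => //.
    - by move=> u _; exact: one_primitive_ge0.
    - exact: (measurable_funTS mp).
    - by move=> u _; exact: one_primitive_le.
  by rewrite integral_cst// [X in _ * X](_ : _ = t%:E).
have I0 : 0 <= \int[leb]_(u in `[0%R, t]) psi (t - u)%R.
  by apply: integral_ge0 => u _; exact: one_primitive_ge0.
have If : \int[leb]_(u in `[0%R, t]) psi (t - u)%R \is a fin_num.
  by rewrite ge0_fin_numE// (le_lt_trans up)// ltry.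
exists (fine (\int[leb]_(u in `[0%R, t]) psi (t - u)%R)); first by rewrite fineK.
have low : ((1 + rho - e) * (t - b))%:E <= \int[leb]_(u in `[0%R, t]) psi (t - u)%R.
  have [tb|bt] := leP t b.
    by apply: le_trans I0; rewrite lee_fin mulr_ge0_le0; lra.
  apply: (@le_trans _ _ (\int[leb]_(u in `[0%R, (t - b)%R]) psi (t - u)%R)); last first.
    apply: ge0_subset_integral => //.
    - exact: (measurable_funTS mp).
    - by move=> u _; exact: one_primitive_ge0.
    - by move=> u/=; rewrite !in_itv/= => /andP[-> h]/=; rewrite (le_trans h)// gerBl.
  apply: (@le_trans _ _ (\int[leb]_(u in `[0%R, (t - b)%R]) (1 + rho - e)%:E)).
    rewrite integral_cst// [X in _ * X](_ : _ = (t - b)%:E) ?EFinM//.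
    by rewrite /= lebesgue_measure_itv/= lte_fin subr_gt0 bt sube0.
  apply: ge0_le_integral => //.
  - by move=> u _; rewrite lee_fin; lra.
  - exact: (measurable_funTS mp).
  - move=> u /=; rewrite in_itv/= => /andP[_ ub]; apply: le_trans hb _.
    by apply: one_primitive_nd; lra.
move: up low; rewrite -(fineK If) !lee_fin => up low.
rewrite ler_norml; apply/andP; split; nra.
Qed.

End resolvent_asymptotics.

Lemma abse_poweR2 {R : realType} (x : \bar R) : (`|x| `^ 2 = x * x)%E.
Proof.
case: x => [x| |]; last 2 first.
- by rewrite [abse _]/= poweRyr// mulyy.
- by rewrite [abse _]/= poweRyr// mulNyNy.
by rewrite abse_EFin poweR_EFin powR_mulrn// real_normK ?num_real// expr2 EFinM.
Qed.

(** Variance plus bias: [a Z - n] is the sum of [a (Z - c)] and [a c - n], and the square of a sum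
    is at most twice the sum of the squares. *)
Lemma Lnorm2_centering_le {d : measure_display} {Om : measurableType d}
    {R : realType} (P : probability Om R) (Z : Om -> \bar R) (a c n V e : R) :
  measurable_fun setT Z -> (forall w, 0 <= Z w)%E -> 0 < a -> 0 <= e ->
  (\int[P]_w ((Z w - c%:E) * (Z w - c%:E)) <= V%:E)%E ->
  2 * a ^+ 2 * V + 2 * (a * c - n) ^+ 2 <= e ^+ 2 ->
  (Lnorm P 2%:E (fun w => a%:E * Z w - n%:E) <= e%:E)%E.
Proof.
move=> mZ Z0 a0 e0 hV hVe.
have sq0 (x : \bar R) : (0 <= x * x)%E.
  by have [h|h] := leP 0%E x; [exact: mule_ge0|rewrite mule_le0// ltW].
have ms (y : R) (Y : Om -> \bar R) : measurable_fun setT Y ->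
    measurable_fun setT (fun w => (Y w - y%:E) * (Y w - y%:E))%E.
  by move=> mY; apply: emeasurable_funM; apply: emeasurable_funB => //; exact: measurable_cst.
have maZ : measurable_fun setT (fun w => a%:E * Z w)%E.
  by apply: emeasurable_funM => //; exact: measurable_cst.
have H : (\int[P]_w ((a%:E * Z w - n%:E) * (a%:E * Z w - n%:E)) <= (e ^+ 2)%:E)%E.
  apply: (@le_trans _ _ (\int[P]_w ((2 * a ^+ 2)%:E * ((Z w - c%:E) * (Z w - c%:E)) +
      (2 * (a * c - n) ^+ 2)%:E))%E).
    apply: ge0_le_integral.
    - exact: measurableT.
    - by move=> w _.
    - exact: (ms n _ maZ).
    - by apply: emeasurable_funD => //; apply: emeasurable_funM; [exact: measurable_cst|exact: (ms c _ mZ)].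
    move=> w _; case: (Z w) (Z0 w) => [z| |]// z0.
      rewrite -(EFinM a z) -!EFinB -!EFinM -EFinD lee_fin.
      have : 0 <= (a * (z - c) - (a * c - n)) ^+ 2 by exact: sqr_ge0.
      rewrite !expr2; nra.
    have a2 : (0 < (2 * a ^+ 2)%:E)%E by rewrite lte_fin mulr_gt0// exprn_gt0.
    by rewrite [X in (_ <= _ * X + _)%E]mulyy (gt0_muley a2) leey.
  rewrite ge0_integralD; [|exact: measurableT| | | |exact: measurable_cst]; last 3 first.
  - by move=> w _; rewrite mule_ge0// lee_fin mulr_ge0// sqr_ge0.
  - by apply: emeasurable_funM; [exact: measurable_cst|exact: (ms c _ mZ)].
  - by move=> w _; rewrite lee_fin mulr_ge0// sqr_ge0.
  rewrite integral_cst// [X in (_ + _ * X)%E]probability_setT mule1.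
  rewrite ge0_integralZl; [|exact: measurableT|exact: (ms c _ mZ)|by move=> w _|
    by rewrite lee_fin mulr_ge0// sqr_ge0].
  apply: (@le_trans _ _ ((2 * a ^+ 2)%:E * V%:E + (2 * (a * c - n) ^+ 2)%:E)%E).
    by rewrite leeD2r// lee_wpmul2l// lee_fin mulr_ge0// sqr_ge0.
  by rewrite -EFinM -EFinD lee_fin.
rewrite unlock; under eq_integral do rewrite abse_poweR2.
have -> : e%:E = ((e ^+ 2)%:E `^ 2^-1)%E.
  by rewrite poweR_EFin powR12_sqrt ?sqr_ge0// sqrtr_sqr ger0_norm.
apply: gt0_ler_poweR; rewrite ?invr_ge0// in_itv/= ?andbT ?leey ?lee_fin ?sqr_ge0//.
by rewrite integral_ge0.
Qed.

(** Reconciles [fertility], which drops the time 0, with [mean_fertility] and [L1norm], which keep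
    it. *)
Lemma ge0_integral_eq_off {R : realType} (a : R) (g h : R -> \bar R) :
  measurable_fun setT g -> measurable_fun setT h ->
  (forall u, 0 <= g u)%E -> (forall u, 0 <= h u)%E ->
  (forall u, u != a -> g u = h u) ->
  (\int[lebesgue_measure]_u g u = \int[lebesgue_measure]_u h u)%E.
Proof.
move=> mg mh g0 h0 gh; apply: ge0_ae_eq_integral => //.
exists [set a]; split; [exact: measurable_set1|exact: lebesgue_measure_set1|].
by move=> u /= H; apply: contra_notP H => /eqP/gh.
Qed.

(** The bias is at most [e / 2], one quarter of [e] from the slope error [eps] and one from the
    boundary term [kb], so its doubled square is at most [e ^+ 2 / 2]. The variance term takes the
    other half. *)
Lemma scaled_centering_le {R : realFieldType} (e D C kap kb v t eps c : R) :
  0 < e -> 0 <= D -> 0 <= v -> 0 < t ->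
  D * (eps * v) <= e / 4 -> 4 * (D * kb) <= e * t -> 4 * (C * v) <= e ^+ 2 * t ->
  `|c - kap * (t * v)| <= kb + eps * (t * v) ->
  2 * t^-1 ^+ 2 * (C * (t * v)) + 2 * (t^-1 * (D * c) - v * D * kap) ^+ 2 <= e ^+ 2.
Proof.
move=> e0 D0 v0 t0 heps hkb hC hc; have tn : t != 0 by rewrite gt_eqF.
have -> : 2 * t^-1 ^+ 2 * (C * (t * v)) = (4 * (C * v)) / t / 2 by field.
have h1 : (4 * (C * v)) / t <= e ^+ 2 by rewrite ler_pdivrMr.
set z := t^-1 * (D * c) - v * D * kap.
have zE : z = D * (c - kap * (t * v)) / t by rewrite /z; field.
have h2 : `|z| <= e / 2.
  have ti0 : 0 <= t^-1 by rewrite invr_ge0 ltW.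
  rewrite zE !normrM (ger0_norm D0) (ger0_norm ti0) ler_pdivrMr//.
  apply: le_trans (ler_wpM2l D0 hc) _.
  have := ler_wpM2r (ltW t0) heps; nra.
have h3 : z ^+ 2 <= (e / 2) ^+ 2 by rewrite -(real_normK (num_real z)) lerXn2r// ?nnegrE// divr_ge0// ltW.
move: h1 h3; rewrite !expr2; lra.
Qed.

(** * Mark averages and time integrals of the fertility *)

Section mean_fertility.
Context {R : realType} {dE : measure_display} {E : measurableType dE}.
Variables (Q : probability E R) (f : R -> E -> R).
Hypothesis hf : hawkes_fertility Q f.
Local Notation leb := (@lebesgue_measure R).
Local Open Scope ereal_scope.
Let F := mean_fertility Q f.
Let F0 u := if (0 <= u)%R then F u else 0%R.
Let fx (y : R * E) : \bar R := if (0 <= y.1)%R then (f y.1 y.2)%:E else 0.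

Let fx0 y : 0 <= fx y.
Proof. by rewrite /fx; case: ifPn => // y0; rewrite lee_fin; have [_ ->] := hf. Qed.

Let mfx : measurable_fun setT fx.
Proof.
have [mf _ _ _] := hf.
rewrite (_ : fx = (fun y => (f y.1 y.2)%:E) \_ (`[0%R, +oo[%classic `*` setT)).
  apply/(measurable_restrictT _ _).1.
    by apply: measurableX; [exact: measurable_itv|exact: measurableT].
  exact/measurable_EFinP.
apply/funext => -[u x]; rewrite patchE /fx/=.
case: ifPn => u0; first by rewrite mem_set//; split => //=; rewrite in_itv/= u0.
by rewrite memNset//= in_itv/= andbT => -[/(negP u0)].
Qed.

Let fxE (u : R) x : (u != 0)%R -> fertility f (u, x) = fx (u, x).
Proof. by move=> u0; rewrite /fertility /fx/= lt_neqAle eq_sym u0. Qed.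

Let F0E u : \int[Q]_x fx (u, x) = (F0 u)%:E.
Proof.
rewrite /F0; case: ifPn => u0; last first.
  by rewrite integral0_eq// => x _; rewrite /fx/= (negbTE u0).
rewrite /F /mean_fertility /Rintegral fineK; last first.
  have [_ _ [M hM] _] := hf.
  rewrite ge0_fin_numE; last by apply: integral_ge0 => x _; have := fx0 (u, x); rewrite /fx/= u0.
  apply: (@le_lt_trans _ _ (\int[Q]_x (cst M%:E) x)).
    apply: ge0_le_integral => //.
    - by move=> x _; have := fx0 (u, x); rewrite /fx/= u0.
    - have := measurableT_comp mfx (pair1_measurable u).
      by apply: eq_measurable_fun => x _; rewrite /fx/= u0.
    - by move=> x _; rewrite lee_fin hM.
  by rewrite integral_cst// [X in _ * X]probability_setT mule1 ltry.
by apply: eq_integral => x _; rewrite /fx/= u0.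
Qed.

Lemma mean_fertility_ge0 t : (0 <= t)%R -> (0 <= F t)%R.
Proof.
move=> t0; have := F0E t; rewrite /F0 t0 -lee_fin => <-.
by apply: integral_ge0 => x _.
Qed.

Lemma mean_fertility_le M : (forall t x, (0 <= t)%R -> (f t x <= M)%R) ->
  forall t, (0 <= t)%R -> (F t <= M)%R.
Proof.
move=> hM t t0; have := F0E t; rewrite /F0 t0 -lee_fin => <-.
apply: (@le_trans _ _ (\int[Q]_x (cst M%:E) x)).
  apply: ge0_le_integral => //.
  - exact: (measurableT_comp mfx (pair1_measurable t)).
  - by move=> x _; rewrite /fx/= t0 lee_fin hM.
by rewrite integral_cst// [X in _ * X]probability_setT mule1.
Qed.

Lemma measurable_mean_fertility : measurable_fun setT F0.
Proof.
apply/measurable_EFinP; rewrite (_ : EFin \o F0 = fun u => \int[Q]_x fx (u, x)).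
  exact: (@measurable_fun_fubini_tonelli_F _ _ _ _ R Q fx mfx fx0).
by apply/funext => u; rewrite F0E.
Qed.

Lemma L1norm_mean_fertility : L1norm F = \int[leb]_u (F0 u)%:E.
Proof.
rewrite /L1norm integral_mkcond; apply: eq_integral => u _.
rewrite patchE mem_setE in_itv/= andbT /F0; case: ifPn => // u0.
by rewrite ger0_norm// mean_fertility_ge0.
Qed.

Lemma integral_fertility_time x : \int[leb]_u fertility f (u, x) = L1norm (fun t => f t x).
Proof.
rewrite /L1norm [RHS]integral_mkcond.
transitivity (\int[leb]_u fx (u, x)).
  apply: (@ge0_integral_eq_off _ 0%R).
  - exact: (measurableT_comp (measurable_fertility hf) (pair2_measurable x)).
  - exact: (measurableT_comp mfx (pair2_measurable x)).
  - by move=> u; exact: (fertility_ge0 hf).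
  - by move=> u; exact: fx0.
  - by move=> u u0; exact: fxE.
apply: eq_integral => u _; rewrite patchE mem_setE in_itv/= andbT /fx/=; case: ifPn => // u0.
by rewrite ger0_norm//; have [_ ->] := hf.
Qed.

Lemma integral_fertility_mark (b : R -> \bar R) : measurable_fun setT b -> (forall u, 0 <= b u) ->
  \int[leb]_u (\int[Q]_x fertility f (u, x) * b u) = \int[leb]_u ((F0 u)%:E * b u).
Proof.
move=> mb b0; apply: (@ge0_integral_eq_off _ 0%R).
- apply: emeasurable_funM => //.
  exact: (@measurable_fun_fubini_tonelli_F _ _ _ _ R Q (fertility f)
    (measurable_fertility hf) (fertility_ge0 hf)).
- by apply: emeasurable_funM => //; apply/measurable_EFinP; exact: measurable_mean_fertility.
- by move=> u; apply: mule_ge0 => //; apply: integral_ge0 => x _; exact: (fertility_ge0 hf).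
- by move=> u; apply: mule_ge0 => //; rewrite -F0E; apply: integral_ge0.
- by move=> u u0; rewrite -F0E; congr (_ * _); apply: eq_integral => x _; exact: fxE.
Qed.

Lemma integral_fertility : \int[Q]_x \int[leb]_u fertility f (u, x) = L1norm F.
Proof.
rewrite -(@fubini_tonelli _ _ _ _ R leb Q (fertility f) (measurable_fertility hf) (fertility_ge0 hf)).
rewrite L1norm_mean_fertility.
have := @integral_fertility_mark (cst 1) (measurable_cst _) (fun=> lee01).
by under eq_integral do rewrite mule1; move=> ->; apply: eq_integral => u _; rewrite mule1.
Qed.

End mean_fertility.

Lemma L1norm_resolvent {R : realType} (F r : R -> R) :
  (forall t, 0 <= t -> 0 <= F t) -> (forall t, 0 <= t -> r t + F t <= 0) ->
  L1norm (fun t => - r t) =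
  (\int[lebesgue_measure]_s (- (if (0 <= s)%R then r s else 0))%:E)%E.
Proof.
move=> F0 rF; rewrite /L1norm integral_mkcond; apply: eq_integral => s _.
rewrite patchE mem_setE in_itv/= andbT; case: ifPn => [s0|_]; last by rewrite oppr0.
by rewrite /= ger0_norm//; have := F0 s s0; have := rF s s0; lra.
Qed.

Lemma ge0_cvge_pinfty0 {R : realType} (g : R -> \bar R) : (forall t, 0 <= g t)%E ->
  (forall e : R, 0 < e -> \forall t \near +oo, (g t <= e%:E)%E) ->
  g t @[t --> +oo] --> 0%E.
Proof.
move=> g0 H; apply/fine_cvgP; split.
  near=> t; rewrite ge0_fin_numE// (@le_lt_trans _ _ 1%:E)// ?ltry//.
  by near: t; exact: H.
apply/cvgrPdist_le => e e0; near=> t.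
have gt : (g t <= e%:E)%E by near: t; exact: H.
rewrite sub0r normrN ger0_norm ?fine_ge0//= -lee_fin fineK//.
by rewrite ge0_fin_numE// (le_lt_trans gt)// ltry.
Unshelve. all: by end_near. Qed.

Theorem theorem4p1 (R : realType) (dO dE : measure_display)
  (Omega : measurableType dO) (P : probability Omega R)
  (E : measurableType dE) (hE : borel_space R E)
  (Q : probability E R) (m : R) (hm : 0 <= m)
  (f : R -> E -> R) (hf : hawkes_fertility Q f)
  (T : nat -> Omega -> \bar R) (X : nat -> Omega -> option E)
  (hN : marked_hawkes_process P Q m f T X)
  (r : R -> R) (hr : resolvent_opp (mean_fertility Q f) r)
  (hF1 : (L1norm (mean_fertility Q f) < 1)%E)
  (hF2 : (\int[lebesgue_measure]_(t in `[0%R, +oo[%classic)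
            (t * mean_fertility Q f t)%:E < +oo)%E)
  (A : set E) (hA : measurable A) :
  let N := mpp_measure T X in
  let Res := fun t => - r t in
  let nu := fun v : R => v * m * fine (Q A) * (fine (L1norm Res) + 1) in
  forall v : R, 0 <= v ->
    Lnorm P 2%:E (fun w => t^-1%:E * mpp_count N (t * v)%R A w - (nu v)%:E)%E
      @[t --> +oo] --> 0%E.
Proof.
move=> N Res nu v v0.
have [hTX [comp hcomp compE]] := hN.
have [_ f0 [M fM] fS] := hf.
have F_ge0 := mean_fertility_ge0 hf.
have F_le := mean_fertility_le hf fM.
have mF := measurable_mean_fertility hf.
have LF := L1norm_mean_fertility hf.
pose q := fine (L1norm (mean_fertility Q f)).
have L0 : (0 <= L1norm (mean_fertility Q f))%E by apply: integral_ge0.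
have Lq : L1norm (mean_fertility Q f) = q%:E.
  by rewrite fineK// ge0_fin_numE// (lt_trans hF1)// ltry.
have q01 : 0 <= q < 1 by rewrite -!lee_fin -lte_fin -Lq L0.
have q1 : q < 1 by case/andP: q01.
have intF := etrans (esym LF) Lq.
pose g (s : R) : \bar R := (- (if 0 <= s then r s else 0))%:E.
have rF := resolvent_le0 mF F_ge0 F_le intF q1 hr.
have g0 s : (0 <= g s)%E.
  rewrite lee_fin; case: ifPn => [s0|_]; last by rewrite oppr0.
  by have := F_ge0 s s0; have := rF s s0; lra.
have mg : measurable_fun setT g.
  by apply/measurable_EFinP; apply: measurableT_comp => //; exact: measurable_resolvent hr.
pose rho := fine (L1norm Res).
have intg : (\int[lebesgue_measure]_s g s = rho%:E)%E.
  have ig0 : (0 <= \int[lebesgue_measure]_s g s)%E by apply: integral_ge0 => s _.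
  rewrite /rho (L1norm_resolvent F_ge0 rF) -/g fineK// ge0_fin_numE//.
  exact: resolvent_L1_lty mF F_ge0 F_le intF q1 hr.
pose psi v := (1 + \int[lebesgue_measure]_s ((s <= v)%R%:R%:E * g s))%E.
have mpsi : measurable_fun setT psi := measurable_one_primitive mg g0.
have psi0 : (forall v, 0 <= psi v)%E := one_primitive_ge0 g0.
have psi_le : (forall v, psi v <= (1 + rho)%:E)%E := one_primitive_le mg g0 intg.
have psiE w : 0 <= w -> (psi w = 1 + \int[lebesgue_measure]_u
    (\int[Q]_x fertility f (u, x) * ((u <= w)%R%:R%:E * psi (w - u)%R)))%E.
  move=> _; rewrite (integral_fertility_mark hf (b := fun u => (u <= w)%R%:R%:E * psi (w - u)%R)%E).
  - exact: resolvent_renewal mF F_ge0 F_le intF q1 hr w.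
  - apply: emeasurable_funM.
      by apply: measurable_natr_bool; exact: measurable_fun_ler.
    by apply: (measurableT_comp mpsi); exact: measurable_funB.
  - by move=> u; rewrite mule_ge0 ?lee_fin.
have hq := etrans (integral_fertility hf) Lq.
pose S := fine (\int[Q]_x (L1norm (fun t => f t x)) ^+ 2)%E.
have hS : (\int[Q]_x (\int[lebesgue_measure]_u fertility f (u, x) *
    \int[lebesgue_measure]_u fertility f (u, x)) = S%:E)%E.
  rewrite fineK; last first.
    by rewrite ge0_fin_numE// integral_ge0// => x _; rewrite expe_ge0// integral_ge0.
  by apply: eq_integral => x _; rewrite (integral_fertility_time hf) expe2.
pose kap := 1 + rho; pose D := m * fine (Q A).
have D0 : 0 <= D by rewrite mulr_ge0// fine_ge0.
pose C := (2 + 2 * (kap ^+ 2 * S)) * ((1 - q)^-1 * m).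
apply: ge0_cvge_pinfty0 => [t|e e0]; first exact: Lnorm_ge0.
(* The minimum with 1 is required by [mean_one_primitive_near]; the added 1 keeps the denominator
   positive when [D * v] is 0. *)
pose eps := Num.min 1 (e / 4 / (D * v + 1)).
have Dv0 : 0 <= D * v by rewrite mulr_ge0.
have eps01 : 0 < eps <= 1.
  by rewrite lt_min ltr01/= ge_min lexx andbT !divr_gt0//; lra.
have epsD : D * (eps * v) <= e / 4.
  have : eps <= e / 4 / (D * v + 1) by rewrite ge_min lexx orbT.
  rewrite ler_pdivlMr; last lra.
  by have /andP[+ _] := eps01; nra.
have [b b0 hb] := mean_one_primitive_near mg g0 intg eps01.
near=> t.
have t0 : 0 < t by near: t; exact: nbhs_pinfty_gt.
have tv0 : 0 <= t * v by rewrite mulr_ge0// ltW.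
have [c cE hc] := hb _ tv0.
(* The count up to [t * v] is centered at [D * c], and its variance is at most linear in [t * v], so
   division by [t ^+ 2] leaves a term of order [1 / t]. *)
apply: (@Lnorm2_centering_le _ _ _ _ _ _ (D * c) _ (C * (t * v))).
- exact: measurable_mpp_count.
- by move=> w; exact: measure_ge0.
- by rewrite invr_gt0.
- exact: ltW.
- have := mpp_count_variance_le hm hf hTX hcomp compE q01 hq fM hS mpsi psi0 psi_le psiE hA tv0.
  rewrite (centering_integralE _ _ mpsi psi0 _ hA) cE -EFinM -EFinM -/D.
  have -> // : C * (t * v) = (2 + 2 * (kap ^+ 2 * S)) * ((1 - q)^-1 * (m * (t * v))).
  by rewrite /C; ring.
- rewrite (_ : nu v = v * D * kap); last by rewrite /nu /D /kap -/rho; ring.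
  apply: (scaled_centering_le e0 D0 v0 t0 epsD _ _ hc).
  (* [b] and [C] were fixed before [t], so a large [t] beats both the boundary term and the variance
     bound. *)
  + by rewrite -ler_pdivrMl//; near: t; apply: nbhs_pinfty_ge; exact: num_real.
  + rewrite -ler_pdivrMl ?exprn_gt0//; near: t; apply: nbhs_pinfty_ge; exact: num_real.
Unshelve. all: by end_near. Qed.
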